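(* Let $q\in\mathbb{C}^*$ be not a root of unity, $j_1,j_2\in\frac12\mathbb{N}$, $a,b,u_1,u_2\in\mathbb{C}^*$. The pairs $(\mathcal{A}_{12},\mathcal{B}_{21})$ and $(\mathcal{A}_{21},\mathcal{B}_{12})$ of linear operators on $V=\mathbb{C}_{2j_1}[z_1]\otimes\mathbb{C}_{2j_2}[z_2]$ are tridiagonal pairs of $q$-Racah type if and only if: (i) for any $\varepsilon_1,\varepsilon_2\in\{\pm1\}$, the $q$-strings $S(2j_1,(q/u_1^2)^{\varepsilon_1})$ and $S(2j_2,(q/u_2^2)^{\varepsilon_2})$ are in general position; (ii) for $i=1,2$, $ab,\ a/b\notin S(2j_i,q/u_i^2)\cup S(2j_i,(q/u_i^2)^{-1})$; (iii) $\pm a,\pm b\notin\{q^{-2j_1-2j_2+1},\dots,q^{2j_1+2j_2-1}\}$ (all integer powers $q^m$ with $|m|\le 2j_1+2j_2-1$).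
   Context: $\mathbb{C}_{2j}[z]$ is the space of polynomials in $z$ of degree at most $2j$. Operators on $V$, with $\alpha=a+a^{-1}$, $\beta=b+b^{-1}$, $T^{(1)}_\pm f(z_1,z_2)=f(q^{\pm1}z_1,z_2)$, $T^{(2)}_\pm f(z_1,z_2)=f(z_1,q^{\pm1}z_2)$, $i=1,2$: $\mathcal{A}_i=u_iz_iq^{j_i}+u_i^{-1}z_i^{-1}q^{-j_i}-u_i^{-1}q^{-j_i}z_i^{-1}(1-z_iu_iq^{-j_i}a)(1-z_iu_iq^{-j_i}a^{-1})(T^{(i)}_+)^2$, $\mathcal{B}_i=u_i^{-1}z_iq^{-j_i}+u_iz_i^{-1}q^{j_i}-u_iq^{j_i}z_i^{-1}(1-z_iu_i^{-1}q^{j_i}b)(1-z_iu_i^{-1}q^{j_i}b^{-1})(T^{(i)}_-)^2$, $\mathcal{A}_{12}=\mathcal{A}_1+q^{-2j_1}(T^{(1)}_+)^2(\mathcal{A}_2-\alpha)$, $\mathcal{B}_{12}=\mathcal{B}_2+(\mathcal{B}_1-\beta)q^{2j_2}(T^{(2)}_-)^2$, $\mathcal{A}_{21}=\mathcal{A}_2+(\mathcal{A}_1-\alpha)q^{-2j_2}(T^{(2)}_+)^2$, $\mathcal{B}_{21}=\mathcal{B}_1+q^{2j_1}(T^{(1)}_-)^2(\mathcal{B}_2-\beta)$. Tridiagonal (TD) pair: for a finite-dimensional nonzero $\mathbb{C}$-vector space $V$, an ordered pair of linear maps $\mathsf{A},\mathsf{A}^*:V\to V$ such that (1) both are diagonalizable;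 (2) there is an ordering $V_0,\dots,V_d$ of the eigenspaces of $\mathsf{A}$ with $\mathsf{A}^*V_p\subseteq V_{p-1}+V_p+V_{p+1}$ for $0\le p\le d$ ($V_{-1}=V_{d+1}=0$); (3) there is an ordering $V_0^*,\dots,V_\delta^*$ of the eigenspaces of $\mathsf{A}^*$ with $\mathsf{A}V_p^*\subseteq V_{p-1}^*+V_p^*+V_{p+1}^*$ for $0\le p\le\delta$ ($V^*_{-1}=V^*_{\delta+1}=0$); (4) no subspace $W$ other than $0,V$ satisfies $\mathsf{A}W\subseteq W$ and $\mathsf{A}^*W\subseteq W$. It is of $q$-Racah type if the eigenvalues $\theta_p$ of $\mathsf{A}$ on $V_p$ and $\theta_p^*$ of $\mathsf{A}^*$ on $V_p^*$ (for such orderings) have the form $\theta_p=e\,q^{2p}+f\,q^{-2p}$, $\theta_p^*=e^*q^{2p}+f^*q^{-2p}$ with $e,f,e^*,f^*\in\mathbb{C}^*$. $q$-strings: for $v\in\mathbb{C}^*$, $d\in\mathbb{N}$, $S(d,v)=\{vq^{2i-d+1}\mid 0\le i\le d-1\}$. Two $q$-strings $S(d,v),S(d',v')$ are in general position if either $S(d,v)\cup S(d',v')$ is not a $q$-string, or $S(d,v)\subseteq S(d',v')$, or $S(d,v)\supseteq S(d',v')$. *)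

(* Defs.v *)
From HB Require Import structures.
From mathcomp Require Import all_boot all_order all_algebra.
From mathcomp Require Import ring reals complex.

Set Implicit Arguments.
Unset Strict Implicit.
Unset Printing Implicit Defensive.

Import Order.TTheory GRing.Theory Num.Theory.

Local Open Scope ring_scope.

(* bipoly F m n is F_m[z1] (x) F_n[z2], seen as the space of the polynomials  *)
(* f(z1, z2) of degree at most m in z1 and at most n in z2. In                *)
(* {poly {poly F}} the outer variable 'X is z1 and the inner one, 'X%:P, is   *)
(* z2.                                                                        *)
Section Bipoly.
Variables (F : fieldType) (m n : nat).

Definition bounded_bidegree : pred {poly {poly F}} := fun f =>
  (size f <= m.+1)%N && all (fun g : {poly F} => (size g <= n.+1)%N) f.

Lemma bounded_bidegreeP (f : {poly {poly F}}) :
  reflect (forall i k, (m < i)%N || (n < k)%N -> f`_i`_k = 0)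
          (bounded_bidegree f).
Proof.
apply: (iffP andP) => [[sf /allP af] i k /orP[im|nk] | H].
- by rewrite (nth_default _ (leq_trans sf im)) coef0.
- have [fi|fi] := leqP (size f) i; first by rewrite (nth_default _ fi) coef0.
  by rewrite (nth_default _ (leq_trans (af _ (mem_nth 0 fi)) nk)).
split.
  apply/leq_sizeP => i mi; apply/polyP => k.
  by rewrite coef0 H // mi.
apply/allP => g /(nthP 0)[i _ <-]; apply/leq_sizeP => k nk.
by rewrite H // nk orbT.
Qed.

Fact bounded_zmod_closed : zmod_closed bounded_bidegree.
Proof.
split=> [|f g /bounded_bidegreeP Hf /bounded_bidegreeP Hg];
  apply/bounded_bidegreeP => i k h; first by rewrite !coef0.
by rewrite !coefB Hf // Hg // subrr.
Qed.

HB.instance Definition _ :=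
  GRing.isZmodClosed.Build {poly {poly F}} bounded_bidegree
    bounded_zmod_closed.

Record bipoly : predArgType := Bipoly {
  bival :> {poly {poly F}};
  _ : bival \in bounded_bidegree
}.

HB.instance Definition _ := [isSub for bival].
HB.instance Definition _ := [Choice of bipoly by <:].
HB.instance Definition _ := [SubChoice_isSubZmodule of bipoly by <:].

Lemma bival_bounded (f : bipoly) : bival f \in bounded_bidegree.
Proof. by case: f. Qed.

Fact bipoly_scale_subproof (c : F) (f : bipoly) :
  c%:P *: bival f \in bounded_bidegree.
Proof.
apply/bounded_bidegreeP => i k h; rewrite coefZ coefCM.
by rewrite (bounded_bidegreeP _ (bival_bounded f)) // mulr0.
Qed.

Definition bipoly_scale c f : bipoly := Bipoly (bipoly_scale_subproof c f).

Fact bipoly_scalerA a b v :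
  bipoly_scale a (bipoly_scale b v) = bipoly_scale (a * b) v.
Proof. by apply: val_inj; rewrite /= scalerA polyCM. Qed.

Fact bipoly_scale1r : left_id 1 bipoly_scale.
Proof. by move=> v; apply: val_inj; rewrite /= polyC1 scale1r. Qed.

Fact bipoly_scalerDr : right_distributive bipoly_scale +%R.
Proof. by move=> a u v; apply: val_inj; rewrite /= scalerDr. Qed.

Fact bipoly_scalerDl v : {morph bipoly_scale^~ v : a b / a + b}.
Proof. by move=> a b; apply: val_inj; rewrite /= polyCD scalerDl. Qed.

HB.instance Definition _ := GRing.Zmodule_isLmodule.Build F bipoly
  bipoly_scalerA bipoly_scale1r bipoly_scalerDr bipoly_scalerDl.

Lemma bivalD (f g : bipoly) : bival (f + g) = bival f + bival g.
Proof. by []. Qed.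

Lemma bivalZ (c : F) (f : bipoly) : bival (c *: f) = c%:P *: bival f.
Proof. by []. Qed.

Fact bitrunc_subproof (E : nat -> nat -> F) :
  \poly_(i < m.+1) \poly_(k < n.+1) E i k \in bounded_bidegree.
Proof.
apply/bounded_bidegreeP => i k h; rewrite coef_poly.
case: ltnP => im; last by rewrite coef0.
rewrite coef_poly; case: ltnP => kn //.
by move: h; rewrite ltnNge -ltnS im ltnNge -ltnS kn.
Qed.

Definition bitrunc (f : {poly {poly F}}) : bipoly :=
  Bipoly (bitrunc_subproof (fun i k => f`_i`_k)).

Lemma coef_bitrunc f i k : (bival (bitrunc f))`_i`_k =
  if (i < m.+1)%N && (k < n.+1)%N then f`_i`_k else 0.
Proof.
rewrite coef_poly; case: ltnP => _ /=; last by rewrite coef0.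
by rewrite coef_poly.
Qed.

Lemma bitruncK f : f \in bounded_bidegree -> bival (bitrunc f) = f.
Proof.
move=> /bounded_bidegreeP H; apply/polyP => i; apply/polyP => k.
rewrite coef_bitrunc; case: ifPn => //; rewrite negb_and -!leqNgt => h.
by rewrite H.
Qed.

Lemma bipolyP (f g : bipoly) :
  (forall i k, (i < m.+1)%N -> (k < n.+1)%N ->
     (bival f)`_i`_k = (bival g)`_i`_k) -> f = g.
Proof.
move=> H; apply: val_inj => /=.
rewrite -(bitruncK (bival_bounded f)) -(bitruncK (bival_bounded g)).
apply/polyP => i; apply/polyP => k; rewrite !coef_bitrunc.
by case: ifP => // /andP[]; apply: H.
Qed.

Definition bipoly_mx (f : bipoly) : 'M[F]_(m.+1, n.+1) :=
  \matrix_(i, k) (bival f)`_i`_k.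

Definition mx_bipoly (M : 'M[F]_(m.+1, n.+1)) : bipoly :=
  Bipoly (bitrunc_subproof (fun i k => M (inord i) (inord k))).

Lemma bipoly_mxK : cancel bipoly_mx mx_bipoly.
Proof.
move=> f; apply: bipolyP => i k im kn.
by rewrite coef_poly im coef_poly kn mxE !inordK.
Qed.

Lemma mx_bipolyK : cancel mx_bipoly bipoly_mx.
Proof.
move=> M; apply/matrixP => i k.
by rewrite mxE coef_poly ltn_ord coef_poly ltn_ord !inord_val.
Qed.

Fact bipoly_vect_axiom : Vector.axiom (m.+1 * n.+1) bipoly.
Proof.
exists (mxvec \o bipoly_mx).
  move=> c f g /=; rewrite -linearP /=; congr mxvec; apply/matrixP => i k.
  by rewrite !mxE bivalD bivalZ coefD coefZ coefD coefCM.
exists (mx_bipoly \o vec_mx) => x /=.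
  by rewrite mxvecK bipoly_mxK.
by rewrite mx_bipolyK vec_mxK.
Qed.

HB.instance Definition _ := Lmodule_hasFinDim.Build F bipoly
  bipoly_vect_axiom.

(* lift1 L applies L : K[z1] -> K[z1], K = F[z2], in the variable z1, and     *)
(* lift2 L applies L : F[z2] -> F[z2] to the coefficients of f as a           *)
(* polynomial in z1, that is, in the variable z2. The truncation makes both   *)
(* unconditionally defined; it does nothing when L respects the degree bound  *)
(* (lift1E and lift2E), as the operators used below do.                       *)
Definition lift1_fun (L : {linear {poly {poly F}} -> {poly {poly F}}})
  (f : bipoly) : bipoly := bitrunc (L (bival f)).
Definition lift2_fun (L : {linear {poly F} -> {poly F}})
  (f : bipoly) : bipoly := bitrunc (map_poly L (bival f)).

Fact lift1_linear L : linear (lift1_fun L).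
Proof.
move=> c f g; apply: bipolyP => i k im kn; rewrite /lift1_fun.
rewrite [in RHS]bivalD [in RHS]bivalZ !(coefD, coefZ, coefCM) !coef_bitrunc.
by rewrite im kn bivalD bivalZ linearP !(coefD, coefZ, coefCM).
Qed.

Fact lift2_linear L : linear (lift2_fun L).
Proof.
move=> c f g; apply: bipolyP => i k im kn; rewrite /lift2_fun.
rewrite [in RHS]bivalD [in RHS]bivalZ !(coefD, coefZ, coefCM) !coef_bitrunc.
rewrite im kn bivalD bivalZ !coef_map_id0 ?linear0 // coefD coefZ.
by rewrite mul_polyC linearP !(coefD, coefZ).
Qed.

HB.instance Definition _ (L : {linear {poly {poly F}} -> {poly {poly F}}}) :=
  GRing.isLinear.Build F bipoly bipoly _
  (lift1_fun L) (lift1_linear L).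
HB.instance Definition _ (L : {linear {poly F} -> {poly F}}) :=
  GRing.isLinear.Build F bipoly bipoly _
  (lift2_fun L) (lift2_linear L).

Definition lift1 (L : {linear {poly {poly F}} -> {poly {poly F}}}) : 'End(bipoly) := linfun (lift1_fun L).
Definition lift2 (L : {linear {poly F} -> {poly F}}) : 'End(bipoly) := linfun (lift2_fun L).

Lemma lift1E (L : {linear {poly {poly F}} -> {poly {poly F}}}) f : L (bival f) \in bounded_bidegree ->
  bival (lift1 L f) = L (bival f).
Proof. by move=> h; rewrite lfunE; apply: bitruncK. Qed.

Lemma lift2E (L : {linear {poly F} -> {poly F}}) f : map_poly L (bival f) \in bounded_bidegree ->
  bival (lift2 L f) = map_poly L (bival f).
Proof. by move=> h; rewrite lfunE; apply: bitruncK. Qed.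

End Bipoly.

(* The operators in one variable z = 'X, over a ring K of scalars. The        *)
(* parameter h stands for q^j.                                                *)
Section OneVariable.
Variable K : comUnitRingType.
Implicit Types (q u h a b c : K) (f : {poly K}).

Definition dilate c f : {poly K} := f \Po (c *: 'X).

(* z^-1 only occurs in front of polynomials which vanish at z = 0 (opA_E and  *)
(* opB_E), where it is drop_poly 1.                                           *)
Definition opA q u h a f : {poly K} :=
  (u * h) *: ('X * f)
  + (u^-1 * h^-1) *: drop_poly 1
      (f - (1 - (u * h^-1 * a) *: 'X) * (1 - (u * h^-1 * a^-1) *: 'X)
           * dilate q (dilate q f)).

Definition opB q u h b f : {poly K} :=
  (u^-1 * h^-1) *: ('X * f)
  + (u * h) *: drop_poly 1
      (f - (1 - (u^-1 * h * b) *: 'X) * (1 - (u^-1 * h * b^-1) *: 'X)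
           * dilate q^-1 (dilate q^-1 f)).

Lemma coef_dilate c f i : (dilate c f)`_i = c ^+ i * f`_i.
Proof.
rewrite /dilate comp_polyE.
under eq_bigr do rewrite exprZn scalerA.
rewrite coef_sum; under eq_bigr do rewrite coefZ coefXn.
have [fi|fi] := ltnP i (size f).
  rewrite (bigD1 (Ordinal fi)) //= eqxx mulr1 mulrC big1 ?addr0 // => j.
  by rewrite -val_eqE /= eq_sym => /negPf->; rewrite mulr0.
rewrite nth_default // mulr0 big1 // => j _.
by case: eqP => [e|]; rewrite ?mulr0 // -e in fi *; move: fi; rewrite leqNgt e ltn_ord.
Qed.

Fact dilate_linear c : linear (dilate c).
Proof. by move=> k f g; rewrite /dilate comp_polyD comp_polyZ. Qed.
HB.instance Definition _ c :=
  GRing.isLinear.Build K {poly K} {poly K} _ (dilate c) (dilate_linear c).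

Fact opA_linear q u h a : linear (opA q u h a).
Proof.
move=> k f g; rewrite /opA; set W := (1 - _) * (1 - _).
have -> : k *: f + g - W * dilate q (dilate q (k *: f + g)) =
    k *: (f - W * dilate q (dilate q f))
    + (g - W * dilate q (dilate q g)).
  by rewrite !linearP /= mulrDr -scalerAr scalerBr opprD addrACA.
rewrite linearP /= mulrDr -scalerAr !scalerDr !scalerA.
by rewrite [k * (u * h)]mulrC [k * (u^-1 * h^-1)]mulrC addrACA.
Qed.
HB.instance Definition _ q u h a := GRing.isLinear.Build K {poly K} {poly K} _
  (opA q u h a) (opA_linear q u h a).

Fact opB_linear q u h b : linear (opB q u h b).
Proof.
move=> k f g; rewrite /opB; set W := (1 - _) * (1 - _).
have -> : k *: f + g - W * dilate q^-1 (dilate q^-1 (k *: f + g)) =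
    k *: (f - W * dilate q^-1 (dilate q^-1 f))
    + (g - W * dilate q^-1 (dilate q^-1 g)).
  by rewrite !linearP /= mulrDr -scalerAr scalerBr opprD addrACA.
rewrite linearP /= mulrDr -scalerAr !scalerDr !scalerA.
by rewrite [k * (u * h)]mulrC [k * (u^-1 * h^-1)]mulrC addrACA.
Qed.
HB.instance Definition _ q u h b := GRing.isLinear.Build K {poly K} {poly K} _
  (opB q u h b) (opB_linear q u h b).

Lemma opB_opA q u h b f : opB q u h b f = opA q^-1 u^-1 h^-1 b f.
Proof. by rewrite /opA !invrK. Qed.

Lemma opA_E q u h a f : 'X * opA q u h a f =
  (u * h) *: ('X^2 * f)
  + (u^-1 * h^-1) *:
      (f - (1 - (u * h^-1 * a) *: 'X) * (1 - (u * h^-1 * a^-1) *: 'X)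
           * dilate q (dilate q f)).
Proof.
rewrite /opA; set d := f - _.
have d0 : d`_0 = 0.
  by rewrite coefB -!horner_coef0 !hornerE !horner_coef0 !coef_dilate !mul1r;
    rewrite !(mulr0, subr0, mul1r) subrr.
have dE : d = drop_poly 1 d * 'X.
  rewrite -[LHS](poly_take_drop 1) expr1 [take_poly _ _](_ : _ = 0) ?add0r //.
  by apply/polyP => -[|i]; rewrite coef_take_poly coef0 //= d0.
by rewrite mulrDr -!scalerAr mulrA -expr2 {2}dE [_ * 'X]mulrC.
Qed.

Lemma opB_E q u h b f : 'X * opB q u h b f =
  (u^-1 * h^-1) *: ('X^2 * f)
  + (u * h) *:
      (f - (1 - (u^-1 * h * b) *: 'X) * (1 - (u^-1 * h * b^-1) *: 'X)
           * dilate q^-1 (dilate q^-1 f)).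
Proof. by rewrite opB_opA opA_E !invrK. Qed.

Lemma coef_opA q u h a f k : (opA q u h a f)`_k =
  (if k is k'.+1 then
     (u * h - u^-1 * h^-1 * (u * h^-1 * a) * (u * h^-1 * a^-1) * (q * q) ^+ k')
     * f`_k' else 0)
  + u^-1 * h^-1 * (u * h^-1 * a + u * h^-1 * a^-1) * (q * q) ^+ k * f`_k
  + u^-1 * h^-1 * (1 - (q * q) ^+ k.+1) * f`_k.+1.
Proof.
rewrite /opA; move: (u * h^-1 * a) (u * h^-1 * a^-1) => x y.
rewrite coefD !coefZ coefXM coef_drop_poly addn1 coefB.
set g := dilate q _.
have gE i : g`_i = (q * q) ^+ i * f`_i by rewrite !coef_dilate mulrA exprMn.
have -> : (1 - x *: 'X) * (1 - y *: 'X) * g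
    = g - (x + y) *: ('X * g) + (x * y) *: ('X * ('X * g)).
  rewrite -!mul_polyC polyCD polyCM; ring.
rewrite !coefD coefN !coefZ !coefXM !gE /=.
by case: k => [|k] /=; rewrite ?gE; ring.
Qed.

End OneVariable.

Section Operators.
Variables (F : fieldType) (m n : nat).
Local Notation V := (bipoly F m n).

(* m = 2 j_1, n = 2 j_2, and s is a square root of q, so that q^{j_1} and     *)
(* q^{j_2} are s^m and s^n.                                                   *)
Variable s : F.
Let q := s ^+ 2.

Definition dil1 (c : F) : 'End(V) := lift1 m n (dilate c%:P).
Definition dil2 (c : F) : 'End(V) := lift2 m n (dilate c).

Definition A1 (u a : F) : 'End(V) :=
  lift1 m n (opA q%:P u%:P (s ^+ m)%:P a%:P).
Definition A2 (u a : F) : 'End(V) := lift2 m n (opA q u (s ^+ n) a).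
Definition B1 (u b : F) : 'End(V) :=
  lift1 m n (opB q%:P u%:P (s ^+ m)%:P b%:P).
Definition B2 (u b : F) : 'End(V) := lift2 m n (opB q u (s ^+ n) b).

Definition A12 (u1 u2 a : F) : 'End(V) :=
  (A1 u1 a + q ^- m *: (dil1 q \o dil1 q \o (A2 u2 a - (a + a^-1) *: \1)))%VF.

Definition B12 (u1 u2 b : F) : 'End(V) :=
  (B2 u2 b + ((B1 u1 b - (b + b^-1) *: \1)
              \o (q ^+ n *: (dil2 q^-1 \o dil2 q^-1))))%VF.

Definition A21 (u1 u2 a : F) : 'End(V) :=
  (A2 u2 a + ((A1 u1 a - (a + a^-1) *: \1)
              \o (q ^- n *: (dil2 q \o dil2 q))))%VF.

Definition B21 (u1 u2 b : F) : 'End(V) :=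
  (B1 u1 b
   + q ^+ m *: (dil1 q^-1 \o dil1 q^-1 \o (B2 u2 b - (b + b^-1) *: \1)))%VF.

Lemma dil1E c (f : V) : bival (dil1 c f) = dilate c%:P (bival f).
Proof.
apply: lift1E; apply/bounded_bidegreeP => i k h; rewrite coef_dilate.
by rewrite -polyC_exp coefCM (bounded_bidegreeP _ _ _ (bival_bounded f)) ?mulr0.
Qed.

Lemma dil2E c (f : V) : bival (dil2 c f) = map_poly (dilate c) (bival f).
Proof.
apply: lift2E; apply/bounded_bidegreeP => i k h.
rewrite coef_map_id0 ?linear0 // coef_dilate.
by rewrite (bounded_bidegreeP _ _ _ (bival_bounded f)) ?mulr0.
Qed.

Fact opA_top (p u a r : F) (d : nat) : u != 0 -> a != 0 -> r != 0 ->
  p = r ^+ 2 ->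
  u * r ^+ d - u^-1 * (r ^+ d)^-1 * (u * (r ^+ d)^-1 * a)
               * (u * (r ^+ d)^-1 * a^-1) * (p * p) ^+ d = 0.
Proof.
move=> u0 a0 r0 ->; have := expf_neq0 d r0.
have -> : (r ^+ 2 * r ^+ 2) ^+ d = (r ^+ d) ^+ 4.
  by rewrite -exprD -!exprM mulnC.
by move: (r ^+ d) => h h0; field; rewrite u0 a0 h0.
Qed.

Fact opA1_bounded (p u a r : F) (f : V) : u != 0 -> a != 0 -> r != 0 ->
  p = r ^+ 2 ->
  opA p%:P u%:P (r ^+ m)%:P a%:P (bival f) \in bounded_bidegree m n.
Proof.
move=> u0 a0 r0 pE; have f0 := bounded_bidegreeP _ _ _ (bival_bounded f).
apply/bounded_bidegreeP => i k h; rewrite coef_opA.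
have coefMC (g : {poly F}) c j : (g * c)`_j = (c * g)`_j by rewrite mulrC.
have C1 : (1 : {poly F}) = 1%:P by [].
rewrite !polyCV C1 -?(polyCM, polyCD, polyCN, polyCB, polyC_exp).
rewrite !coefD -?polyCB !coefCM (f0 i) // (f0 i.+1); last first.
  by case/orP: h => [/leqW->|->]; rewrite ?orbT.
rewrite !mulr0 !addr0; case: i h => [|i] h; first by rewrite coef0.
rewrite -!(polyCM, polyC_exp, polyCB) coefCM.
have [e|im] := eqVneq i m.
  by rewrite e opA_top // mul0r.
rewrite f0 ?mulr0 //; case/orP: h => [|->]; last by rewrite orbT.
by rewrite ltnS leq_eqVlt eq_sym (negPf im) => /= ->.
Qed.

Fact opA2_bounded (p u a r : F) (f : V) : u != 0 -> a != 0 -> r != 0 ->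
  p = r ^+ 2 ->
  map_poly (opA p u (r ^+ n) a) (bival f) \in bounded_bidegree m n.
Proof.
move=> u0 a0 r0 pE; have f0 := bounded_bidegreeP _ _ _ (bival_bounded f).
apply/bounded_bidegreeP => i k h; rewrite coef_map_id0 ?linear0 // coef_opA.
rewrite (f0 i k) // (f0 i k.+1); last first.
  by case/orP: h => [->|/leqW->]; rewrite ?orbT.
rewrite !mulr0 !addr0; case: k h => [|k] h //.
have [e|im] := eqVneq k n.
  by rewrite e opA_top // mul0r.
rewrite f0 ?mulr0 //; case/orP: h => [->//|].
by rewrite ltnS leq_eqVlt eq_sym (negPf im) => /= ->; rewrite orbT.
Qed.

Hypothesis s0 : s != 0.

Lemma A1E u a (f : V) : u != 0 -> a != 0 ->
  bival (A1 u a f) = opA q%:P u%:P (s ^+ m)%:P a%:P (bival f).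
Proof. by move=> u0 a0; apply: lift1E; apply: opA1_bounded. Qed.

Lemma A2E u a (f : V) : u != 0 -> a != 0 ->
  bival (A2 u a f) = map_poly (opA q u (s ^+ n) a) (bival f).
Proof. by move=> u0 a0; apply: lift2E; apply: opA2_bounded. Qed.

Lemma B1E u b (f : V) : u != 0 -> b != 0 ->
  bival (B1 u b f) = opB q%:P u%:P (s ^+ m)%:P b%:P (bival f).
Proof.
move=> u0 b0; apply: lift1E => /=; rewrite opB_opA !polyCV -[(s ^+ m)^-1]exprVn.
by apply: opA1_bounded; rewrite ?invr_eq0 // /q exprVn.
Qed.

Lemma B2E u b (f : V) : u != 0 -> b != 0 ->
  bival (B2 u b f) = map_poly (opB q u (s ^+ n) b) (bival f).
Proof.
move=> u0 b0; apply: lift2E => /=.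
rewrite (eq_map_poly (opB_opA _ _ _ _)) -[(s ^+ n)^-1]exprVn.
by apply: opA2_bounded; rewrite ?invr_eq0 // /q exprVn.
Qed.

End Operators.

Section TridiagonalPairs.
Variables (K : fieldType) (V : vectType K).
Implicit Types (A B : 'End(V)) (th : seq K).

Definition diagonalizable_end A :=
  exists2 X : seq V, basis_of fullv X &
    forall x, x \in X -> exists c, A x = c *: x.

(* An ordering V_0, ..., V_d of the eigenspaces of A, given by the list of    *)
(* the corresponding eigenvalues.                                             *)
Definition eigenspace_ordering A th :=
  uniq th /\ forall c, passmx.leigenvalue A c = (c \in th).

Definition eigenspace_at A th p : {vspace V} :=
  if (p < size th)%N then passmx.leigenspace A th`_p else 0%VS.

Definition tridiagonal_ordering A B th :=
  eigenspace_ordering A th /\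
  forall p, (p < size th)%N ->
    (B @: eigenspace_at A th p <=
       (if p is p'.+1 then eigenspace_at A th p' else 0)
       + eigenspace_at A th p + eigenspace_at A th p.+1)%VS.

Record tridiagonal_pair A B : Prop := TridiagonalPair {
  td_nonzero : \dim {:V} != 0%N;
  td_diag : diagonalizable_end A;
  td_diag_dual : diagonalizable_end B;
  td_ordering : exists th, tridiagonal_ordering A B th;
  td_ordering_dual : exists th, tridiagonal_ordering B A th;
  td_irreducible : forall W : {vspace V},
    (A @: W <= W)%VS -> (B @: W <= W)%VS -> W = 0%VS \/ W = fullv
}.

Definition qRacah_form (q : K) th :=
  exists e f : K, [/\ e != 0, f != 0 &
    forall p, (p < size th)%N ->
      th`_p = e * q ^+ (2 * p) + f * q ^- (2 * p)].

Definition qRacah_tridiagonal_pair (q : K) A B :=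
  [/\ tridiagonal_pair A B,
      exists2 th, tridiagonal_ordering A B th & qRacah_form q th
    & exists2 th, tridiagonal_ordering B A th & qRacah_form q th].

End TridiagonalPairs.

(* Finite subsets of K are given by lists, compared with =i.                  *)
Section QStrings.
Variables (K : fieldType) (q : K).

Definition qstring (d : nat) (v : K) : seq K :=
  [seq v * q ^ (2%:Z * i%:Z - d%:Z + 1) | i <- iota 0 d].

Definition is_qstring (S : seq K) :=
  exists d v, v != 0 /\ S =i qstring d v.

Definition general_position (d : nat) (v : K) (d' : nat) (v' : K) :=
  [\/ ~ is_qstring (qstring d v ++ qstring d' v'),
      {subset qstring d v <= qstring d' v'}
    | {subset qstring d' v' <= qstring d v}].

End QStrings.

(* Main.v *)
(* Write A for A12 and B for B21 (A21 and B12 reduce to them by exchanging z1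
   and z2), and note that B is A with q, u1, u2, a replaced by q^-1, u1^-1,
   u2^-1, b. There are explicit products Psi k1 k2 of linear factors on which A
   acts by the scalar theta (k1 + k2) modulo Psi (k1+1) k2 and Psi k1 (k2+1),
   and B by a scalar modulo Psi (k1-1) k2 and Psi k1 (k2-1); they form a basis
   under (ii). The resulting flags for (a, b) and (a^-1, b) are opposite, which
   makes each of A and B act tridiagonally on the eigenspaces of the other,
   and (iii) says that the theta's are distinct.

   For irreducibility, an invariant subspace which contains Psi 0 0 is
   everything: from the span of the Psi of degree j one reaches a multiple
   mu j of Psi (j+1) 0, and mu j factors into (i) and (ii). A diagonal bilinear
   form makes A and B adjoint to their analogues with u_i replaced by q / u_i,
   so an invariant subspace without vector of top B-eigenvalue has an
   orthogonal which contains the analogue of Psi 0 0, hence vanishes.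

   Conversely, if (i) or (ii) fails, the polynomials vanishing on a finite set
   of lines z2 = const or z1 = g z2 form an invariant subspace, after replacing
   some of the parameters a, b, u_1, u_2 by a^-1, b^-1, q / u_1, q / u_2. If
   (iii) fails, A or B is not diagonalizable because A has a cyclic vector. *)

From HB Require Import structures.
Require Import Defs.
From mathcomp Require Import all_boot all_order all_algebra.
From mathcomp Require Import boolp.
From mathcomp Require Import ring zify reals complex.

Set Implicit Arguments.
Unset Strict Implicit.
Unset Printing Implicit Defensive.

Import Order.TTheory GRing.Theory Num.Theory.

Local Open Scope ring_scope.

(** * Tridiagonal orderings from annihilating products *)

(** The eigenvalue of [A12] attached to [Psi k1 k2] depends on [k1 + k2] only, so eigenspaces have
    dimension greater than one in general and no explicit eigenbasis is at hand. Diagonalizability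
    and the tridiagonal relations are therefore expressed by products of factors [A - t] which
    vanish on vectors; such statements follow from flags alone. The same multiplicity is the
    obstacle to irreducibility: modulo higher degree, [A12] is a scalar on the [Psi] of degree j,
    and raising them yields j + 1 relations among the j + 2 vectors of degree j + 1. The missing
    relation comes from the boundary of the grid once j has reached m or n, and from [mu j] before
    that. In the converse, the lines z2 = const are tied to the pair ([A12], [B21]) and give (ii)
    for i = 2 only; (ii) for i = 1 is read off from the other pair. Condition (ii) has to precede
    (i): the replacement of u_2 alone by q / u_2 is obtained by comparing two bases [Psi2], which
    are bases because of (ii). *)

Section Halves.
Variables (K : fieldType) (V : vectType K).
Implicit Types (A B : 'End(V)) (th ts : seq K) (v w : V).

(** A polynomial in [A] with roots [ts], applied to a vector. Keeping the roots as a list turns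
    commutation and divisibility into permutation and concatenation. *)
Definition factors A ts v := foldr (fun t w => A w - t *: w) v ts.

Lemma factors_cons A t ts v : factors A (t :: ts) v = A (factors A ts v) - t *: factors A ts v.
Proof. by []. Qed.

Lemma factors_linear A ts : linear (factors A ts).
Proof.
move=> c v w; elim: ts => [|t ts IH] //=.
by rewrite IH linearP /= scalerDr !scalerA mulrC -!scalerA scalerBr opprD addrACA.
Qed.

HB.instance Definition _ A ts :=
  GRing.isLinear.Build K V V _ (factors A ts) (factors_linear A ts).

Lemma factors_comm A ts v : factors A ts (A v) = A (factors A ts v).
Proof. by elim: ts => //= t ts ->; rewrite [RHS]linearB [in RHS]linearZ /=. Qed.

Lemma factors_cat A ts ts' v : factors A (ts ++ ts') v = factors A ts (factors A ts' v).
Proof. by rewrite /factors foldr_cat. Qed.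

Lemma factors_catC A ts ts' v : factors A (ts ++ ts') v = factors A (ts' ++ ts) v.
Proof.
rewrite !factors_cat; elim: ts => //= t ts ->.
by rewrite [RHS]linearB [in RHS]linearZ /= factors_comm.
Qed.

Lemma factors_perm A ts ts' v : perm_eq ts ts' -> factors A ts v = factors A ts' v.
Proof.
elim: ts ts' => [|t ts IH] ts' p.
  by move: p; rewrite perm_sym => /perm_nilP ->.
have /splitPr e : t \in ts' by rewrite -(perm_mem p) mem_head.
case: e p => s1 s2; rewrite -[t :: s2]cat1s perm_sym perm_catCA perm_cons.
rewrite perm_sym => /IH e.
by rewrite -[t :: ts]cat1s factors_cat e -factors_cat catA factors_cat factors_catC -factors_cat -catA.
Qed.

Lemma factors_rem A ts t v : t \in ts -> factors A ts v = factors A (t :: rem t ts) v.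
Proof. by move=> h; apply/factors_perm/perm_to_rem. Qed.

Lemma factors_eigen A ts c v : A v = c *: v ->
  factors A ts v = (\prod_(t <- ts) (c - t)) *: v.
Proof.
move=> e; elim: ts => /= [|t ts ->]; first by rewrite big_nil scale1r.
by rewrite linearZ /= e big_cons !scalerA -scalerBl [_ * c]mulrC -mulrBl.
Qed.

(** If P is the product over the tail [ts], then [P v] is an eigenvector for [t], on which P acts by
    the nonzero scalar [c]. Hence [y = c^-1 P v] is the component of [v] at [t], and P kills
    [v - y]. *)
Lemma factors_decomp A ts v : uniq ts -> factors A ts v = 0 ->
  exists2 w : K -> V, v = \sum_(t <- ts) w t &
    forall t, t \in ts -> A (w t) = t *: w t.
Proof.
elim: ts v => [|t ts IH] v /=.
  by move=> _ ->; exists (fun _ => 0); rewrite ?big_nil.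
move=> /andP[tts uts] /eqP; rewrite subr_eq0 => /eqP ev.
have c0 : \prod_(t' <- ts) (t - t') != 0.
  rewrite prodf_seq_neq0; apply/allP => t' t'ts /=.
  by rewrite subr_eq0; apply: contraNneq tts => ->.
set c := \prod_(_ <- _) _ in c0; pose y := c^-1 *: factors A ts v.
have Ay : A y = t *: y by rewrite linearZ /= ev !scalerA mulrC.
have [|w vw wE] := IH (v - y) uts.
  rewrite linearB /= (factors_eigen _ Ay) scalerA divff // scale1r subrr //.
exists (fun t' => if t' == t then y else w t') => [|t'].
  rewrite big_cons eqxx -[LHS](subrK y) vw addrC; congr (_ + _).
  rewrite !big_seq; apply: eq_bigr => i its; case: eqP => // e.
  by rewrite -e its in tts.
by rewrite inE; case: eqP => [-> _|_ /= /wE].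
Qed.

Definition neighbours th p :=
  (if p is p'.+1 then [:: th`_p'] else [::]) ++ th`_p ::
  (if (p.+1 < size th)%N then [:: th`_p.+1] else [::]).

(* A tridiagonal ordering, expressed without eigenspaces. The vector that no  *)
(* (size th).-1 factors annihilate makes all the entries of th eigenvalues;   *)
(* the last clause is the tridiagonal relation, because the product over the  *)
(* neighbours of p annihilates exactly the sum of their eigenspaces.          *)
Definition half_tridiagonal A B th :=
  [/\ uniq th, forall v, factors A th v = 0,
      exists v, forall ts, size ts = (size th).-1 -> factors A ts v != 0 &
      forall p v, (p < size th)%N -> A v = th`_p *: v ->
        factors A (neighbours th p) (B v) = 0].

Lemma leigenspaceP A c v :
  reflect (A v = c *: v) (v \in passmx.leigenspace A c).
Proof.
rewrite memv_ker add_lfunE opp_lfunE scale_lfunE id_lfunE subr_eq0.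
exact: eqP.
Qed.

Lemma leigenvalueP A c :
  reflect (exists2 v, v != 0 & A v = c *: v) (passmx.leigenvalue A c).
Proof.
apply: (iffP idP) => [h|[v v0 /leigenspaceP h]].
  exists (vpick (passmx.leigenspace A c)); first by rewrite vpick0.
  by apply/leigenspaceP; apply: memv_pick.
by apply: contraNneq v0 => e; rewrite -memv0 -e.
Qed.

Lemma half_ordering A B th : half_tridiagonal A B th -> tridiagonal_ordering A B th.
Proof.
case=> uth A0 [v0 v0P] tri; split.
  split=> // c; apply/leigenvalueP/idP => [[v vn0 Av]|cth].
    have /eqP := A0 v; rewrite (factors_eigen _ Av) scaler_eq0 (negPf vn0) orbF.
    rewrite prodf_seq_eq0 => /hasP[t tth /=]; rewrite subr_eq0.
    by move/eqP->.
  exists (factors A (rem c th) v0); first by apply: v0P; rewrite size_rem.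
  have := A0 v0; rewrite (factors_rem _ _ cth) /= => /eqP.
  by rewrite subr_eq0 => /eqP.
move=> p pth; apply/subvP => x /memv_imgP[v]; rewrite {1}/eigenspace_at pth.
move=> /leigenspaceP Av ->.
have un : uniq (neighbours th p).
  have H i j : (i < size th)%N -> (j < size th)%N -> (i != j) ->
      (th`_i == th`_j) = false by move=> *; rewrite nth_uniq //; apply/negbTE.
  rewrite /neighbours; case: p pth {Av} => [|p] pth; case: ifP => //= h;
  by rewrite ?inE !H //; lia.
have [w -> wP] := factors_decomp un (tri _ _ pth Av).
have at_ i : (i < size th)%N -> th`_i \in neighbours th p ->
    w th`_i \in eigenspace_at A th i.
  by move=> hi /wP h; rewrite /eigenspace_at hi; apply/leigenspaceP.
move: at_; rewrite /neighbours; case: p pth {Av un wP} => [|p] pth at_; rewrite big_cat /=.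
  rewrite big_nil add0r big_cons add0v; apply: memv_add.
    by apply: at_; rewrite // inE eqxx.
  case: ifP at_ => h at_; last by rewrite big_nil mem0v.
  by rewrite big_seq1; apply: at_; rewrite // !inE eqxx orbT.
rewrite big_seq1 big_cons addrA; apply: memv_add; first apply: memv_add.
- by apply: at_; rewrite ?inE ?eqxx //; lia.
- by apply: at_; rewrite ?inE ?eqxx ?orbT //.
case: ifP at_ => h at_; last by rewrite big_nil mem0v.
by rewrite big_seq1; apply: at_; rewrite // !inE eqxx !orbT.
Qed.

Lemma half_diag A B th : half_tridiagonal A B th -> diagonalizable_end A.
Proof.
case=> uth A0 _ _.
pose U (i : 'I_(size th)) := passmx.leigenspace A th`_i.
have full : (\sum_i U i)%VS = fullv.
  apply/eqP; rewrite eqEsubv subvf /=; apply/subvP => v _.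
  have [w -> wP] := factors_decomp uth (A0 v).
  rewrite (big_nth 0) big_mkord; apply: memv_sumr => i _.
  by apply/leigenspaceP; apply/wP/mem_nth.
have dir : directv (\sum_i U i).
  apply/directv_sum_independent => u uU u0 i _.
  have Hu j : A (u j) = th`_j *: u j by apply/leigenspaceP; apply: uU.
  (* The product over the other eigenvalues kills all summands but the one at [i], on which it acts
     by a nonzero scalar. *)
  have := congr1 (factors A (rem th`_i th)) u0; rewrite linear0 linear_sum /=.
  rewrite (bigD1 i) //= big1 ?addr0 => [|j ji].
    rewrite (factors_eigen _ (Hu i)) => /eqP; rewrite scaler_eq0.
    case/orP => [|/eqP //]; rewrite prodf_seq_eq0 => /hasP[t].
    by rewrite mem_rem_uniq // inE /= => /andP[ti _]; rewrite subr_eq0 eq_sym (negPf ti).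
  rewrite (factors_eigen _ (Hu j)); apply/eqP; rewrite scaler_eq0; apply/orP; left.
  rewrite prodf_seq_eq0; apply/hasP; exists th`_j; last by rewrite /= subrr.
  by rewrite mem_rem_uniq // inE /= mem_nth // nth_uniq // ji.
exists (\big[cat/[::]]_i vbasis (U i)).
  rewrite -full; apply: bigcat_basis => // i _; exact: vbasisP.
move=> x; elim/big_ind: _ => // [s1 s2 H1 H2|i _].
  by rewrite mem_cat => /orP[/H1|/H2].
by move=> /vbasis_mem /leigenspaceP h; exists th`_i.
Qed.

Definition irreducible_pair A B := forall W : {vspace V},
  (A @: W <= W)%VS -> (B @: W <= W)%VS -> W = 0%VS \/ W = fullv.

Lemma td_of_halves A B thA thB q :
  half_tridiagonal A B thA -> half_tridiagonal B A thB -> irreducible_pair A B ->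
  qRacah_form q thA -> qRacah_form q thB -> qRacah_tridiagonal_pair q A B.
Proof.
move=> hA hB iAB qA qB; have oA := half_ordering hA; have oB := half_ordering hB.
split; [|by exists thA|by exists thB].
split; [|exact: half_diag hA|exact: half_diag hB|by exists thA|by exists thB|by []].
case: hA => _ _ [v vP] _; apply/eqP => d0.
have /vP : size (nseq (size thA).-1 (0 : K)) = (size thA).-1 by rewrite size_nseq.
have -> : v = 0.
  by apply/eqP; rewrite -memv0 -(eqP (_ : fullv == 0%VS)) ?memvf // -dimv_eq0 d0.
by rewrite linear0 eqxx.
Qed.
End Halves.

(** * Transport of pairs along isomorphisms and along bilinear forms *)

Section Transport.
Variables (K : fieldType) (V V' : vectType K) (T : 'Hom(V, V')).
Variables (A B : 'End(V)) (A' B' : 'End(V')).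
Hypotheses (Tinj : lker T = 0%VS) (Tsurj : limg T = fullv).
Hypotheses (TA : forall v, T (A v) = A' (T v)) (TB : forall v, T (B v) = B' (T v)).

Let Tpre v' : exists v, v' = T v.
Proof.
have : v' \in limg T by rewrite Tsurj memvf.
by move=> /memv_imgP[v _ ->]; exists v. Qed.

Let T0 v : T v = 0 -> v = 0.
Proof. by move/eqP; rewrite -memv_ker Tinj memv0 => /eqP. Qed.

Lemma transport_factors ts v : T (factors A ts v) = factors A' ts (T v).
Proof. by elim: ts => //= t ts <-; rewrite [LHS]linearB [in LHS]linearZ /= TA. Qed.

Lemma transport_half th : half_tridiagonal A' B' th -> half_tridiagonal A B th.
Proof.
case=> uth A0 [v0 v0P] tri; split=> //.
- by move=> v; apply: T0; rewrite transport_factors.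
- have [v e] := Tpre v0; exists v => ts /v0P; apply: contraNneq => h.
  by rewrite e -transport_factors h linear0.
move=> p v pth Av; apply: T0; rewrite transport_factors TB; apply: tri => //.
by rewrite -TA Av linearZ.
Qed.

Lemma transport_irr : irreducible_pair A' B' -> irreducible_pair A B.
Proof.
move=> I W AW BW.
have inv (C : 'End(V)) (C' : 'End(V')) : (forall v, T (C v) = C' (T v)) ->
    (C @: W <= W)%VS -> (C' @: (T @: W) <= T @: W)%VS.
  move=> TC /subvP CW; apply/subvP => _ /memv_imgP[_ /memv_imgP[v vW ->] ->].
  by rewrite -TC memv_img // CW // memv_img.
have [e|e] := I _ (inv _ _ TA AW) (inv _ _ TB BW); [left|right].
  apply/eqP; rewrite -subv0; apply/subvP => v vW; rewrite memv0; apply/eqP/T0.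
  by apply/eqP; rewrite -memv0 -e memv_img.
apply/eqP; rewrite eqEsubv subvf /=; apply/subvP => v _.
have /memv_imgP[w wW /eqP] : T v \in (T @: W)%VS by rewrite e memvf.
by rewrite -subr_eq0 -linearB => /eqP/T0/eqP; rewrite subr_eq0 => /eqP->.
Qed.
End Transport.

Lemma lfun_of_basis (K : fieldType) (V : vectType K)
    (X X' : (\dim {:V}).-tuple V) :
  basis_of fullv X -> basis_of fullv X' ->
  exists2 T : 'End(V), lker T = 0%VS &
    forall i : 'I_(\dim {:V}), T X`_i = X'`_i.
Proof.
move=> bX bX'.
have E v : passmx.hommx X X' 1%:M v = passmx.vecof X' (passmx.rVof X v).
  by rewrite passmx.hommxE // mulmx1.
exists (passmx.hommx X X' 1%:M).
  apply/eqP; rewrite -subv0; apply/subvP => v; rewrite memv_ker E.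
  by rewrite passmx.vecof_eq0 ?passmx.rVof_eq0 ?memv0 // (basis_free bX').
by move=> i; rewrite E passmx.rVofE ?passmx.vecof_delta // (basis_free bX).
Qed.

Section Orth.
Variables (K : fieldType) (V : vectType K) (g : V -> V -> K).
Hypotheses (gl : forall w, scalar (g^~ w)) (gr : forall v, scalar (g v)).
Hypotheses (ndl : forall v, (forall w, g v w = 0) -> v = 0).
Hypotheses (ndr : forall w, (forall v, g v w = 0) -> w = 0).

(** The orthogonal is the kernel of the vector of pairings with a basis of [W], so its codimension
    is at most [\dim W]. *)
Lemma orth_exists (W : {vspace V}) : exists W' : {vspace V},
  (forall v, v \in W' <-> forall w, w \in W -> g v w = 0) /\
  (W' = 0%VS -> W = fullv).
Proof.
pose f v := \row_(i < \dim W) g v (vbasis W)`_i.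
have fl : linear f.
  move=> c v w; apply/rowP => i; rewrite !mxE; exact: gl.
pose fL := GRing.isLinear.Build K V 'rV[K]_(\dim W) _ f fl.
pose F : {linear V -> 'rV[K]_(\dim W)} := HB.pack f fL.
exists (lker (linfun F)); split.
  move=> v; rewrite memv_ker lfunE /=; split=> [/eqP/rowP fv w /coord_vbasis ->|H].
    have g0 : g v 0 = 0 by have := gr v (-1) 0 0; rewrite scaler0 addr0 mulN1r addNr.
    rewrite (big_morph (g v) (id1 := 0) (op1 := +%R)) // => [|x y]; last first.
      by have := gr v 1 x y; rewrite scale1r mul1r.
    rewrite big1 // => i _.
    have := gr v (coord (vbasis W) i w) (vbasis W)`_i 0; rewrite addr0 g0 => ->.
    by have := fv i; rewrite !mxE => ->; rewrite mulr0 addr0.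
  apply/eqP/rowP => i; rewrite !mxE; apply: H.
  by apply/vbasis_mem/mem_nth; rewrite size_tuple.
move=> k0; apply/eqP; rewrite -[_ == _](dimv_leqif_eq (subvf W)) eqn_leq dimvS ?subvf //=.
have := limg_ker_dim (linfun F) fullv; rewrite capfv k0 dimv0 add0n => <-.
by rewrite (leq_trans (dimvS (subvf _))) // dimvf /dim /= mul1n.
Qed.

Variables (A B A' B' : 'End(V)).
Hypotheses (gA : forall v w, g (A v) w = g v (A' w)).
Hypotheses (gB : forall v w, g (B v) w = g v (B' w)).

(** The orthogonal of a subspace stable under the adjoints is stable under the operators, and taking
    orthogonals exchanges the two trivial subspaces. *)
Lemma orth_irr : irreducible_pair A B -> irreducible_pair A' B'.
Proof.
move=> I W /subvP A'W /subvP B'W; have [W' [W'P W'0]] := orth_exists W.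
have inv (C C' : 'End(V)) : (forall v w, g (C v) w = g v (C' w)) ->
    {subset (C' @: W)%VS <= W} -> (C @: W' <= W')%VS.
  move=> CC' C'W; apply/subvP => _ /memv_imgP[v /W'P vW' ->].
  by apply/W'P => w wW; rewrite CC'; apply/vW'/C'W/memv_img.
have [/W'0|e] := I _ (inv _ _ gA A'W) (inv _ _ gB B'W); [by right|left].
apply/eqP; rewrite -subv0; apply/subvP => w wW; rewrite memv0; apply/eqP/ndr => v.
by have /W'P : v \in W' by [rewrite e memvf]; apply.
Qed.
End Orth.

(** * The operators on functions of (z1, z2) *)

Section Evaluation.
Variables (F : fieldType) (m n : nat).
Local Notation V := (bipoly F m n).
Implicit Types (f g : V) (x y c : F).

Definition ev f x y := (bival f).[x%:P].[y].

Lemma evD f g x y : ev (f + g) x y = ev f x y + ev g x y.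
Proof. by rewrite /ev bivalD !hornerD. Qed.

Lemma evZ c f x y : ev (c *: f) x y = c * ev f x y.
Proof. by rewrite /ev bivalZ hornerZ hornerM hornerC. Qed.

Lemma ev0 x y : ev 0 x y = 0.
Proof. by rewrite /ev /= !horner0. Qed.

Lemma ev_coef f x y :
  ev f x y = \sum_(i < m.+1) \sum_(k < n.+1) (bival f)`_i`_k * x ^+ i * y ^+ k.
Proof.
have /andP[sf _] := bival_bounded f.
rewrite /ev (horner_coef_wide _ sf) horner_sum.
apply: eq_bigr => i _; rewrite -rmorphXn hornerM hornerC.
have sfi : (size ((bival f)`_i)%R <= n.+1)%N.
  apply/leq_sizeP => k nk; apply: (bounded_bidegreeP _ _ _ (bival_bounded f)).
  by rewrite nk orbT.
rewrite (horner_coef_wide _ sfi) mulr_suml; apply: eq_bigr => k _.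
by rewrite mulrAC.
Qed.

(* Allows to compare operators through their action on functions, evaluated   *)
(* at powers of q only: x and y are invertible there.                         *)
Lemma ev_inj (z : nat -> F) f g : injective z ->
  (forall i j, ev f (z i) (z j) = ev g (z i) (z j)) -> f = g.
Proof.
have poly0 (K : idomainType) (w : nat -> K) (p : {poly K}) : injective w ->
    (forall i, p.[w i] = 0) -> p = 0.
  move=> iw pw; apply/eqP; apply: contraTT isT => p0.
  have : uniq [seq w i | i <- iota 0 (size p)] by rewrite map_inj_uniq ?iota_uniq.
  move=> /(max_poly_roots p0) H; have {H} := H _; rewrite size_map size_iota ltnn.
  by apply; apply/allP => _ /mapP[i _ ->]; apply/rootP.
move=> iz H; apply: val_inj; apply/eqP; rewrite -subr_eq0; apply/eqP.
apply: (@poly0 {poly F} (fun i => (z i)%:P)) => [i j /polyC_inj /iz //|i].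
apply: (poly0 _ z) => // j; rewrite !hornerE; apply/eqP; rewrite subr_eq0.
exact/eqP/H.
Qed.

Lemma bounded_poly2 (p : {poly {poly F}}) : (size p <= m.+1)%N ->
  (forall i, (size (p`_i)%R <= n.+1)%N) -> p \in bounded_bidegree m n.
Proof.
move=> sp spi; apply/bounded_bidegreeP => i k /orP[im|nk].
  by rewrite (nth_default _ (leq_trans sp im)) coef0.
by rewrite nth_default // (leq_trans (spi i)).
Qed.

Definition tens (p r : {poly F}) : V := bitrunc m n (map_poly polyC p * r%:P).

Lemma tens_coef (p r : {poly F}) i k : (bival (tens p r))`_i`_k =
  if (i < m.+1)%N && (k < n.+1)%N then p`_i * r`_k else 0.
Proof. by rewrite coef_bitrunc coefMC coef_map coefCM. Qed.

Lemma ev_tens (p r : {poly F}) x y : (size p <= m.+1)%N -> (size r <= n.+1)%N ->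
  ev (tens p r) x y = p.[x] * r.[y].
Proof.
move=> sp sr; rewrite ev_coef (horner_coef_wide _ sp) (horner_coef_wide _ sr).
rewrite mulr_suml; apply: eq_bigr => i _; rewrite mulr_sumr.
apply: eq_bigr => k _; rewrite tens_coef !ltn_ord /=; ring.
Qed.

Lemma tens_linl r : linear (tens^~ r).
Proof.
move=> c p p'; apply: bipolyP => i k im kn.
rewrite bivalD bivalZ !(coefD, coefZ, coefCM) !tens_coef im kn /=.
by rewrite coefD coefZ mulrDl mulrA.
Qed.

Lemma tens_linr p : linear (tens p).
Proof.
move=> c r r'; apply: bipolyP => i k im kn.
rewrite bivalD bivalZ !(coefD, coefZ, coefCM) !tens_coef im kn /=.
by rewrite coefD coefZ; ring.
Qed.

Lemma tens_span f :
  f = \sum_(i < m.+1) \sum_(k < n.+1) (bival f)`_i`_k *: tens 'X^i 'X^k.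
Proof.
apply: bipolyP => i k im kn.
have bs (I : Type) (r : seq I) (E : I -> V) : bival (\sum_(i <- r) E i) = \sum_(i <- r) bival (E i).
  by apply: (big_morph (@bival F m n)).
rewrite bs coef_sum; under eq_bigr => i' _ do rewrite bs coef_sum.
rewrite coef_sum (bigD1 (Ordinal im)) //= [X in _ + X]big1 ?addr0; last first.
  move=> i'; rewrite -val_eqE /= => ii'; rewrite coef_sum big1 // => k' _.
  by rewrite ?bivalZ coefZ coefCM ?tens_coef im kn /= coefXn eq_sym (negPf ii') mul0r mulr0.
rewrite coef_sum (bigD1 (Ordinal kn)) //= [X in _ + X]big1 ?addr0; last first.
  move=> k'; rewrite -val_eqE /= => kk'.
  by rewrite ?bivalZ coefZ coefCM ?tens_coef im kn /= !coefXn [k == k']eq_sym (negPf kk') !mulr0.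
by rewrite ?bivalZ coefZ coefCM ?tens_coef im kn /= !coefXn !eqxx !mulr1.
Qed.

Lemma bipoly_span (M : {vspace V}) :
  (forall i k, (i <= m)%N -> (k <= n)%N -> tens 'X^i 'X^k \in M) -> M = fullv.
Proof.
move=> H; apply/eqP; rewrite eqEsubv subvf /=; apply/subvP => f _.
rewrite (tens_span f); apply: memv_suml => i _; apply: memv_suml => k _.
by apply/memvZ/H; rewrite -ltnS ltn_ord.
Qed.

End Evaluation.

Section Action.
Variables (F : fieldType) (m n : nat) (s : F).
Hypothesis s0 : s != 0.
Local Notation V := (bipoly F m n).
Implicit Types (f g : V) (x y c u a b : F).
Let q := s ^+ 2.

Lemma horner_dilate (K : comUnitRingType) (p : {poly K}) (c x : K) :
  (dilate c p).[x] = p.[c * x].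
Proof. by rewrite /dilate horner_comp !hornerE. Qed.

Lemma horner_opA (K : comUnitRingType) (p u h a x : K) (f : {poly K}) :
  x * (opA p u h a f).[x] = u * h * x ^+ 2 * f.[x] + u^-1 * h^-1 *
    (f.[x] - (1 - u * h^-1 * a * x) * (1 - u * h^-1 * a^-1 * x) * f.[p * (p * x)]).
Proof.
have := congr1 (horner^~ x) (opA_E p u h a f).
rewrite !hornerM hornerX => ->; rewrite !(hornerE, horner_dilate) /=; ring.
Qed.

(** Powers of [x%:P] are scalars for the [F]-linear map [L], so an operator in z2 commutes with the
    evaluation of z1. *)
Lemma horner_map_linear (L : {linear {poly F} -> {poly F}}) (p : {poly {poly F}}) x :
  (map_poly L p).[x%:P] = L p.[x%:P].
Proof.
rewrite (horner_coef_wide _ (size_poly _ _)) horner_coef linear_sum.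
apply: eq_bigr => i _; rewrite coef_map_id0 ?linear0 //.
by rewrite -rmorphXn mulrC mul_polyC -linearZ -mul_polyC mulrC.
Qed.

Lemma ev_dil1 c f x y : ev (dil1 m n c f) x y = ev f (c * x) y.
Proof. by rewrite /ev dil1E horner_dilate -polyCM. Qed.

Lemma ev_dil2 c f x y : ev (dil2 m n c f) x y = ev f x (c * y).
Proof. by rewrite /ev dil2E horner_map_linear horner_dilate. Qed.

Lemma ev_A1 u a f x y : u != 0 -> a != 0 -> x != 0 ->
  ev (A1 m n s u a f) x y = (u * s ^+ m * x + (u * s ^+ m * x)^-1) * ev f x y
   - (u * s ^+ m * x)^-1 * (1 - u / s ^+ m * a * x) * (1 - u / s ^+ m / a * x)
     * ev f (q ^+ 2 * x) y.
Proof.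
move=> u0 a0 x0; have h0 : s ^+ m != 0 by rewrite expf_neq0.
have C1 : (1 : {poly F}) = 1%:P by [].
have := horner_opA q%:P u%:P (s ^+ m)%:P a%:P x%:P (bival f).
move=> /(congr1 (horner^~ y)).
rewrite -A1E // !polyCV C1 -?polyCM -?polyCN -?polyC_exp -?polyCM -?polyCN -?polyCD.
rewrite !(hornerM, hornerD, hornerN, hornerC) => e.
apply: (mulfI x0); rewrite {}e [q ^+ 2]expr2 -[q * q * x]mulrA -!/(ev _ _ _).
field; by rewrite u0 a0 x0 h0.
Qed.

Lemma ev_A2 u a f x y : u != 0 -> a != 0 -> y != 0 ->
  ev (A2 m n s u a f) x y = (u * s ^+ n * y + (u * s ^+ n * y)^-1) * ev f x y
   - (u * s ^+ n * y)^-1 * (1 - u / s ^+ n * a * y) * (1 - u / s ^+ n / a * y)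
     * ev f x (q ^+ 2 * y).
Proof.
move=> u0 a0 y0; have h0 : s ^+ n != 0 by rewrite expf_neq0.
rewrite {1}/ev A2E // horner_map_linear.
have := horner_opA q u (s ^+ n) a y (bival f).[x%:P].
rewrite -/(ev f x y) -/(ev f x (q * (q * y))) => e.
apply: (mulfI y0); rewrite {}e [q ^+ 2]expr2 -[q * q * y]mulrA; field; by rewrite u0 a0 y0 h0.
Qed.

Lemma ev_A12 u1 u2 a f x y : u1 != 0 -> u2 != 0 -> a != 0 -> x != 0 -> y != 0 ->
  ev (A12 m n s u1 u2 a f) x y =
    (u1 * s ^+ m * x + (u1 * s ^+ m * x)^-1) * ev f x y
   - (u1 * s ^+ m * x)^-1 * (1 - u1 / s ^+ m * a * x) * (1 - u1 / s ^+ m / a * x)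
     * ev f (q ^+ 2 * x) y
   + (s ^+ m) ^- 2 * ((u2 * s ^+ n * y + (u2 * s ^+ n * y)^-1) * ev f (q ^+ 2 * x) y
   - (u2 * s ^+ n * y)^-1 * (1 - u2 / s ^+ n * a * y) * (1 - u2 / s ^+ n / a * y)
     * ev f (q ^+ 2 * x) (q ^+ 2 * y) - (a + a^-1) * ev f (q ^+ 2 * x) y).
Proof.
move=> u10 u20 a0 x0 y0.
rewrite /A12 add_lfunE evD ev_A1 // scale_lfunE evZ comp_lfunE comp_lfunE.
rewrite !ev_dil1 add_lfunE opp_lfunE scale_lfunE id_lfunE evD -scaleN1r evZ evZ.
rewrite ev_A2 // -/q [q * (q * x)]mulrA -expr2.
congr (_ + _ * _); last by rewrite mulN1r.
by rewrite -exprM -exprM mulnC.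
Qed.

Lemma ev_A21 u1 u2 a f x y : u1 != 0 -> u2 != 0 -> a != 0 -> x != 0 -> y != 0 ->
  ev (A21 m n s u1 u2 a f) x y =
    (u2 * s ^+ n * y + (u2 * s ^+ n * y)^-1) * ev f x y
   - (u2 * s ^+ n * y)^-1 * (1 - u2 / s ^+ n * a * y) * (1 - u2 / s ^+ n / a * y)
     * ev f x (q ^+ 2 * y)
   + (s ^+ n) ^- 2 * ((u1 * s ^+ m * x + (u1 * s ^+ m * x)^-1) * ev f x (q ^+ 2 * y)
   - (u1 * s ^+ m * x)^-1 * (1 - u1 / s ^+ m * a * x) * (1 - u1 / s ^+ m / a * x)
     * ev f (q ^+ 2 * x) (q ^+ 2 * y) - (a + a^-1) * ev f x (q ^+ 2 * y)).
Proof.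
move=> u10 u20 a0 x0 y0.
rewrite /A21 add_lfunE evD ev_A2 // comp_lfunE add_lfunE opp_lfunE.
rewrite !scale_lfunE id_lfunE comp_lfunE evD -scaleN1r !evZ ev_A1 // !evZ !ev_dil2.
have -> : s ^+ 2 * (s ^+ 2 * y) = q ^+ 2 * y by rewrite /q; ring.
congr (_ + _).
have -> : q ^- n = (s ^+ n) ^- 2 by rewrite -!exprM mulnC.
ring.
Qed.
End Action.

Lemma B1_A1 (F : fieldType) (m n : nat) (s u b : F) : B1 m n s u b = A1 m n s^-1 u^-1 b.
Proof.
apply/lfunP => f; rewrite !lfunE /= /lift1_fun /= opB_opA.
by rewrite !polyCV !exprVn.
Qed.

Lemma B2_A2 (F : fieldType) (m n : nat) (s u b : F) : B2 m n s u b = A2 m n s^-1 u^-1 b.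
Proof.
apply/lfunP => f; rewrite !lfunE /= /lift2_fun /=; congr bitrunc.
by apply: eq_map_poly => p /=; rewrite opB_opA -!exprVn.
Qed.

Lemma B21_A12 (F : fieldType) (m n : nat) (s u1 u2 b : F) :
  B21 m n s u1 u2 b = A12 m n s^-1 u1^-1 u2^-1 b.
Proof. by rewrite /B21 /A12 B1_A1 B2_A2 !exprVn !invrK. Qed.

Lemma B12_A21 (F : fieldType) (m n : nat) (s u1 u2 b : F) :
  B12 m n s u1 u2 b = A21 m n s^-1 u1^-1 u2^-1 b.
Proof. by rewrite /B12 /A21 B1_A1 B2_A2 !exprVn !invrK. Qed.

(** * Bases on which A12 raises and B21 lowers *)

Section Psi.
Variables (F : fieldType).
Implicit Types (q c d x u h a : F) (n k : nat).

(* The n factors are chosen so that dividing by the argument and shifting it  *)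
(* by q^2 only affects the extreme ones: the first group starts at the zero   *)
(* of the factor (1 - z u h^-1 a) of A_i, which yields psi_op.                *)
Definition psi q c d n k : {poly F} :=
  if (k <= n)%N then
    \prod_(i < k) (1 - (c * q ^+ (2 * i)) *: 'X)
    * \prod_(i < n - k) (1 - (d / q ^+ (2 * i)) *: 'X)
  else 0.

Lemma psiE q c d n k x : (k <= n)%N -> (psi q c d n k).[x] =
  \prod_(i < k) (1 - c * q ^+ (2 * i) * x)
  * \prod_(i < n - k) (1 - d / q ^+ (2 * i) * x).
Proof.
move=> kn; rewrite /psi kn hornerM !horner_prod.
by congr (_ * _); apply: eq_bigr => i _; rewrite !hornerE.
Qed.

Lemma psi_over q c d n k : (n < k)%N -> psi q c d n k = 0.
Proof. by rewrite /psi ltnNge => /negbTE ->. Qed.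

Lemma size_lin_prod (c : nat -> F) k : (size (\prod_(i < k) (1 - c i *: 'X) : {poly F})%R <= k.+1)%N.
Proof.
elim: k => [|k IH]; first by rewrite big_ord0 size_polyC oner_neq0.
rewrite big_ord_recr /=; apply: leq_trans (size_polyMleq _ _) _.
have H (x y : nat) : (x <= k.+1 -> y <= 2 -> (x + y).-1 <= k.+2)%N by lia.
apply: H => //.
rewrite (leq_trans (size_polyD _ _)) // geq_max size_polyC oner_neq0 size_polyN.
by rewrite (leq_trans (size_scale_leq _ _)) // size_polyX.
Qed.

Lemma size_psi q c d n k : (size (psi q c d n k) <= n.+1)%N.
Proof.
have [kn|nk] := leqP k n; last by rewrite psi_over // size_poly0.
rewrite /psi kn.
apply: leq_trans (size_polyMleq _ _) _.
have H (x y : nat) : (x <= k.+1 -> y <= (n - k).+1 -> (x + y).-1 <= n.+1)%N by lia.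
apply: H; first exact: (size_lin_prod (fun i => c * q ^+ (2 * i))).
exact: (size_lin_prod (fun i => d / q ^+ (2 * i))).
Qed.

Lemma psi_shift q c d n k x :
  (psi q c d n k).[q ^+ 2 * x] = (psi q (q ^+ 2 * c) (q ^+ 2 * d) n k).[x].
Proof.
have [nk|kn] := ltnP n k; first by rewrite !psi_over ?horner0.
rewrite !psiE //; congr (_ * _); apply: eq_bigr => i _; ring.
Qed.

Lemma psi_inv q c d n k : (k <= n)%N -> psi q c d n k = psi q^-1 d c n (n - k).
Proof.
move=> kn; rewrite /psi kn leq_subr subKn // mulrC.
by congr (_ * _); apply: eq_bigr => i _; rewrite exprVn ?invrK.
Qed.

(** The raising coefficient of [psi_op], at [Q = q^(2k)]. Both terms carry the factor [1 - Q / h^4],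
    so it vanishes at k = n, where [h^4 = q^(2n)]. *)
Definition phi q u h a d Q :=
  (u * h)^-1 * (d * q ^+ 2 * (1 - Q / h ^+ 4) + u / h / a * (1 - h ^+ 4 / Q)).

Lemma psi_op q u h a d n k x : q != 0 -> u != 0 -> h != 0 -> a != 0 -> x != 0 ->
  h ^+ 4 = q ^+ (2 * n) -> (k <= n)%N ->
  (u * h * x + (u * h * x)^-1) * (psi q (u / h * a) d n k).[x]
  - (u * h * x)^-1 * (1 - u / h * a * x) * (1 - u / h / a * x)
    * (psi q (u / h * a) d n k).[q ^+ 2 * x] =
  (a * q ^+ (2 * k) / h ^+ 2 + h ^+ 2 / (a * q ^+ (2 * k))) * (psi q (u / h * a) d n k).[x]
  + phi q u h a d (q ^+ (2 * k)) * (psi q (u / h * a) d n k.+1).[x].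
Proof.
move=> q0 u0 h0 a0 x0 hq kn; set c := u / h * a.
have Q0 : q ^+ (2 * k) != 0 by rewrite expf_neq0.
(* The shift by [q^2] drops the factor [1 - c * x] of the first group, which the operator supplies
   again, and adds one at the upper end. *)
have e1 : (1 - c * x) * \prod_(i < k) (1 - c * q ^+ (2 * i) * (q ^+ 2 * x)) =
    (1 - c * q ^+ (2 * k) * x) * \prod_(i < k) (1 - c * q ^+ (2 * i) * x).
  rewrite [RHS]mulrC -(big_ord_recr k (fun i => 1 - c * q ^+ (2 * i) * x)) big_ord_recl.
  rewrite muln0 expr0 mulr1; congr (_ * _); apply: eq_bigr => i _.
  by rewrite lift0 mulnS exprD; ring.
have [kn'|] := ltnP k n; last first.
  move=> nk; have {nk kn} e : k = n by apply/eqP; rewrite eqn_leq kn.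
  subst k; rewrite (psi_over q c d (leqnn _)) horner0 mulr0 addr0 !psiE //.
  rewrite subnn !big_ord0 !mulr1.
  have {e1} : (1 - u / h * a * x) * \prod_(i < n) (1 - c * q ^+ (2 * i) * (q ^+ 2 * x)) =
    (1 - u / h * a * q ^+ (2 * n) * x) * \prod_(i < n) (1 - c * q ^+ (2 * i) * x) by [].
  move: (\prod_(i < n) (1 - c * q ^+ (2 * i) * (q ^+ 2 * x))) (\prod_(i < n) (1 - c * q ^+ (2 * i) * x)) => P2 P.
  rewrite -hq => e1.
  have -> (X Y : F) : X * (1 - u / h * a * x) * Y * P2 = X * Y * ((1 - u / h * a * x) * P2).
    by ring.
  by rewrite e1; field; rewrite u0 h0 a0 x0.
rewrite !psiE //.
have -> : (n - k = (n - k.+1).+1)%N by lia.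
rewrite [\prod_(i < _.+1) (1 - d / _ * x)]big_ord_recr /=.
rewrite [\prod_(i < _.+1) (1 - d / _ * (q ^+ 2 * x))]big_ord_recl.
rewrite [\prod_(i < k.+1) _]big_ord_recr /=.
have -> : \prod_(i < n - k.+1) (1 - d / q ^+ (2 * lift ord0 i) * (q ^+ 2 * x)) =
    \prod_(i < n - k.+1) (1 - d / q ^+ (2 * i) * x).
  apply: eq_bigr => i _; rewrite lift0 mulnS exprD.
  by congr (1 - _); field; rewrite q0 expf_neq0.
have -> : q ^+ (2 * (n - k.+1)) = h ^+ 4 / (q ^+ 2 * q ^+ (2 * k)).
  rewrite hq -exprD; apply: (canRL (mulfK _)); first by rewrite expf_neq0.
  by rewrite -exprD; congr (_ ^+ _); lia.
rewrite muln0 expr0.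
have {e1} : (1 - u / h * a * x) * \prod_(i < k) (1 - c * q ^+ (2 * i) * (q ^+ 2 * x)) =
    (1 - c * q ^+ (2 * k) * x) * \prod_(i < k) (1 - c * q ^+ (2 * i) * x) by [].
move: (\prod_(i < k) (1 - c * q ^+ (2 * i) * (q ^+ 2 * x))) (\prod_(i < k) (1 - c * q ^+ (2 * i) * x)).
move: (\prod_(i < _) (1 - d / q ^+ (2 * i) * x)) => D P2 P e1.
have -> (X Y Z : F) : X * (1 - u / h * a * x) * Y * (P2 * Z) =
    X * Y * Z * ((1 - u / h * a * x) * P2) by ring.
by rewrite e1 /phi /c; move: Q0; move: (q ^+ (2 * k)) => Q Q0; field; rewrite q0 u0 h0 a0 x0 Q0 oner_neq0.
Qed.

(** Newton interpolation. A multiple of the first k factors in [c] is corrected by a multiple of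
    [psi k] so as to vanish also at the zero [z] of the next such factor. This needs the cofactor
    [D] of [psi k] to be nonzero at [z], which is the hypothesis on [c] and [d] at [t = k + i]. *)
Lemma psi_span q c d n (p : {poly F}) : c != 0 -> q != 0 ->
  (forall t, (t < n)%N -> c * q ^+ (2 * t) != d) -> (size p <= n.+1)%N ->
  exists x : nat -> F, p = \sum_(k < n.+1) x k *: psi q c d n k.
Proof.
move=> c0 q0 cd.
suff H j : (j <= n)%N -> forall g : {poly F}, (size g <= j.+1)%N ->
    exists x : nat -> F, \prod_(i < n - j) (1 - (c * q ^+ (2 * i)) *: 'X) * g =
      \sum_(k < n.+1 | (n - j <= k)%N) x k *: psi q c d n k.
  move=> sp; have [x xP] := H n (leqnn n) p sp; exists x.
  by move: xP; rewrite subnn big_ord0 mul1r.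
elim: j => [_ g sg|j IH jn g sg].
  exists (fun=> g`_0); rewrite subn0 (big_pred1 ord_max) => [|i]; last first.
    rewrite /= -val_eqE /=; have := ltn_ord i; lia.
  by rewrite {1}(size1_polyC sg) /psi /= leqnn subnn big_ord0 mulr1 mulrC mul_polyC.
set k := (n - j.+1)%N; have nj : (n - j = k.+1)%N by rewrite /k; lia.
have kn : (k <= n)%N by rewrite /k; lia.
pose z := (c * q ^+ (2 * k))^-1.
have cq0 : c * q ^+ (2 * k) != 0 by rewrite mulf_neq0 ?expf_neq0.
pose D := \prod_(i < n - k) (1 - (d / q ^+ (2 * i)) *: 'X) : {poly F}.
have sD : (size D <= j.+2)%N.
  have -> : j.+2 = (n - k).+1 by rewrite /k; lia.
  exact: (size_lin_prod (fun i => d / q ^+ (2 * i))).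
have Dz : D.[z] != 0.
  rewrite horner_prod; apply/prodf_neq0 => i _; rewrite !hornerE subr_eq0 eq_sym.
  apply/negP => /eqP e.
  have kin : (k + i < n)%N by have := ltn_ord i; rewrite /k; lia.
  move: (cd _ kin) => /negP; apply.
  have Q0 : q ^+ (2 * i) != 0 by rewrite expf_neq0.
  move: e; rewrite /z mulnDr exprD mulrA => /(congr1 ( *%R^~ (c * q ^+ (2 * k) * q ^+ (2 * i)))).
  rewrite mul1r => <-; apply/eqP; field.
  by rewrite Q0 c0 expf_neq0.
have [g' eg'] : exists g', g - (g.[z] / D.[z]) *: D = g' * (1 - (c * q ^+ (2 * k)) *: 'X).
  have /factor_theorem[g' e] : root (g - (g.[z] / D.[z]) *: D) z.
    by rewrite rootE !hornerE mulfVK ?subrr.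
  exists (- z *: g'); rewrite e -scalerAl scalerAr; congr (_ * _).
  have zw : z * (c * q ^+ (2 * k)) = 1 by rewrite mulVf.
  by rewrite scalerBr scalerA mulNr zw scaleN1r opprK -mul_polyC mulr1 polyCN addrC.
have sg' : (size g' <= j.+1)%N.
  have s2 : size (1 - (c * q ^+ (2 * k)) *: 'X : {poly F})%R = 2%N.
    by rewrite addrC size_polyDl size_polyN size_scale // size_polyX // size_polyC oner_neq0.
  have [->|g'0] := eqVneq g' 0; first by rewrite size_poly0.
  have : (size (g' * (1 - (c * q ^+ (2 * k)) *: 'X))%R <= j.+2)%N.
    rewrite -eg' (leq_trans (size_polyD _ _)) // geq_max sg size_polyN.
    by rewrite (leq_trans (size_scale_leq _ _)).
  by rewrite size_mul // -?size_poly_eq0 s2 // addn2.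
have [x xP] := IH (ltnW jn) g' sg'.
exists (fun i => if i == k then g.[z] / D.[z] else x i).
rewrite -[g in LHS](subrK ((g.[z] / D.[z]) *: D)) eg' mulrDr.
rewrite (bigD1 (Ordinal (kn : (k < n.+1)%N))) //= eqxx addrC; congr (_ + _); last first.
  by rewrite -scalerAr /psi kn.
rewrite mulrA [_ * g']mulrC -mulrA -(big_ord_recr k (fun i => 1 - (c * q ^+ (2 * i)) *: 'X)) -nj.
rewrite mulrC xP; apply: eq_big => [i|i].
  by rewrite nj -val_eqE /= [LHS]ltn_neqAle eq_sym andbC.
by rewrite nj; case: eqP => // ->; rewrite ltnn.
Qed.
End Psi.

Definition nonroot (F : fieldType) (s : F) :=
  s != 0 /\ forall k, (0 < k)%N -> (s ^+ 2) ^+ k != 1.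

Lemma nonroot_inv (F : fieldType) (s : F) : nonroot s -> nonroot s^-1.
Proof.
by case=> s0 H; split=> [|k /H]; rewrite ?invr_eq0 // !exprVn invr_eq1.
Qed.

Lemma nonroot_inj (F : fieldType) (s : F) : nonroot s -> injective (GRing.exp (s ^+ 2)).
Proof.
case=> s0 H; have q0 k : (s ^+ 2) ^+ k != 0 by rewrite !expf_neq0.
suff L i j : (i < j)%N -> (s ^+ 2) ^+ i <> (s ^+ 2) ^+ j.
  by move=> i j e; case: (ltngtP i j) => // /L; [|move/nesym].
move=> ij e; have := H (j - i)%N; rewrite subn_gt0 ij => /(_ isT)/eqP; apply.
by apply: (mulIf (q0 i)); rewrite -exprD subnK ?mul1r // ltnW.
Qed.

Section Grid.
Variables (F : fieldType) (m n : nat).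
Local Notation V := (bipoly F m n).
Implicit Types (s u a b d : F) (f : V) (i k : nat).

(** This is [x + x^-1] at [x = a q^(2p - 2j_1 - 2j_2)], so that reversing [p] amounts to inverting
    [a] ([theta_inva]). *)
Definition theta s a p :=
  a * (s ^+ 2) ^+ (2 * p) / (s ^+ m * s ^+ n) ^+ 2
  + (s ^+ m * s ^+ n) ^+ 2 / (a * (s ^+ 2) ^+ (2 * p)).

(* A12 is A_1 with alpha replaced by an operator in z2; on the k2-th vector of *)
(* the second factor this replaces a by a q^(2 k2) / q^(2 j_2), and the shift *)
(* of z1 in front of A_2 turns this parameter into that of k2 + 1.            *)
Definition Psi s u1 u2 a d1 d2 k1 k2 : V :=
  tens m n
    (psi (s ^+ 2) (u1 / s ^+ m * (a * (s ^+ 2) ^+ (2 * k2) / (s ^+ n) ^+ 2))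
         (d1 * (s ^+ 2) ^+ (2 * k2)) m k1)
    (psi (s ^+ 2) (u2 / s ^+ n * a) d2 n k2).

Definition rho1 s u1 a d1 k1 k2 :=
  phi (s ^+ 2) u1 (s ^+ m) (a * (s ^+ 2) ^+ (2 * k2) / (s ^+ n) ^+ 2)
      (d1 * (s ^+ 2) ^+ (2 * k2)) ((s ^+ 2) ^+ (2 * k1)).

Definition rho2 s u2 a d2 k2 :=
  (s ^+ m) ^- 2 * phi (s ^+ 2) u2 (s ^+ n) a d2 ((s ^+ 2) ^+ (2 * k2)).

Lemma expr4_double s k : (s ^+ k) ^+ 4 = (s ^+ 2) ^+ (2 * k).
Proof. by rewrite -!exprM; congr (_ ^+ _); lia. Qed.

Lemma A12_Psi s u1 u2 a d1 d2 k1 k2 : nonroot s -> u1 != 0 -> u2 != 0 -> a != 0 ->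
  (k1 <= m)%N -> (k2 <= n)%N ->
  A12 m n s u1 u2 a (Psi s u1 u2 a d1 d2 k1 k2) =
  theta s a (k1 + k2) *: Psi s u1 u2 a d1 d2 k1 k2
  + rho1 s u1 a d1 k1 k2 *: Psi s u1 u2 a d1 d2 k1.+1 k2
  + rho2 s u2 a d2 k2 *: Psi s u1 u2 a d1 d2 k1 k2.+1.
Proof.
move=> sr u10 u20 a0 k1m k2n; have s0 : s != 0 by case: sr.
apply: (ev_inj (nonroot_inj sr)) => i j.
have q0 : s ^+ 2 != 0 by rewrite expf_neq0.
have := expf_neq0 i q0; have := expf_neq0 j q0.
move: ((s ^+ 2) ^+ i) ((s ^+ 2) ^+ j) => x y y0 x0.
rewrite !evD !evZ ev_A12 // !ev_tens ?size_psi //.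
have -> : (psi (s ^+ 2) (u1 / s ^+ m * (a * (s ^+ 2) ^+ (2 * k2.+1) / (s ^+ n) ^+ 2))
         (d1 * (s ^+ 2) ^+ (2 * k2.+1)) m k1).[x] =
    (psi (s ^+ 2) (u1 / s ^+ m * (a * (s ^+ 2) ^+ (2 * k2) / (s ^+ n) ^+ 2))
         (d1 * (s ^+ 2) ^+ (2 * k2)) m k1).[(s ^+ 2) ^+ 2 * x].
  by rewrite psi_shift mulnS exprD; congr (psi _ _ _ _ _).[_]; ring.
have h10 : s ^+ m != 0 by rewrite expf_neq0.
have h20 : s ^+ n != 0 by rewrite expf_neq0.
have Q2 : (s ^+ 2) ^+ (2 * k2) != 0 by rewrite expf_neq0.
have Q1 : (s ^+ 2) ^+ (2 * k1) != 0 by rewrite expf_neq0.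
have := psi_op d2 q0 u20 h20 a0 y0 (expr4_double s n) k2n.
have a'0 : a * (s ^+ 2) ^+ (2 * k2) / (s ^+ n) ^+ 2 != 0.
  by rewrite !mulf_neq0 ?invr_eq0 ?expf_neq0.
have := psi_op (d1 * (s ^+ 2) ^+ (2 * k2)) q0 u10 h10 a'0 x0 (expr4_double s m) k1m.
rewrite /rho1 /rho2 /theta mulnDr exprD.
move: (phi _ _ _ _ _ _) (phi _ _ _ _ _ _) => f1 f2.
move: (psi _ _ _ _ _).[x] (psi _ _ _ _ _).[x] (psi _ _ _ _ _).[_ * x] => P1 P0 P2.
move: (psi _ _ _ _ _).[y] (psi _ _ _ _ _).[y] (psi _ _ _ _ _).[_ * y] => R1 R0 R2.
move: (s ^+ m) (s ^+ n) h10 h20 => h1 h2 h10 h20 {a'0}.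
move: ((s ^+ 2) ^+ (2 * k1)) ((s ^+ 2) ^+ (2 * k2)) Q1 Q2 => q1 q2 Q1 Q2 e1 e2.
set E1 := _ - _ in e1; set E2 := _ - _ in e2.
(* In the coefficient of [f(q^2 z1, z2)] the terms with [a + a^-1] cancel, so [a] may be replaced
   there by [a' = a q^(2 k2) / q^(2 j_2)], at the price of the middle term. That term is compensated
   by the diagonal part of [E2], which is [a' + a'^-1]. *)
transitivity (E1 * R0 - h1 ^- 2 * (a * q2 / h2 ^+ 2 + h2 ^+ 2 / (a * q2)) * P2 * R0
   + h1 ^- 2 * P2 * E2).
  rewrite /E1 /E2; field.
  by rewrite a0 u10 u20 h10 h20 x0 y0 Q2.
rewrite e1 e2; field.
by rewrite a0 ?u10 ?u20 h10 h20 ?x0 ?y0 Q1 Q2.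
Qed.

(* The values of d1 and d2 for which the same vectors, read backwards, are    *)
(* the basis attached to B21 (Psi2_inv), so that B21 lowers the indices.      *)
Definition Psi2 s u1 u2 a b k1 k2 :=
  Psi s u1 u2 a (s ^+ m / u1 * b / (s ^+ n) ^+ 2) (s ^+ n / u2 * b) k1 k2.

Lemma Psi2_inv s u1 u2 a b k1 k2 : s != 0 -> (k1 <= m)%N -> (k2 <= n)%N ->
  Psi2 s u1 u2 a b k1 k2 = Psi2 s^-1 u1^-1 u2^-1 b a (m - k1) (n - k2).
Proof.
move=> s0 k1m k2n; rewrite /Psi2 /Psi psi_inv // [in LHS](psi_inv _ _ _ k2n).
have h20 : s ^+ n != 0 by rewrite expf_neq0.
have Q2 : (s ^+ 2) ^+ (2 * k2) != 0 by rewrite !expf_neq0.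
have e : (s ^+ 2) ^+ (2 * (n - k2)) = (s ^+ n) ^+ 4 / (s ^+ 2) ^+ (2 * k2).
  apply: (canRL (mulfK Q2)); rewrite -exprD expr4_double; congr (_ ^+ _); lia.
rewrite !exprVn !invrK e.
have psiE x x' y y' N k : x = x' -> y = y' -> psi (s ^+ 2)^-1 x y N k = psi (s ^+ 2)^-1 x' y' N k.
  by move=> -> ->.
congr (tens _ _ _ _); apply: psiE.
- move: (s ^+ m) (u1^-1) (s ^+ n) (_ ^+ (2 * k2)) h20 Q2 => h1 v h2 q2 h20 Q2.
  by field; rewrite ?h20 ?Q2.
- move: ((s ^+ m)^-1) (s ^+ n) (_ ^+ (2 * k2)) h20 Q2 => h1 h2 q2 h20 Q2.
  by field; rewrite ?h20 ?Q2.
- by congr (_ * _); rewrite mulrC.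
- by congr (_ * _); rewrite mulrC.
Qed.
End Grid.

(** Bezout's relation for two products without common root, in terms of eigenvectors: what is left
    before the last factor of [ts] is an eigenvector on which [ts'] acts by a nonzero scalar. *)
Lemma factors_coprime (K : fieldType) (V : vectType K) (A : 'End(V)) (ts ts' : seq K) v :
  (forall t, t \in ts -> t \notin ts') -> factors A ts v = 0 -> factors A ts' v = 0 -> v = 0.
Proof.
elim: ts v => [|t ts IH] v //= H /eqP; rewrite subr_eq0 => /eqP e z.
apply: IH => // [t' t's|]; first by apply: H; rewrite inE t's orbT.
have := factors_eigen ts' e; rewrite -factors_cat factors_catC factors_cat z linear0.
move/esym/eqP; rewrite scaler_eq0 => /orP[|/eqP //].
rewrite prodf_seq_eq0 => /hasP[t' t's /=]; rewrite subr_eq0 => /eqP tt'.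
by have := H t (mem_head _ _); rewrite tt' t's.
Qed.

(** * Flags raised by one operator and lowered by the other *)

Section Flags.
Variables (K : fieldType) (V : vectType K) (m n : nat) (Psi : nat -> nat -> V).
Hypothesis Psi0 : forall k1 k2, (m < k1)%N || (n < k2)%N -> Psi k1 k2 = 0.
Hypothesis Psi_span : forall M : {vspace V},
  (forall k1 k2, (k1 <= m)%N -> (k2 <= n)%N -> Psi k1 k2 \in M) -> M = fullv.

Definition flag i : {vspace V} :=
  (\sum_(k1 < m.+1) \sum_(k2 < n.+1 | (i <= k1 + k2)%N) <[Psi k1 k2]>)%VS.

Lemma mem_flag i k1 k2 : (i <= k1 + k2)%N -> Psi k1 k2 \in flag i.
Proof.
move=> ik; have [/Psi0->|] := boolP ((m < k1)%N || (n < k2)%N); first exact: mem0v.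
rewrite negb_or -!leqNgt -ltnS -[(k2 <= n)%N]ltnS => /andP[k1m k2n].
have H : Psi k1 k2 \in (\sum_(k2 < n.+1 | (i <= k1 + k2)%N) <[Psi k1 k2]>)%VS.
  rewrite (bigD1 (Ordinal k2n)) //=; apply: subvP (addvSl _ _) _ _; exact: memv_line.
by rewrite /flag (bigD1 (Ordinal k1m)) //=; apply: subvP (addvSl _ _) _ H.
Qed.

Lemma flag_sub i (M : {vspace V}) :
  (forall k1 k2, (k1 <= m)%N -> (k2 <= n)%N -> (i <= k1 + k2)%N -> Psi k1 k2 \in M) ->
  (flag i <= M)%VS.
Proof.
move=> H; apply/subv_sumP => k1 _; apply/subv_sumP => k2 ik.
by rewrite -memvE; apply: H => //; rewrite -ltnS ltn_ord.
Qed.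

Lemma flag_full : flag 0 = fullv.
Proof. by apply: Psi_span => k1 k2 _ _; apply: mem_flag. Qed.

Lemma flag_zero i : (m + n < i)%N -> flag i = 0%VS.
Proof.
move=> mni; apply/eqP; rewrite -subv0; apply: flag_sub => k1 k2; lia.
Qed.

Lemma flag_top v : v \in flag (m + n) -> exists c, v = c *: Psi m n.
Proof.
move=> h; apply/vlineP; move: v h; apply/subvP/flag_sub => k1 k2 k1m k2n k12.
have [-> ->] : k1 = m /\ k2 = n by lia.
exact: memv_line.
Qed.

Variables (A : 'End(V)) (th : nat -> K).
Hypothesis A_Psi : forall k1 k2, (k1 <= m)%N -> (k2 <= n)%N ->
  A (Psi k1 k2) - th (k1 + k2)%N *: Psi k1 k2 \in flag (k1 + k2).+1.

Lemma flag_A i v : v \in flag i -> A v - th i *: v \in flag i.+1.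
Proof.
have lE w : (A - th i *: \1)%VF w = A w - th i *: w.
  by rewrite add_lfunE opp_lfunE scale_lfunE id_lfunE.
rewrite -lE => h; have : (A - th i *: \1)%VF v \in ((A - th i *: \1) @: flag i)%VS.
  exact: memv_img.
move: {h} (_ v) => w; apply/subvP; rewrite /flag limg_sum.
apply/subv_sumP => k1 _; rewrite limg_sum; apply/subv_sumP => k2 ik.
rewrite limg_line -memvE lE.
have [e|ni] := eqVneq i (k1 + k2)%N.
  by rewrite {1}e; have := A_Psi (leq_ord k1) (leq_ord k2); rewrite -e.
have {ik ni} ik : (i < k1 + k2)%N by rewrite ltn_neqAle ni.
have Pi : Psi k1 k2 \in flag i.+1 by apply: mem_flag.
rewrite memvB ?memvZ // -[A _](subrK (th (k1 + k2)%N *: Psi k1 k2)) memvD ?memvZ //.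
have := A_Psi (leq_ord k1) (leq_ord k2); apply/subvP/flag_sub => l1 l2 _ _ h.
by apply: mem_flag; apply: leq_trans h; rewrite ltnW // ltnS.
Qed.

Lemma flag_fac i l v : v \in flag i -> factors A (map th (iota i l)) v \in flag (i + l).
Proof.
elim: l i v => [|l IH] i v vi; first by rewrite addn0.
rewrite -[map _ _]/([:: th i] ++ map th (iota i.+1 l)) factors_catC factors_cat /=.
by rewrite -addSnnS; apply/IH/flag_A.
Qed.

Lemma flag_annih v : factors A (map th (iota 0 (m + n).+1)) v = 0.
Proof.
have : v \in flag 0 by rewrite flag_full memvf.
move=> /(@flag_fac _ (m + n).+1); rewrite add0n flag_zero // memv0 => /eqP.
by [].
Qed.

Lemma flag_fac_top v : exists c, factors A (map th (iota 0 (m + n))) v = c *: Psi m n.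
Proof.
apply: flag_top; have := @flag_fac 0 (m + n) v; apply.
by rewrite flag_full memvf.
Qed.

Variable B : 'End(V).
Hypothesis B_Psi : forall k1 k2, (k1 <= m)%N -> (k2 <= n)%N ->
  B (Psi k1 k2) \in flag (k1 + k2).-1.

Lemma flag_B i v : v \in flag i -> B v \in flag i.-1.
Proof.
move=> /(memv_img B); apply: subvP; rewrite /flag limg_sum.
apply/subv_sumP => k1 _; rewrite limg_sum; apply/subv_sumP => k2 ik.
rewrite limg_line -memvE.
have := B_Psi (leq_ord k1) (leq_ord k2); apply/subvP/flag_sub => l1 l2 _ _ h.
by apply: mem_flag; apply: leq_trans h; lia.
Qed.

(** The first [p] factors map the whole space into [flag p] and act on [v] by a nonzero scalar, so
    [v] lies in [flag p]. Then [B v] lies in [flag p.-1], which the factors from [p.-1] on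
    annihilate. *)
Lemma flag_eigen p v : (p <= m + n)%N ->
  uniq (map th (iota 0 (m + n).+1)) -> A v = th p *: v ->
  factors A (map th (iota p.-1 ((m + n).+1 - p.-1))) (B v) = 0.
Proof.
move=> pmn uth Av.
have vp : v \in flag p.
  have : v \in flag 0 by rewrite flag_full memvf.
  move=> /(@flag_fac _ p); rewrite add0n (factors_eigen _ Av) => /(memvZ (\prod_(t <- map th (iota 0 p)) (th p - t))^-1).
  rewrite scalerA mulVf ?scale1r // prodf_seq_neq0; apply/allP => _ /mapP[i ip ->] /=.
  rewrite subr_eq0; move: ip; rewrite mem_iota => /andP[_ ip].
  have := uth; rewrite -addn1 iotaD map_cat cat_uniq => /and3P[_ _ _].
  have pN : (p < (m + n).+1)%N by [].
  have -> : th p = nth 0 (map th (iota 0 (m + n).+1)) p.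
    by rewrite (nth_map 0%N) ?size_iota // nth_iota.
  have -> : th i = nth 0 (map th (iota 0 (m + n).+1)) i.
    by rewrite (nth_map 0%N) ?size_iota ?nth_iota //; lia.
  rewrite nth_uniq ?size_map ?size_iota //; lia.
have := flag_fac ((m + n).+1 - p.-1) (flag_B vp).
by rewrite flag_zero ?memv0 => [/eqP|] //; lia.
Qed.
End Flags.

(* The flags of the bases for a and a^-1 are opposite for A, so the two       *)
(* inclusions of flag_eigen intersect in the three neighbouring eigenspaces.  *)
Section TwoFlags.
Variables (K : fieldType) (V : vectType K) (m n : nat) (Psi Psi' : nat -> nat -> V).
Variables (A B : 'End(V)) (th : nat -> K).
Let N := (m + n)%N.
Hypothesis Psi0 : forall k1 k2, (m < k1)%N || (n < k2)%N -> Psi k1 k2 = 0.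
Hypothesis Psi0' : forall k1 k2, (m < k1)%N || (n < k2)%N -> Psi' k1 k2 = 0.
Hypothesis Psi_span : forall M : {vspace V},
  (forall k1 k2, (k1 <= m)%N -> (k2 <= n)%N -> Psi k1 k2 \in M) -> M = fullv.
Hypothesis Psi_span' : forall M : {vspace V},
  (forall k1 k2, (k1 <= m)%N -> (k2 <= n)%N -> Psi' k1 k2 \in M) -> M = fullv.
Hypothesis A_Psi : forall k1 k2, (k1 <= m)%N -> (k2 <= n)%N ->
  A (Psi k1 k2) - th (k1 + k2)%N *: Psi k1 k2 \in flag m n Psi (k1 + k2).+1.
Hypothesis A_Psi' : forall k1 k2, (k1 <= m)%N -> (k2 <= n)%N ->
  A (Psi' k1 k2) - th (N - (k1 + k2))%N *: Psi' k1 k2 \in flag m n Psi' (k1 + k2).+1.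
Hypothesis B_Psi : forall k1 k2, (k1 <= m)%N -> (k2 <= n)%N ->
  B (Psi k1 k2) \in flag m n Psi (k1 + k2).-1.
Hypothesis B_Psi' : forall k1 k2, (k1 <= m)%N -> (k2 <= n)%N ->
  B (Psi' k1 k2) \in flag m n Psi' (k1 + k2).-1.
Hypothesis uth : uniq (map th (iota 0 N.+1)).
Hypothesis cyc : exists v, forall ts, size ts = N -> factors A ts v != 0.

Lemma two_flags_half : half_tridiagonal A B (map th (iota 0 N.+1)).
Proof.
have thE i : (i <= N)%N -> (map th (iota 0 N.+1))`_i = th i.
  by move=> iN; rewrite (nth_map 0%N) ?size_iota // nth_iota.
split=> //; first exact: (flag_annih Psi0 Psi_span A_Psi).
  by case: cyc => v vP; exists v; rewrite size_map size_iota.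
move=> p v; rewrite {1}size_map size_iota ltnS => pN; rewrite thE // => Av.
have e1 := flag_eigen Psi0 Psi_span A_Psi B_Psi pN uth Av.
(* Along [Psi'] the eigenvalues occur in reverse order, so [flag_eigen] at [N - p] yields the
   factors of index at most [p + 1]. *)
pose th' i := th (N - i)%N.
have revth j l : (j + l <= N.+1)%N ->
    perm_eq (map th' (iota j l)) (map th (iota (N.+1 - (j + l)) l)).
  move=> jl; rewrite (map_comp th (subn N)); apply: perm_map; apply: uniq_perm.
  - rewrite map_inj_in_uniq ?iota_uniq // => x y; rewrite !mem_iota; lia.
  - exact: iota_uniq.
  move=> x; rewrite mem_iota; apply/mapP/idP => [[y]|h].
    rewrite mem_iota; lia.
  by exists (N - x)%N; [rewrite mem_iota|]; lia.
have uth' : uniq (map th' (iota 0 N.+1)).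
  by rewrite (perm_uniq (revth _ _ _)) ?subnn.
have Av' : A v = th' (N - p)%N *: v by rewrite /th' subKn.
have := flag_eigen Psi0' Psi_span' (A_Psi' : forall k1 k2, _ -> _ -> _ - th' _ *: _ \in _)
  B_Psi' (leq_subr p N) uth' Av'.
rewrite (factors_perm _ _ (revth _ _ _)); last by lia.
set Y := neighbours _ _ => e2.
pose idx := iota p.-1 (minn p.+2 N.+1 - p.-1).
have Yi : Y = map th idx.
  rewrite /Y /neighbours size_map size_iota /idx; case: (p) pN => [|p'] p'N; case: ltnP => h.
  - by have -> : (minn 2 N.+1 - 0.-1 = 2)%N by [lia]; rewrite !thE //; lia.
  - by have -> : (minn 2 N.+1 - 0.-1 = 1)%N by [lia]; rewrite !thE //; lia.
  - by have -> : (minn p'.+3 N.+1 - p'.+1.-1 = 3)%N by [lia]; rewrite !thE //; lia.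
  - by have -> : (minn p'.+3 N.+1 - p'.+1.-1 = 2)%N by [lia]; rewrite !thE //; lia.
have ul i j : (i <= N)%N -> (j <= N)%N -> th i = th j -> i = j.
  move=> iN jN; rewrite -!thE // => /eqP; rewrite nth_uniq ?size_map ?size_iota //.
  by move/eqP.
(* Both annihilating products contain the neighbours of [p]. The indices left over, below [p - 1] in
   one and above [p + 1] in the other, are disjoint. *)
apply: (@factors_coprime _ _ A (map th (iota 0 p.-1)) (map th (iota p.+2 (N.+1 - p.+2)))).
- move=> _ /mapP[i hi ->]; apply/negP => /mapP[j hj /ul e].
  by move: hi hj e; rewrite !mem_iota; lia.
- rewrite -factors_cat Yi -map_cat; move: e2.
  have -> : (N.+1 - ((N - p).-1 + (N.+1 - (N - p).-1)) = 0)%N by lia.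
  have -> : (N.+1 - (N - p).-1 = p.-1 + (minn p.+2 N.+1 - p.-1))%N by lia.
  by rewrite iotaD add0n.
rewrite -factors_cat factors_catC Yi -map_cat; move: e1.
have -> : (N.+1 - p.-1 = (minn p.+2 N.+1 - p.-1) + (N.+1 - p.+2))%N by lia.
rewrite iotaD; have [h|h] := boolP (p.+2 <= N.+1)%N.
  by have -> : (p.-1 + (minn p.+2 N.+1 - p.-1) = p.+2)%N by lia.
by have -> : (N.+1 - p.+2 = 0)%N by lia.
Qed.
End TwoFlags.

Lemma linear_comb (K : fieldType) (U V : lmodType K) (f : U -> V) (I : Type) (r : seq I)
    (x : I -> K) (p : I -> U) : linear f ->
  f (\sum_(i <- r) x i *: p i) = \sum_(i <- r) x i *: f (p i).
Proof.
move=> lf; have f0 : f 0 = 0.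
  by have := lf (-1) 0 0; rewrite scaler0 addr0 scaleN1r addNr.
elim: r => [|i r IH]; first by rewrite !big_nil.
by rewrite !big_cons lf IH.
Qed.

Section Span.
Variables (F : fieldType) (m n : nat) (s u1 u2 a d1 d2 : F).
Hypotheses (s0 : s != 0) (u10 : u1 != 0) (u20 : u2 != 0) (a0 : a != 0).
Hypothesis H1 : forall t, (t < m)%N ->
  u1 / s ^+ m * a / (s ^+ n) ^+ 2 * (s ^+ 2) ^+ (2 * t) != d1.
Hypothesis H2 : forall t, (t < n)%N -> u2 / s ^+ n * a * (s ^+ 2) ^+ (2 * t) != d2.

(** The power of z2 is expanded first, then, for each [k2], the power of z1 in the [psi] which
    belong to this [k2]. Their two parameters are multiplied by the same [q^(2 k2)], so one
    condition [H1] serves for all [k2]. *)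
Lemma Psi_spanning (M : {vspace bipoly F m n}) :
  (forall k1 k2, (k1 <= m)%N -> (k2 <= n)%N -> Psi m n s u1 u2 a d1 d2 k1 k2 \in M) ->
  M = fullv.
Proof.
have q0 : s ^+ 2 != 0 by rewrite expf_neq0.
have h10 : s ^+ m != 0 by rewrite expf_neq0.
have h20 : s ^+ n != 0 by rewrite expf_neq0.
move=> PM; apply: bipoly_span => i k im kn.
have c20 : u2 / s ^+ n * a != 0 by rewrite !mulf_neq0 ?invr_eq0.
have [|x ->] := psi_span c20 q0 H2 (p := 'X^k); first by rewrite size_polyXn ltnS.
rewrite linear_comb; last exact: tens_linr.
apply: memv_suml => k2 _; apply: memvZ.
have Q20 : (s ^+ 2) ^+ (2 * k2) != 0 by rewrite expf_neq0.
have c10 : u1 / s ^+ m * (a * (s ^+ 2) ^+ (2 * k2) / (s ^+ n) ^+ 2) != 0.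
  by rewrite !mulf_neq0 ?invr_eq0 ?expf_neq0.
have H1' t : (t < m)%N ->
    u1 / s ^+ m * (a * (s ^+ 2) ^+ (2 * k2) / (s ^+ n) ^+ 2) * (s ^+ 2) ^+ (2 * t) !=
    d1 * (s ^+ 2) ^+ (2 * k2).
  move=> /H1; apply: contraNneq => e; apply/eqP/(mulIf Q20); rewrite -e; ring.
have [|y ->] := psi_span c10 q0 H1' (p := 'X^i); first by rewrite size_polyXn ltnS.
rewrite (linear_comb _ _ _ (@tens_linl _ _ _ _)).
apply: memv_suml => k1 _; apply: memvZ; apply: PM; exact: leq_ord.
Qed.
End Span.

(** * Coefficients of [A12] on monomials and a cyclic vector *)

Section Cyclic.
Variables (F : fieldType) (m n : nat) (s u1 u2 a : F).
Hypotheses (sr : nonroot s) (u10 : u1 != 0) (u20 : u2 != 0) (a0 : a != 0).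
Local Notation V := (bipoly F m n).
Implicit Types (f : V) (i k : nat).

(** [up] and [dn] are the off-diagonal entries of the tridiagonal matrix of A_i on monomials,
    leaving degree [i] upwards and downwards. They do not involve [a]. *)
Definition up u (h : F) i : F := u * h * (1 - (s ^+ 2) ^+ (2 * i) / h ^+ 4).
Definition dn u (h : F) i : F := (u * h)^-1 * (1 - (s ^+ 2) ^+ (2 * i)).
Definition hop u (h : F) (x : nat -> F) i :=
  (if i is i'.+1 then up u h i' * x i' else 0) + dn u h i.+1 * x i.+1.

Lemma coef_A1 f i k : (bival (A1 m n s u1 a f))`_i`_k =
  hop u1 (s ^+ m) (fun j => (bival f)`_j`_k) i
  + (a + a^-1) * (s ^+ 2) ^+ (2 * i) / (s ^+ m) ^+ 2 * (bival f)`_i`_k.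
Proof.
have s0 : s != 0 by case: sr.
have h0 : s ^+ m != 0 by rewrite expf_neq0.
have C1 : (1 : {poly F}) = 1%:P by [].
rewrite A1E // coef_opA !polyCV C1 -?(polyCM, polyCN, polyCD, polyC_exp) -?(polyCM, polyCN, polyCD).
rewrite !coefD -?polyCM -?polyCN -?polyCD !coefCM.
have e : (s ^+ 2 * s ^+ 2) ^+ i = (s ^+ 2) ^+ (2 * i) by rewrite -expr2 -!exprM.
have e' : (s ^+ 2 * s ^+ 2) ^+ i.+1 = (s ^+ 2) ^+ (2 * i.+1) by rewrite -expr2 -!exprM.
rewrite /hop /up /dn e e'.
move: ((s ^+ 2) ^+ (2 * i)) ((s ^+ 2) ^+ (2 * i.+1)) => q1 q2.
case: i {e e'} => [|i].
  by rewrite coef0; field; rewrite u10 a0 h0.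
rewrite -?(polyCM, polyCN, polyCD, polyC_exp) -?(polyCM, polyCN, polyCD) coefCM.
have -> : (s ^+ 2 * s ^+ 2) ^+ i = (s ^+ 2) ^+ (2 * i) by rewrite -expr2 -!exprM.
by field; rewrite u10 a0 h0.
Qed.

Lemma coef_A2 f i k : (bival (A2 m n s u2 a f))`_i`_k =
  hop u2 (s ^+ n) (fun j => (bival f)`_i`_j) k
  + (a + a^-1) * (s ^+ 2) ^+ (2 * k) / (s ^+ n) ^+ 2 * (bival f)`_i`_k.
Proof.
have s0 : s != 0 by case: sr.
have h0 : s ^+ n != 0 by rewrite expf_neq0.
rewrite A2E // coef_map_id0 ?linear0 // coef_opA.
have e j : (s ^+ 2 * s ^+ 2) ^+ j = (s ^+ 2) ^+ (2 * j) by rewrite -expr2 -!exprM.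
rewrite /hop /up /dn !e.
move: ((s ^+ 2) ^+ (2 * k)) ((s ^+ 2) ^+ (2 * k.+1)) => q1 q2.
case: k => [|k]; last rewrite e.
  by field; rewrite u20 a0 h0.
by field; rewrite u20 a0 h0.
Qed.

Lemma coef_A12 f i k : (bival (A12 m n s u1 u2 a f))`_i`_k =
  hop u1 (s ^+ m) (fun j => (bival f)`_j`_k) i
  + (s ^+ 2) ^+ (2 * i) / (s ^+ m) ^+ 2 * hop u2 (s ^+ n) (fun j => (bival f)`_i`_j) k
  + (a + a^-1) * (s ^+ 2) ^+ (2 * i) * (s ^+ 2) ^+ (2 * k) / (s ^+ m * s ^+ n) ^+ 2
    * (bival f)`_i`_k.
Proof.
have s0 : s != 0 by case: sr.
have h0 : s ^+ m != 0 by rewrite expf_neq0.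
have h0' : s ^+ n != 0 by rewrite expf_neq0.
rewrite /A12 add_lfunE bivalD !coefD coef_A1 scale_lfunE bivalZ coefZ coefCM !comp_lfunE.
rewrite !dil1E !coef_dilate -polyC_exp mulrA -polyCM coefCM.
rewrite add_lfunE opp_lfunE scale_lfunE id_lfunE bivalD !coefD coef_A2.
have -> : (bival (- ((a + a^-1) *: f)))`_i`_k = - ((a + a^-1) * (bival f)`_i`_k).
  by rewrite -scaleN1r bivalZ coefZ coefCM bivalZ coefZ coefCM mulN1r.
have -> : (s ^+ 2) ^+ i * (s ^+ 2) ^+ i = (s ^+ 2) ^+ (2 * i).
  by rewrite -exprD; congr (_ ^+ _); lia.
have -> : s ^+ 2 ^- m = (s ^+ m) ^- 2 by rewrite -!exprM mulnC.
move: (hop _ _ _ _) (hop _ _ _ _) ((s ^+ 2) ^+ (2 * i)) ((s ^+ 2) ^+ (2 * k)) => x y q1 q2.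
by field; rewrite a0 h0 h0'.
Qed.

(* The coefficients of degree l of A12^l 1, and of any product of l shifted   *)
(* copies of A12, are the C i k with i + k = l; C m n is nonzero.             *)
Let den j : F := 1 - (s ^+ 2) ^+ (2 * j.+1).
Let g1 i := \prod_(t < i) (up u1 (s ^+ m) t / den t).
Let g2 k := \prod_(t < k) (up u2 (s ^+ n) t / ((s ^+ m) ^+ 2 * den t)).
Let C i k := (\prod_(t < i + k) den t) * g1 i * g2 k.

Let den0 j : den j != 0.
Proof. by case: sr => _ H; rewrite subr_eq0 eq_sym H // muln_gt0. Qed.

(** [C i k] is a Gaussian binomial coefficient in [q^2] times products of raising entries. This is
    its Pascal rule, from [den (i + k + 1) = den i + q^(2 (i + 1)) den k]. *)
Let Crec i k : (0 < i + k)%N -> C i k =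
  (if i is i'.+1 then up u1 (s ^+ m) i' * C i' k else 0)
  + (s ^+ 2) ^+ (2 * i) / (s ^+ m) ^+ 2
    * (if k is k'.+1 then up u2 (s ^+ n) k' * C i k' else 0).
Proof.
have h0 : s ^+ m != 0 by case: sr => s0 _; rewrite expf_neq0.
case: i k => [|i] [|k] // _; rewrite /C /g1 /g2.
- rewrite add0n !big_ord0 muln0 expr0 !big_ord_recr /=.
  by field; rewrite h0 den0.
- by rewrite !addn0 !big_ord0 !big_ord_recr /= mulr0 addr0; field.
rewrite !addSn !addnS !big_ord_recr /=.
have : den (i + k).+1 = den i + (s ^+ 2) ^+ (2 * i.+1) * den k.
  rewrite /den mulrBr mulr1 -exprD addrA subrK; congr (1 - _ ^+ _); lia.
move: (den (i + k).+1) (den0 i) (den0 k) => D Di Dk ->.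
by field; rewrite h0 Di Dk.
Qed.

Lemma A12_cyclic : exists v : V, forall ts, size ts = (m + n)%N ->
  factors (A12 m n s u1 u2 a) ts v != 0.
Proof.
have s0 : s != 0 by case: sr.
have h10 : s ^+ m != 0 by rewrite expf_neq0.
have h20 : s ^+ n != 0 by rewrite expf_neq0.
have up0 u (h : F) d : h ^+ 4 = (s ^+ 2) ^+ (2 * d) -> h != 0 -> up u h d = 0.
  by move=> e h0; rewrite /up -e divff ?subrr ?mulr0 // expf_neq0.
have upn0 u (h : F) d t : h ^+ 4 = (s ^+ 2) ^+ (2 * d) -> u != 0 -> h != 0 -> (t < d)%N ->
    up u h t != 0.
  move=> e u0 h0 td; rewrite /up !mulf_neq0 // subr_eq0 eq_sym.
  rewrite -subr_eq0 -(mulfK (expf_neq0 4 h0) 1) mul1r -mulrBl mulf_eq0 negb_or.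
  rewrite invr_eq0 expf_neq0 // andbT subr_eq0 e (inj_eq (nonroot_inj sr)); lia.
have C0 i k : (m < i)%N || (n < k)%N -> C i k = 0.
  case/orP => h; rewrite /C.
    by rewrite /g1 (bigD1 (Ordinal h)) //= up0 ?expr4_double // !mul0r mulr0 mul0r.
  by rewrite /g2 (bigD1 (Ordinal h)) //= up0 ?expr4_double // !mul0r mulr0.
exists (tens m n 1 1) => ts sts.
move: (A12 _ _ _ _ _ _) coef_A12 => A coefA.
(* The Boolean factor also records that the coefficients of higher degree vanish, so that neither
   the scalars [t] nor the lowering entries contribute to the next top degree. *)
have main i k : (size ts <= i + k)%N ->
    (bival (factors A ts (tens m n 1 1)))`_i`_k = (i + k == size ts)%N%:R * C i k.
  elim: ts {sts} i k => [|t ts IH] i k.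
    move=> _ /=; rewrite tens_coef !coef1 -natrM mulnb.
    case: i k => [|i] [|k] /=; rewrite ?mul0r ?if_same //.
    by rewrite /C /g1 /g2 !big_ord0 !mulr1.
  rewrite (_ : size (t :: ts) = (size ts).+1) // => h; rewrite factors_cons.
  rewrite -scaleN1r bivalD !coefD bivalZ coefZ coefCM bivalZ coefZ coefCM.
  have z j l : (size ts < j + l)%N -> (bival (factors A ts (tens m n 1 1)))`_j`_l = 0.
    by move=> jl; rewrite IH ?(ltnW jl) // gtn_eqF // mul0r.
  have o j l : (j + l = size ts)%N -> (bival (factors A ts (tens m n 1 1)))`_j`_l = C j l.
    by move=> jl; rewrite IH ?jl // eqxx mul1r.
  rewrite coefA /hop (z i k) // (z i.+1 k) ?addSn 1?ltnW // (z i k.+1) ?addnS 1?ltnW //.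
  rewrite !mulr0 !addr0.
  have [e|ne] := eqVneq (i + k)%N (size ts).+1; last first.
    rewrite mul0r; case: i h ne => [|i] h ne; case: k h ne => [|k] h ne;
      rewrite ?z ?mulr0 ?addr0 //; lia.
  rewrite mul1r Crec; last by rewrite e.
  by case: i e {h} => [|i] e; case: k e => [|k] e; rewrite ?o //; lia.
have := main m n; rewrite sts => /(_ (leqnn _)); rewrite eqxx mul1r => e.
apply/negP => /eqP z; move: e; rewrite z /= !coef0 => /esym/eqP; apply/negP.
rewrite !mulf_neq0 //.
- by apply/prodf_neq0 => i _.
- by apply/prodf_neq0 => i _; rewrite mulf_neq0 ?invr_eq0 // (upn0 _ _ m) ?expr4_double.
apply/prodf_neq0 => i _; apply: mulf_neq0; first by rewrite (upn0 _ _ n) ?expr4_double.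
by rewrite invr_eq0 mulf_neq0 // expf_neq0.
Qed.
End Cyclic.

(* x is not in S(n, q / u^2), where s^2 = q.                                  *)
Definition off_string (F : fieldType) (s : F) n u x :=
  forall t, (t < n)%N -> u ^+ 2 * x * (s ^+ 2) ^+ (2 * t) != (s ^+ n) ^+ 2.

Section Pair.
Variables (F : fieldType) (m n : nat).
Local Notation V := (bipoly F m n).
Implicit Types (s u a b : F) (f : V) (k i : nat).

Lemma A12_inva s u1 u2 a : nonroot s -> u1 != 0 -> u2 != 0 -> a != 0 ->
  A12 m n s u1 u2 a^-1 = A12 m n s u1 u2 a.
Proof.
move=> sr u10 u20 a0; have s0 : s != 0 by case: sr.
have q0 : s ^+ 2 != 0 by rewrite expf_neq0.
apply/lfunP => f; apply: (ev_inj (nonroot_inj sr)) => i j.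
rewrite !ev_A12 ?invr_eq0 ?expf_neq0 // invrK.
have -> (X : F) : (a^-1 + a) * X = (a + a^-1) * X by rewrite addrC.
have E (c x X : F) : c * (1 - u1 / s ^+ m / a * x) * (1 - u1 / s ^+ m * a * x) * X =
   c * (1 - u1 / s ^+ m * a * x) * (1 - u1 / s ^+ m / a * x) * X by rewrite [c * _ * _]mulrAC.
have E' (c x X : F) : c * (1 - u2 / s ^+ n / a * x) * (1 - u2 / s ^+ n * a * x) * X =
   c * (1 - u2 / s ^+ n * a * x) * (1 - u2 / s ^+ n / a * x) * X by rewrite [c * _ * _]mulrAC.
by rewrite E E'.
Qed.

Lemma theta_inva s a k : nonroot s -> a != 0 -> (k <= m + n)%N ->
  theta m n s a^-1 k = theta m n s a (m + n - k).
Proof.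
move=> [s0 _] a0 kN; rewrite /theta -!exprD.
have Q0 : (s ^+ 2) ^+ (2 * k) != 0 by rewrite !expf_neq0.
have h0 : s ^+ (m + n) != 0 by rewrite expf_neq0.
have -> : (s ^+ 2) ^+ (2 * (m + n - k)) = (s ^+ (m + n)) ^+ 4 / (s ^+ 2) ^+ (2 * k).
  by apply: (canRL (mulfK Q0)); rewrite -exprD expr4_double; congr (_ ^+ _); lia.
by field; rewrite a0 Q0 h0.
Qed.

Lemma Psi_zero s u1 u2 a d1 d2 k1 k2 : (m < k1)%N || (n < k2)%N ->
  Psi m n s u1 u2 a d1 d2 k1 k2 = 0.
Proof.
case/orP => h; rewrite /Psi (psi_over _ _ _ h).
  by have := @tens_linl F m n (psi (s ^+ 2) (u2 / s ^+ n * a) d2 n k2) (-1) 0 0;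
    rewrite scaler0 addr0 scaleN1r addNr.
set p := psi _ _ _ _ _.
by have := @tens_linr F m n p (-1) 0 0; rewrite scaler0 addr0 scaleN1r addNr.
Qed.

Lemma Psi2_span s u1 u2 a b : s != 0 -> u1 != 0 -> u2 != 0 -> a != 0 -> b != 0 ->
  off_string s m u1 (a / b) -> off_string s n u2 (a / b) ->
  forall M : {vspace V},
  (forall k1 k2, (k1 <= m)%N -> (k2 <= n)%N -> Psi2 m n s u1 u2 a b k1 k2 \in M) ->
  M = fullv.
Proof.
move=> s0 u10 u20 a0 b0 H1 H2.
have h10 : s ^+ m != 0 by rewrite expf_neq0.
have h20 : s ^+ n != 0 by rewrite expf_neq0.
apply: Psi_spanning => // t.
  move=> /H1; apply: contraNneq; move: (_ ^+ (2 * t)) => Q e; apply/eqP.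
  have -> : u1 ^+ 2 * (a / b) * Q =
      u1 / s ^+ m * a / (s ^+ n) ^+ 2 * Q * (u1 / b * s ^+ m * (s ^+ n) ^+ 2).
    by field; rewrite b0 h10 h20.
  by rewrite e; field; rewrite b0 h20 u10.
move=> /H2; apply: contraNneq; move: (_ ^+ (2 * t)) => Q e; apply/eqP.
have -> : u2 ^+ 2 * (a / b) * Q = u2 / s ^+ n * a * Q * (u2 / b * s ^+ n).
  by field; rewrite b0 h20.
by rewrite e; field; rewrite b0 u20.
Qed.

(** Raising coefficients of the inverted parameters at the complementary indices, since [Psi2] read
    backwards is the basis attached to [B21]. *)
Definition lambda1 s u1 a b k1 k2 :=
  rho1 m n s^-1 u1^-1 b (s^-1 ^+ m / u1^-1 * a / (s^-1 ^+ n) ^+ 2) (m - k1) (n - k2).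
Definition lambda2 s u2 a b k2 := rho2 m n s^-1 u2^-1 b (s^-1 ^+ n / u2^-1 * a) (n - k2).

Lemma B21_Psi2 s u1 u2 a b k1 k2 : nonroot s -> u1 != 0 -> u2 != 0 -> b != 0 ->
  (k1 <= m)%N -> (k2 <= n)%N ->
  A12 m n s^-1 u1^-1 u2^-1 b (Psi2 m n s u1 u2 a b k1 k2) =
  theta m n s^-1 b (m + n - (k1 + k2)) *: Psi2 m n s u1 u2 a b k1 k2
  + (if k1 is k.+1 then lambda1 s u1 a b k1 k2 *: Psi2 m n s u1 u2 a b k k2 else 0)
  + (if k2 is k.+1 then lambda2 s u2 a b k2 *: Psi2 m n s u1 u2 a b k1 k else 0).
Proof.
move=> sr u10 u20 b0 k1m k2n; have s0 : s != 0 by case: sr.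
have P k l : (k <= m)%N -> (l <= n)%N -> Psi2 m n s u1 u2 a b k l =
  Psi2 m n s^-1 u1^-1 u2^-1 b a (m - k) (n - l) by apply: Psi2_inv.
rewrite [in LHS]P // A12_Psi ?leq_subr ?invr_eq0 //; last exact: nonroot_inv.
rewrite -[Psi m n _ _ _ _ _ _ _ _]/(Psi2 m n s^-1 u1^-1 u2^-1 b a (m - k1) (n - k2)).
rewrite -P // (_ : m - k1 + (n - k2) = m + n - (k1 + k2))%N; last by lia.
congr (_ + _ + _).
  case: k1 k1m => [|k1] k1m; first by rewrite Psi_zero ?scaler0 // subn0 ltnSn.
  by rewrite [in RHS]P ?(ltnW k1m) // (_ : (m - k1.+1).+1 = (m - k1))%N //; lia.
case: k2 k2n => [|k2] k2n; first by rewrite Psi_zero ?scaler0 // subn0 ltnSn orbT.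
by rewrite [in RHS]P ?(ltnW k2n) // (_ : (n - k2.+1).+1 = (n - k2))%N //; lia.
Qed.

Lemma half_A12 s u1 u2 a b : nonroot s -> u1 != 0 -> u2 != 0 -> a != 0 -> b != 0 ->
  off_string s m u1 (a / b) -> off_string s n u2 (a / b) ->
  off_string s m u1 (a^-1 / b) -> off_string s n u2 (a^-1 / b) ->
  uniq (map (theta m n s a) (iota 0 (m + n).+1)) ->
  half_tridiagonal (A12 m n s u1 u2 a) (A12 m n s^-1 u1^-1 u2^-1 b)
       (map (theta m n s a) (iota 0 (m + n).+1)).
Proof.
move=> sr u10 u20 a0 b0 H1 H2 H1' H2' uth; have s0 : s != 0 by case: sr.
have a0' : a^-1 != 0 by rewrite invr_eq0.
have Z c k1 k2 : (m < k1)%N || (n < k2)%N -> Psi2 m n s u1 u2 c b k1 k2 = 0.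
  exact: Psi_zero.
have AP c k1 k2 : c != 0 -> (k1 <= m)%N -> (k2 <= n)%N ->
   A12 m n s u1 u2 c (Psi2 m n s u1 u2 c b k1 k2)
   - theta m n s c (k1 + k2) *: Psi2 m n s u1 u2 c b k1 k2
   \in flag m n (Psi2 m n s u1 u2 c b) (k1 + k2).+1.
  move=> c0 k1m k2n; rewrite A12_Psi // [_ - _]addrC !addrA addNr add0r.
  by rewrite memvD // memvZ // mem_flag ?addSn ?addnS //; apply: Z.
have BP c k1 k2 : c != 0 -> (k1 <= m)%N -> (k2 <= n)%N ->
   A12 m n s^-1 u1^-1 u2^-1 b (Psi2 m n s u1 u2 c b k1 k2)
   \in flag m n (Psi2 m n s u1 u2 c b) (k1 + k2).-1.
  move=> c0 k1m k2n; rewrite B21_Psi2 // !memvD ?memvZ //.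
  - by apply: mem_flag; [exact: Z|exact: leq_pred].
  - case: k1 k1m => [|k1] k1m; first by rewrite mem0v.
    by rewrite memvZ // mem_flag // => *; apply: Z.
  case: k2 k2n => [|k2] k2n; first by rewrite mem0v.
  by rewrite memvZ // mem_flag ?addnS // => *; apply: Z.
apply: (@two_flags_half _ _ m n (Psi2 m n s u1 u2 a b) (Psi2 m n s u1 u2 a^-1 b)) => //.
- exact: Z.
- exact: Z.
- exact: Psi2_span.
- exact: Psi2_span.
- by move=> *; apply: AP.
(* Inverting [a] fixes [A12] but reverses the eigenvalues, which produces the second flag. *)
- move=> k1 k2 k1m k2n; rewrite -theta_inva ?leq_add // -A12_inva //.
  exact: AP.
- by move=> *; apply: BP.
- by move=> *; apply: BP.
exact: A12_cyclic.
Qed.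

End Pair.

(** * Irreducibility *)

Section Generation.
Variables (K : fieldType) (V : vectType K) (m n : nat) (Psi : nat -> nat -> V).
Hypothesis Psi0 : forall k1 k2, (m < k1)%N || (n < k2)%N -> Psi k1 k2 = 0.
Variables (A B : 'End(V)) (th th' : nat -> K) (r1 l1 : nat -> nat -> K) (r2 l2 : nat -> K).
Hypothesis A_Psi : forall k1 k2, (k1 <= m)%N -> (k2 <= n)%N ->
  A (Psi k1 k2) = th (k1 + k2)%N *: Psi k1 k2 + r1 k1 k2 *: Psi k1.+1 k2
                  + r2 k2 *: Psi k1 k2.+1.
Hypothesis B_Psi : forall k1 k2, (k1 <= m)%N -> (k2 <= n)%N ->
  B (Psi k1 k2) = th' (k1 + k2)%N *: Psi k1 k2
    + (if k1 is k.+1 then l1 k1 k2 *: Psi k k2 else 0)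
    + (if k2 is k.+1 then l2 k2 *: Psi k1 k else 0).
Hypothesis r1m : forall k, r1 m k = 0.
Hypothesis r2n : r2 n = 0.
Hypothesis r2_neq0 : forall k, (k < n)%N -> r2 k != 0.
Hypothesis r1_neq0 : forall i k, (n <= i)%N -> (i < m)%N -> (k <= n)%N -> r1 (i - k)%N k != 0.

(* Applying A - th_j, A - th_(j+1) and B - th'_(j+2) to Psi j 0 and removing  *)
(* multiples of the vectors obtained from Psi j 0 and Psi (j-1) 1 leaves      *)
(* mu j *: Psi (j+1) 0.                                                       *)
Definition mu j :=
  let S := r1 j 0%N + r1 j 1%N in
  r1 j 0%N * r1 j.+1 0%N * l1 j.+2 0%N + r2 0%N * S * l2 1%N
  - r1 j 0%N * (S * l1 j.+1 1%N + r2 1%N * l2 2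
                - (if j is j'.+1 then l1 j 2 * r1 j' 1%N else 0)).
Hypothesis mu_neq0 : forall j, (j < m)%N -> (j < n)%N -> mu j != 0.

Variable M : {vspace V}.
Hypotheses (AM : (A @: M <= M)%VS) (BM : (B @: M <= M)%VS).
Hypothesis P0 : Psi 0%N 0%N \in M.

Let L (C : 'End(V)) t v := C v - t *: v.

Let LD C t c v d w : L C t (c *: v + d *: w) = c *: L C t v + d *: L C t w.
Proof.
rewrite /L; have -> : C (c *: v + d *: w) = c *: C v + d *: C w by rewrite linearD !linearZ.
by rewrite scalerDr opprD addrACA !scalerBr !scalerA ![t * _]mulrC.
Qed.

Let LM C t v : (C @: M <= M)%VS -> v \in M -> L C t v \in M.
Proof.
move=> /subvP CM vM; rewrite memvB ?memvZ //; apply: CM; exact: memv_img.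
Qed.

Let A_L k1 k2 : (k1 <= m)%N -> (k2 <= n)%N ->
  L A (th (k1 + k2)%N) (Psi k1 k2) = r1 k1 k2 *: Psi k1.+1 k2 + r2 k2 *: Psi k1 k2.+1.
Proof. by move=> h1 h2; rewrite /L A_Psi // [_ - _]addrC !addrA addNr add0r. Qed.

Let B_L k1 k2 : (k1 <= m)%N -> (k2 <= n)%N ->
  L B (th' (k1 + k2)%N) (Psi k1 k2) = (if k1 is k.+1 then l1 k1 k2 *: Psi k k2 else 0)
    + (if k2 is k.+1 then l2 k2 *: Psi k1 k else 0).
Proof. by move=> h1 h2; rewrite /L B_Psi // [_ - _]addrC !addrA addNr add0r. Qed.

Let L3 (x y z : V) a b c := a *: x + b *: y + c *: z.
Let L3D x y z a b c a' b' c' :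
  L3 x y z a b c + L3 x y z a' b' c' = L3 x y z (a + a') (b + b') (c + c').
Proof. by rewrite /L3 !scalerDl addrACA; congr (_ + _); rewrite addrACA. Qed.
Let L3Z x y z t a b c : t *: L3 x y z a b c = L3 x y z (t * a) (t * b) (t * c).
Proof. by rewrite /L3 !scalerDr !scalerA. Qed.

Let mem_scale t v : t != 0 -> t *: v \in M -> v \in M.
Proof. by move=> t0 /(memvZ t^-1); rewrite scalerA mulVf // scale1r. Qed.

Lemma mu_mem j : (j < m)%N -> (j < n)%N ->
  (forall k1 k2, (k1 + k2 = j)%N -> Psi k1 k2 \in M) -> mu j *: Psi j.+1 0%N \in M.
Proof.
move=> jm jn IH; set x := Psi j.+1 0%N; set y := Psi j 1%N.
(* For j = 0 there is no [Psi (j - 1) 2], and [z] is 0. *)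
pose z := if j is j'.+1 then Psi j' 2 else 0.
have e0 : r1 j 0%N *: x + r2 0%N *: y \in M.
  by rewrite -A_L ?addn0 ?(ltnW jm) // LM // IH ?addn0.
have e1 : (if j is j'.+1 then r1 j' 1%N else 0) *: y + r2 1%N *: z \in M.
  rewrite /y /z; case: (j) jm jn IH => [|j'] j'm j'n IH.
    by rewrite scale0r scaler0 addr0 mem0v.
  by rewrite -A_L ?(ltnW (ltnW j'm)) //; [rewrite LM // IH ?addn1|lia].
have wM := LM (th j.+1) AM e0.
have := LM (th' j.+2) BM wM.
have -> : L A (th j.+1) (r1 j 0%N *: x + r2 0%N *: y) =
   (r1 j 0%N * r1 j.+1 0%N) *: Psi j.+2 0%N + 1 *: ((r2 0%N * (r1 j 0%N + r1 j 1%N)) *: Psi j.+1 1%N + (r2 0%N * r2 1%N) *: Psi j 2).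
  rewrite LD -{1}[j.+1]addn0 A_L ?addn0 // -[j.+1]addn1 A_L ?(ltnW jm) //; last by lia.
  rewrite addn1 scale1r !scalerDr !scalerA mulrDr scalerDl -!addrA; congr (_ + _).
  by rewrite [r1 j 0%N * _]mulrC; congr (_ + _).
rewrite !LD scale1r.
have E2 : (r1 j 0%N * r1 j.+1 0%N) *: L B (th' j.+2) (Psi j.+2 0%N) =
    (r1 j 0%N * r1 j.+1 0%N * l1 j.+2 0%N) *: x.
  have [j2|mj] := leqP j.+2 m; first by rewrite -{1}[j.+2]addn0 B_L // addr0 scalerA.
  have -> : j.+1 = m by lia.
  by rewrite r1m !mulr0 mul0r !scale0r.
have E1 : L B (th' j.+2) (Psi j.+1 1%N) = l1 j.+1 1%N *: y + l2 1%N *: x.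
  by rewrite -[j.+2]addn1 B_L //; lia.
have E0 : (r2 0%N * r2 1%N) *: L B (th' j.+2) (Psi j 2) =
    (r2 0%N * r2 1%N) *: (((if j is j'.+1 then l1 j 2 else 0) *: z) + l2 2 *: y).
  have [n2|n2] := leqP 2 n; last first.
    by have -> : 1%N = n; [lia|rewrite r2n mulr0 !scale0r].
  rewrite -addn2 B_L ?(ltnW jm) //; congr (_ *: (_ + _)).
  by rewrite /z; case: (j); rewrite ?scaler0.
rewrite E2 E1 E0 => h.
set G := r1 j 0%N + r1 j 1%N in h *.
set t := if j is j'.+1 then r1 j' 1%N else 0 in e1.
set t' := if j is j'.+1 then l1 j 2 else 0 in h.
set g := G * l1 j.+1 1%N + r2 1%N * l2 2 - t' * t.
have e0' : r1 j 0%N *: x + r2 0%N *: y = L3 x y z (r1 j 0%N) (r2 0%N) 0.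
  by rewrite /L3 scale0r addr0.
have e1' : t *: y + r2 1%N *: z = L3 x y z 0 t (r2 1%N) by rewrite /L3 scale0r add0r.
have hE : (r1 j 0%N * r1 j.+1 0%N * l1 j.+2 0%N) *: x + ((r2 0%N * G) *: (l1 j.+1 1%N *: y + l2 1%N *: x) +
   (r2 0%N * r2 1%N) *: (t' *: z + l2 2 *: y)) =
   L3 x y z (r1 j 0%N * r1 j.+1 0%N * l1 j.+2 0%N) 0 0 + ((r2 0%N * G) *: L3 x y z (l2 1%N) (l1 j.+1 1%N) 0 +
   (r2 0%N * r2 1%N) *: L3 x y z 0 (l2 2) t').
  rewrite /L3 !scale0r !addr0 add0r; congr (_ + (_ *: _ + _ *: _)); exact: addrC.
have : mu j *: x = L3 x y z (mu j) 0 0 by rewrite /L3 !scale0r !addr0.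
(* Subtracting [r2 0 * t'] times the vector of [e1] removes [z]. The coefficient of [y] is then
   [r2 0 * g], which [g] times the vector of [e0] removes. *)
have -> : L3 x y z (mu j) 0 0 =
   (L3 x y z (r1 j 0%N * r1 j.+1 0%N * l1 j.+2 0%N) 0 0 + ((r2 0%N * G) *: L3 x y z (l2 1%N) (l1 j.+1 1%N) 0 +
   (r2 0%N * r2 1%N) *: L3 x y z 0 (l2 2) t')) + ((- r2 0%N * t') *: L3 x y z 0 t (r2 1%N)
   + (- g) *: L3 x y z (r1 j 0%N) (r2 0%N) 0).
  have mE : mu j = r1 j 0%N * r1 j.+1 0%N * l1 j.+2 0%N + r2 0%N * G * l2 1%N - r1 j 0%N * g.
    rewrite /mu /g /t /t' -/G; congr (_ - _ * (_ - _)).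
    by case: (j); rewrite ?mul0r.
  rewrite !L3Z !L3D mE; congr L3; rewrite /g; ring.
by rewrite -hE -e0' -e1' => ->; rewrite memvD // memvD // memvZ.
Qed.

(** Induction on the degree. Applying [A - th i] in degree [i] puts combinations of neighbours in
    degree [i + 1] into [M], and as [r2] is nonzero below [n] it suffices to reach [Psi i.+1 0]. For
    [m <= i] this vector is 0; for [n <= i < m] it is reached downwards from the zero vector with
    second index [n + 1], using [r1_neq0]; otherwise [mu i] provides it. *)
Lemma grid_generated k1 k2 : (k1 <= m)%N -> (k2 <= n)%N -> Psi k1 k2 \in M.
Proof.
suff H i k : (k <= i)%N -> Psi (i - k)%N k \in M.
  by move=> _ _; have := H (k1 + k2)%N k2; rewrite addnK leq_addl; apply.
elim: i k => [|i IH] k; first by rewrite leqn0 => /eqP->.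
have R k' : (k' <= i)%N -> r1 (i - k')%N k' *: Psi (i - k').+1 k' + r2 k' *: Psi (i - k')%N k'.+1 \in M.
  move=> ki; have [|h] := boolP ((i - k' <= m)%N && (k' <= n)%N).
    by case/andP => h1 h2; rewrite -A_L // LM // IH.
  rewrite !Psi0 ?scaler0 ?addr0 ?mem0v //; move: h; rewrite negb_and -!ltnNge => /orP[h|h]; lia.
suff : Psi i.+1 0%N \in M.
  move=> Pi; elim: k => [|k IHk] ki; first by rewrite subn0.
  have [nk|kn] := leqP n k; first by rewrite Psi0 ?mem0v // ltnS nk orbT.
  rewrite subSS; apply: (mem_scale (r2_neq0 kn)).
  have := R k ki; have -> : ((i - k).+1 = i.+1 - k)%N by lia.
  move=> h; have := IHk (ltnW ki) => /(memvZ (- r1 (i - k)%N k)) h'.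
  by have := memvD h h'; rewrite scaleNr addrAC subrr add0r.
have [mi|im] := leqP m i; first by rewrite Psi0 ?mem0v // ltnS mi.
have [ni|ilt] := leqP n i; last first.
  apply: (mem_scale (mu_neq0 im ilt)); apply: mu_mem => // k1' k2' e.
  by have := IH k2'; rewrite -e addnK leq_addl; apply.
suff D d : (d <= n.+1)%N -> Psi (i.+1 - (n.+1 - d))%N (n.+1 - d)%N \in M.
  by have := D n.+1 (leqnn _); rewrite subnn subn0.
elim: d => [|d IHd] dn; first by rewrite subn0 Psi0 ?mem0v // ltnSn orbT.
have kn : (n.+1 - d.+1 <= n)%N by lia.
have := R (n.+1 - d.+1)%N (leq_trans kn ni).
have := IHd (ltnW dn); set k0 := (n.+1 - d.+1)%N.
have -> : (n.+1 - d = k0.+1)%N by rewrite /k0; lia.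
have -> : ((i - k0).+1 = i.+1 - k0)%N by rewrite /k0; lia.
rewrite subSS => h h'; apply: (mem_scale (r1_neq0 ni im kn)).
have := memvD h' (memvZ (- r2 k0) h).
by rewrite scaleNr addrK.
Qed.
End Generation.

(** * The diagonal bilinear form *)

Section Weight.
Variables (F : fieldType).
Implicit Types (s u : F) (d i : nat).

(* Weights for which raising and lowering are adjoint up to u -> q / u.       *)
Definition wt s d i : F := \prod_(t < i)
  ((1 - (s ^+ 2) ^+ (2 * t.+1)) / (s ^+ 2 * (s ^+ d) ^+ 2 * (1 - (s ^+ 2) ^+ (2 * t) / (s ^+ d) ^+ 4))).

Lemma top_neq0 s d i : nonroot s -> (i < d)%N -> 1 - (s ^+ 2) ^+ (2 * i) / (s ^+ d) ^+ 4 != 0.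
Proof.
move=> sr id_; have s0 : s != 0 by case: sr.
rewrite subr_eq0 expr4_double eq_sym; apply/eqP => /divr1_eq /(nonroot_inj sr); lia.
Qed.

Lemma bot_neq0 s i : nonroot s -> 1 - (s ^+ 2) ^+ (2 * i.+1) != 0.
Proof. by case=> _ H; rewrite subr_eq0 eq_sym H. Qed.

Lemma wt_neq0 s d i : nonroot s -> (i <= d)%N -> wt s d i != 0.
Proof.
move=> sr id_; have s0 : s != 0 by case: sr.
apply/prodf_neq0 => t _; rewrite mulf_neq0 ?bot_neq0 // invr_eq0 !mulf_neq0 ?expf_neq0 //.
by apply: top_neq0 => //; apply: leq_trans (ltn_ord t) id_.
Qed.

(** Hence one and the same form serves for [A12] and for [B21], whose parameter is [s^-1]. *)
Lemma wt_inv s d i : nonroot s -> (i <= d)%N -> wt s^-1 d i = wt s d i.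
Proof.
move=> sr id_; have s0 : s != 0 by case: sr.
apply: eq_bigr => t _; have td : (t < d)%N by apply: leq_trans (ltn_ord t) id_.
have := top_neq0 sr td; rewrite !exprVn mulnS exprD.
have Q0 : (s ^+ 2) ^+ (2 * t) != 0 by rewrite !expf_neq0.
have h0 : s ^+ d != 0 by rewrite expf_neq0.
have q0 : s ^+ 2 != 0 by rewrite expf_neq0.
move: (s ^+ 2) (s ^+ d) ((s ^+ 2) ^+ (2 * t)) Q0 h0 q0 => q h Q Q0 h0 q0 T0.
have E : 1 - Q^-1 / h ^- 4 = - (h ^+ 4 / Q) * (1 - Q / h ^+ 4).
  by field; rewrite Q0 h0 ?oner_neq0.
rewrite E; move: (1 - Q / _) T0 => T T0; field.
by rewrite Q0 h0 q0 T0 oppr_eq0 expf_neq0.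
Qed.

(** Summation by parts: after a shift of the index, [W] exchanges the raising part for [u] with the
    lowering part for [q / u], and the other two parts likewise. The terms at [d + 1] vanish. *)
Lemma hop_adj s u d (x y : nat -> F) : nonroot s -> u != 0 -> x d.+1 = 0 -> y d.+1 = 0 ->
  \sum_(i < d.+1) wt s d i * hop s u (s ^+ d) x i * y i =
  \sum_(i < d.+1) wt s d i * x i * hop s (s ^+ 2 / u) (s ^+ d) y i.
Proof.
move=> sr u0 xd yd; have s0 : s != 0 by case: sr.
have h0 : s ^+ d != 0 by rewrite expf_neq0.
have q0 : s ^+ 2 != 0 by rewrite expf_neq0.
have W v i : v != 0 -> (i < d)%N ->
    wt s d i.+1 * up s v (s ^+ d) i = wt s d i * dn s (s ^+ 2 / v) (s ^+ d) i.+1.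
  move=> v0 id_; rewrite {1}/wt big_ord_recr /= /up /dn -[LHS]mulrA; congr (_ * _).
  have := top_neq0 sr id_; move: (1 - _ ^+ _ / _) => T T0.
  move: (1 - _ ^+ _) => B; move: (s ^+ 2) (s ^+ d) q0 h0 => q h q0 h0.
  by field; rewrite q0 h0 T0 v0.
have v0 : s ^+ 2 / u != 0 by rewrite mulf_neq0 ?invr_eq0.
have S v (x' y' : nat -> F) : x' d.+1 = 0 ->
    \sum_(i < d.+1) wt s d i * hop s v (s ^+ d) x' i * y' i =
    \sum_(i < d) wt s d i.+1 * up s v (s ^+ d) i * x' i * y' i.+1
    + \sum_(i < d) wt s d i * dn s v (s ^+ d) i.+1 * x' i.+1 * y' i.
  move=> x'd; rewrite /hop.
  under eq_bigr => i _ do rewrite mulrDr mulrDl.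
  rewrite big_split /= big_ord_recl /= mulr0 mul0r add0r; congr (_ + _).
    by apply: eq_bigr => i _; rewrite !mulrA.
  rewrite big_ord_recr /= x'd !mulr0 mul0r addr0.
  by apply: eq_bigr => i _; rewrite !mulrA.
under [RHS]eq_bigr => i _ do rewrite mulrAC.
rewrite !S // [LHS]addrC; apply: (f_equal2 +%R); apply: eq_bigr => i _.
  rewrite (W _ _ v0 (ltn_ord i)) (_ : s ^+ 2 / (s ^+ 2 / u) = u); last first.
    by rewrite invf_div mulrCA mulfV ?mulr1.
  exact: mulrAC.
rewrite (W _ _ u0 (ltn_ord i)); exact: mulrAC.
Qed.
End Weight.

Section Form.
Variables (F : fieldType) (m n : nat) (s : F).
Hypothesis sr : nonroot s.
Local Notation V := (bipoly F m n).
Implicit Types (f g : V).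

Definition form s f g := \sum_(i < m.+1) \sum_(k < n.+1)
  wt s m i * wt s n k * (bival f)`_i`_k * (bival g)`_i`_k.

Lemma form_inv f g : form s^-1 f g = form s f g.
Proof.
apply: eq_bigr => i _; apply: eq_bigr => k _; rewrite !wt_inv //; exact: leq_ord.
Qed.

Lemma formC f g : form s f g = form s g f.
Proof. by apply: eq_bigr => i _; apply: eq_bigr => k _; rewrite mulrAC. Qed.

Lemma form_linr f : scalar (form s f).
Proof.
move=> c g h; rewrite mulr_sumr -big_split; apply: eq_bigr => i _ /=.
rewrite mulr_sumr -big_split; apply: eq_bigr => k _ /=.
by rewrite ?bivalD ?bivalZ !coefD coefZ coefCM; ring.
Qed.

Lemma form_linl g : scalar (form s ^~ g).
Proof. by move=> c f h; rewrite !(formC _ g) form_linr. Qed.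

Lemma form_nondeg f : (forall g, form s f g = 0) -> f = 0.
Proof.
move=> H; apply: bipolyP => i k im kn.
have := H (tens m n 'X^i 'X^k); rewrite /form (bigD1 (Ordinal im)) //= [X in _ + X]big1 ?addr0.
  rewrite (bigD1 (Ordinal kn)) //= [X in _ + X]big1 ?addr0 => [|k'].
    rewrite tens_coef im kn /= !coefXn !eqxx !mulr1 => /eqP.
    rewrite !mulf_eq0 !(negPf (wt_neq0 _ _)) //= => /eqP->.
    by rewrite !coef0.
  rewrite -val_eqE /= => kk'; rewrite tens_coef !coefXn (negPf kk') mulr0.
  by case: ifP; rewrite mulr0.
move=> i'; rewrite -val_eqE /= => ii'; apply: big1 => k' _.
by rewrite tens_coef !coefXn (negPf ii') mul0r; case: ifP; rewrite mulr0.
Qed.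

(** By [coef_A12] the operator is a hop in z1, a hop in z2 weighted by a function of the first
    index, and a diagonal part without [u1] and [u2]. [hop_adj] applies to the first two, one
    variable at a time. *)
Lemma form_A12 u1 u2 a f g : u1 != 0 -> u2 != 0 -> a != 0 ->
  form s (A12 m n s u1 u2 a f) g = form s f (A12 m n s (s ^+ 2 / u1) (s ^+ 2 / u2) a g).
Proof.
move=> u10 u20 a0; have s0 : s != 0 by case: sr.
have q0 : s ^+ 2 != 0 by rewrite expf_neq0.
have out (h : V) i k : (m < i)%N || (n < k)%N -> (bival h)`_i`_k = 0.
  exact: (bounded_bidegreeP _ _ _ (bival_bounded h)).
have o1 (h : V) k : (bival h)`_(m.+1)`_k = 0 by apply: out; rewrite ltnSn.
have o2 (h : V) i : (bival h)`_i`_(n.+1) = 0 by apply: out; rewrite ltnSn orbT.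
have distl (w x y z t : F) : w * (x + y + z) * t = w * x * t + w * y * t + w * z * t by ring.
have distr (w x y z t : F) : w * t * (x + y + z) = w * t * x + w * t * y + w * t * z by ring.
rewrite /form; under eq_bigr => i _ do under eq_bigr => k _ do rewrite coef_A12 // distl.
under [RHS]eq_bigr => i _ do under eq_bigr => k _ do rewrite coef_A12 ?mulf_neq0 ?invr_eq0 // distr.
under eq_bigr => i _ do rewrite !big_split /=.
under [RHS]eq_bigr => i _ do rewrite !big_split /=.
rewrite !big_split /=; congr (_ + _ + _).
- rewrite exchange_big [RHS]exchange_big /=; apply: eq_bigr => k _.
  have := hop_adj (x := fun j => (bival f)`_j`_k) (y := fun j => (bival g)`_j`_k) sr u10 (o1 f k) (o1 g k).
  move=> /(congr1 ( *%R (wt s n k))); rewrite !mulr_sumr => e.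
  by transitivity (\sum_(i < m.+1) wt s n k *
      (wt s m i * hop s u1 (s ^+ m) (fun j => (bival f)`_j`_k) i * (bival g)`_i`_k));
    [|rewrite e]; apply: eq_bigr => i _; ring.
- apply: eq_bigr => i _.
  have := hop_adj (x := fun j => (bival f)`_i`_j) (y := fun j => (bival g)`_i`_j) sr u20 (o2 f i) (o2 g i).
  move=> /(congr1 ( *%R (wt s m i * ((s ^+ 2) ^+ (2 * i) / (s ^+ m) ^+ 2)))).
  rewrite !mulr_sumr => e.
  by transitivity (\sum_(k < n.+1) wt s m i * ((s ^+ 2) ^+ (2 * i) / (s ^+ m) ^+ 2) *
      (wt s n k * hop s u2 (s ^+ n) (fun j => (bival f)`_i`_j) k * (bival g)`_i`_k));
    [|rewrite e]; apply: eq_bigr => k _; ring.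
by apply: eq_bigr => i _; apply: eq_bigr => k _; ring.
Qed.
End Form.

Lemma form_B21 (F : fieldType) m n (s u1 u2 b : F) f g : nonroot s -> u1 != 0 -> u2 != 0 -> b != 0 ->
  form s (A12 m n s^-1 u1^-1 u2^-1 b f) g =
  form s f (A12 m n s^-1 (s ^+ 2 / u1)^-1 (s ^+ 2 / u2)^-1 b g).
Proof.
move=> sr u10 u20 b0; rewrite -[LHS](form_inv sr) -[RHS](form_inv sr).
have E v : (s^-1) ^+ 2 / v^-1 = (s ^+ 2 / v)^-1 by rewrite invf_div exprVn invrK mulrC.
have := form_A12 (nonroot_inv sr) f g (u1 := u1^-1) (u2 := u2^-1) (a := b).
by rewrite !E; apply; rewrite ?invr_eq0.
Qed.

(** * Nonvanishing of the coefficients and irreducibility *)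

Section Irreducible.
Variables (F : fieldType) (m n : nat).
Local Notation V := (bipoly F m n).
Implicit Types (s u a b : F).

(** [lambda1] freed of the truncated differences [m - k1] and [n - k2], so that [mu_value] is an
    identity of rational functions without bounds on [j]. *)
Definition lambda1_closed s u1 a b k1 k2 : F :=
  (1 - ((s ^+ 2) ^+ (2 * k1))^-1) *
  ((s ^+ m) ^+ 2 / (b * (s ^+ 2) ^+ (2 * k2) / (s ^+ n) ^+ 2)
   - u1 ^+ 2 * (a * (s ^+ 2) ^+ (2 * k2) / (s ^+ n) ^+ 2) * (s ^+ 2) ^+ (2 * k1) / (s ^+ 2) ^+ 2).
Definition lambda2_closed s u2 a b k2 : F :=
  (s ^+ m) ^+ 2 * (1 - ((s ^+ 2) ^+ (2 * k2))^-1) *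
  ((s ^+ n) ^+ 2 / b - u2 ^+ 2 * a * (s ^+ 2) ^+ (2 * k2) / (s ^+ 2) ^+ 2).

Lemma lambda1E s u1 a b k1 k2 : s != 0 -> u1 != 0 -> b != 0 -> (k1 <= m)%N -> (k2 <= n)%N ->
  lambda1 m n s u1 a b k1 k2 = lambda1_closed s u1 a b k1 k2.
Proof.
move=> s0 u10 b0 k1m k2n; rewrite /lambda1 /lambda1_closed /rho1 /phi !exprVn !invrK.
have R N k : (k <= N)%N -> (s ^+ 2) ^+ (2 * (N - k)) = (s ^+ N) ^+ 4 / (s ^+ 2) ^+ (2 * k).
  move=> kN; apply: (canRL (mulfK _)); first by rewrite !expf_neq0.
  by rewrite -exprD expr4_double; congr (_ ^+ _); lia.
rewrite !R //.
have h10 : s ^+ m != 0 by rewrite expf_neq0.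
have h20 : s ^+ n != 0 by rewrite expf_neq0.
have q0 : s ^+ 2 != 0 by rewrite expf_neq0.
have Q1 : (s ^+ 2) ^+ (2 * k1) != 0 by rewrite !expf_neq0.
have Q2 : (s ^+ 2) ^+ (2 * k2) != 0 by rewrite !expf_neq0.
move: (s ^+ 2) (s ^+ m) (s ^+ n) ((s ^+ 2) ^+ (2 * k1)) ((s ^+ 2) ^+ (2 * k2)) h10 h20 q0 Q1 Q2.
move=> q h1 h2 q1 q2 h10 h20 q0 Q1 Q2; field.
by rewrite b0 u10 h10 h20 q0 Q1 Q2 ?oner_neq0.
Qed.

Lemma lambda2E s u2 a b k2 : s != 0 -> u2 != 0 -> b != 0 -> (k2 <= n)%N ->
  lambda2 m n s u2 a b k2 = lambda2_closed s u2 a b k2.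
Proof.
move=> s0 u20 b0 k2n; rewrite /lambda2 /lambda2_closed /rho2 /phi !exprVn !invrK.
have R N k : (k <= N)%N -> (s ^+ 2) ^+ (2 * (N - k)) = (s ^+ N) ^+ 4 / (s ^+ 2) ^+ (2 * k).
  move=> kN; apply: (canRL (mulfK _)); first by rewrite !expf_neq0.
  by rewrite -exprD expr4_double; congr (_ ^+ _); lia.
rewrite !R //.
have h20 : s ^+ n != 0 by rewrite expf_neq0.
have q0 : s ^+ 2 != 0 by rewrite expf_neq0.
have Q2 : (s ^+ 2) ^+ (2 * k2) != 0 by rewrite !expf_neq0.
move: (s ^+ 2) (s ^+ m) (s ^+ n) ((s ^+ 2) ^+ (2 * k2)) h20 q0 Q2.
move=> q h1 h2 q2 h20 q0 Q2; field.
by rewrite b0 u20 h20 q0 Q2 ?oner_neq0.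
Qed.

Lemma phiE s u b a d Q : s ^+ d != 0 -> u != 0 -> a != 0 -> Q != 0 ->
  phi (s ^+ 2) u (s ^+ d) a (s ^+ d / u * b) Q =
  (1 - Q / (s ^+ d) ^+ 4) * (a * b * (s ^+ 2) ^+ 2 * Q - u ^+ 2 * (s ^+ d) ^+ 2) / (u ^+ 2 * a * Q).
Proof. by move=> h0 u0 a0 Q0; rewrite /phi; field; rewrite h0 u0 a0 Q0. Qed.

(** For [j < m] the factors in [q], [h1] and [T] alone are nonzero because q is not a root of unity.
    The factor with [a * b] is excluded by condition (ii), and the last two by the first and third
    inequalities of [off_res]. *)
Lemma mu_value s u1 u2 a b j : nonroot s -> u1 != 0 -> u2 != 0 -> a != 0 -> b != 0 ->
  let h1 := s ^+ m in let h2 := s ^+ n in let q := s ^+ 2 in let T := (s ^+ 2) ^+ (2 * j) in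
  mu (rho1 m n s u1 a (s ^+ m / u1 * b / (s ^+ n) ^+ 2)) (lambda1_closed s u1 a b)
     (rho2 m n s u2 a (s ^+ n / u2 * b)) (lambda2_closed s u2 a b) j =
  T / (h1 ^+ 4 * h2 ^+ 2 * q ^+ 4) * (1 - q ^+ 4) * (1 - q ^+ 2) * (1 - h1 ^+ 4 / T)
  * (1 - a * b * q ^+ 2 * T / (h1 ^+ 2 * u1 ^+ 2))
  * (u2 ^+ 2 - u1 ^+ 2 * h1 ^+ 2 * h2 ^+ 2 / T)
  * (u1 ^+ 2 * u2 ^+ 2 * h1 ^+ 2 * h2 ^+ 2 / T - q ^+ 2) / (a * u1 ^+ 2 * u2 ^+ 2).
Proof.
move=> sr u10 u20 a0 b0 h1 h2 q T; have s0 : s != 0 by case: sr.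
have h10 : h1 != 0 by rewrite expf_neq0.
have h20 : h2 != 0 by rewrite expf_neq0.
have q0 : q != 0 by rewrite expf_neq0.
have T0 : T != 0 by rewrite !expf_neq0.
rewrite /mu.
(* The factor [1 - T^-1] vanishes at j = 0, so the closed formula covers the default value too. *)
have -> : (if j is j'.+1 then lambda1_closed s u1 a b j 2 * rho1 m n s u1 a (s ^+ m / u1 * b / (s ^+ n) ^+ 2) j' 1 else 0) =
   (1 - T^-1) * (h1 ^+ 2 / (b * q ^+ 4 / h2 ^+ 2) - u1 ^+ 2 * (a * q ^+ 4 / h2 ^+ 2) * T / q ^+ 2)
   * phi q u1 h1 (a * q ^+ 2 / h2 ^+ 2) (h1 / u1 * b / h2 ^+ 2 * q ^+ 2) (T / q ^+ 2).
  rewrite /T; case: (j) => [|j']; first by rewrite expr0 invr1 subrr !mul0r.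
  by rewrite /lambda1_closed /rho1 -/q -/h1 -/h2 mulnS exprD [q ^+ 2 * q ^+ _]mulrC mulfK // expf_neq0.
have E k : q ^+ (2 * k.+1) = q ^+ 2 * q ^+ (2 * k) by rewrite mulnS exprD.
rewrite /rho1 /rho2 /lambda1_closed /lambda2_closed -/q -/h1 -/h2 !E muln0 expr0 -/T !mulr1.
rewrite /phi; field.
by rewrite h10 h20 q0 T0 u10 u20 a0 b0 ?oner_neq0.
Qed.

(* Condition (i) of the theorem: in none of the four pairs of q-strings do    *)
(* the two strings overlap partially or follow each other.                    *)
Definition off_res s u1 u2 := forall j, (j < m)%N -> (j < n)%N ->
  let P := (s ^+ m) ^+ 2 * (s ^+ n) ^+ 2 in let T := (s ^+ 2) ^+ (2 * j) in
  [/\ u2 ^+ 2 * T != u1 ^+ 2 * P, u1 ^+ 2 * T != u2 ^+ 2 * P,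
      u1 ^+ 2 * u2 ^+ 2 * P != (s ^+ 2) ^+ 2 * T
    & (s ^+ 2) ^+ 2 * P != u1 ^+ 2 * u2 ^+ 2 * T].

(** The duality exchanges the first inequality with the second and the third with the fourth.
    Generation uses the first and the third only, so the other two are what it needs for the adjoint
    operators. *)
Lemma off_res_dual s u1 u2 : s != 0 -> u1 != 0 -> u2 != 0 ->
  off_res s u1 u2 -> off_res s (s ^+ 2 / u1) (s ^+ 2 / u2).
Proof.
move=> s0 u10 u20 H j jm jn /=; have /= := H j jm jn.
have q0 : s ^+ 2 != 0 by rewrite expf_neq0.
move: (s ^+ 2) ((s ^+ 2) ^+ (2 * j)) ((s ^+ m) ^+ 2 * (s ^+ n) ^+ 2) q0 => q T P q0 [H1 H2 H3 H4].
have k1 : u1 ^+ 2 * u2 ^+ 2 / q ^+ 2 != 0 by rewrite !mulf_neq0 ?invr_eq0 ?expf_neq0.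
split.
- move: H2; apply: contraNneq => e; apply/eqP.
  have -> : u1 ^+ 2 * T = (q / u2) ^+ 2 * T * (u1 ^+ 2 * u2 ^+ 2 / q ^+ 2) by field; rewrite q0 u20.
  by rewrite e; field; rewrite q0 u10.
- move: H1; apply: contraNneq => e; apply/eqP.
  have -> : u2 ^+ 2 * T = (q / u1) ^+ 2 * T * (u1 ^+ 2 * u2 ^+ 2 / q ^+ 2) by field; rewrite q0 u10.
  by rewrite e; field; rewrite q0 u20.
- move: H4; apply: contraNneq => e; apply/eqP.
  have -> : q ^+ 2 * P = (q / u1) ^+ 2 * (q / u2) ^+ 2 * P * (u1 ^+ 2 * u2 ^+ 2 / q ^+ 2).
    by field; rewrite q0 u10 u20.
  by rewrite e; field.
move: H3; apply: contraNneq => e; apply/eqP.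
have -> : u1 ^+ 2 * u2 ^+ 2 * P = q ^+ 2 * P * (u1 ^+ 2 * u2 ^+ 2 / q ^+ 2) by field.
by rewrite e; field; rewrite q0 u10 u20.
Qed.

(** [u -> q / u] inverts [q / u^2], and inverting a q-string reverses it: index [t] corresponds to
    [d - t.+1]. *)
Lemma off_string_dual s d u x : s != 0 -> u != 0 -> x != 0 ->
  off_string s d u x -> off_string s d (s ^+ 2 / u) x^-1.
Proof.
move=> s0 u0 x0 H t td; have dt : (d - t.+1 < d)%N by lia.
have := H _ dt; apply: contraNneq => e.
have Q0 : (s ^+ 2) ^+ (2 * t) != 0 by rewrite !expf_neq0.
have q0 : s ^+ 2 != 0 by rewrite expf_neq0.
have h0 : s ^+ d != 0 by rewrite expf_neq0.
have -> : (s ^+ 2) ^+ (2 * (d - t.+1)) = (s ^+ d) ^+ 4 / ((s ^+ 2) ^+ 2 * (s ^+ 2) ^+ (2 * t)).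
  apply: (canRL (mulfK _)); first by rewrite mulf_neq0 // expf_neq0.
  by rewrite -!exprD expr4_double; congr (_ ^+ _); lia.
have -> : (s ^+ d) ^+ 4 = (s ^+ d) ^+ 2 * (s ^+ d) ^+ 2 by ring.
apply/eqP; rewrite -{1}e.
move: (s ^+ 2) (s ^+ d) ((s ^+ 2) ^+ (2 * t)) q0 h0 Q0 => q h Q q0 h0 Q0.
by field; rewrite x0 u0 q0 Q0.
Qed.

Lemma off_string_inv s d u x : s != 0 -> u != 0 -> x != 0 ->
  off_string s d u x -> off_string s^-1 d u^-1 x^-1.
Proof.
move=> s0 u0 x0 H t /H; apply: contraNneq; rewrite !exprVn -!invfM => e.
by apply/eqP/invr_inj; rewrite -e.
Qed.

Lemma phi_neq0 s d u c b' k : nonroot s -> (k < d)%N -> u != 0 -> c != 0 ->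
  u ^+ 2 * (s ^+ d) ^+ 2 != c * b' * (s ^+ 2) ^+ 2 * (s ^+ 2) ^+ (2 * k) ->
  phi (s ^+ 2) u (s ^+ d) c (s ^+ d / u * b') ((s ^+ 2) ^+ (2 * k)) != 0.
Proof.
move=> sr kd u0 c0 H; have s0 : s != 0 by case: sr.
rewrite phiE ?expf_neq0 // !mulf_neq0 ?invr_eq0 ?expf_neq0 //; first exact: top_neq0.
  by rewrite subr_eq0 eq_sym.
by rewrite !mulf_neq0 ?expf_neq0.
Qed.

Lemma off_string_mul s d u x e : nonroot s -> x != 0 -> off_string s d u x^-1 -> (0 < e)%N -> (e <= d)%N ->
  u ^+ 2 * (s ^+ d) ^+ 2 != x * (s ^+ 2) ^+ (2 * e).
Proof.
move=> sr x0 H e0 ed; have s0 : s != 0 by case: sr.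
have td : (d - e < d)%N by lia.
have := H _ td; apply: contraNneq => E.
have Q0 : (s ^+ 2) ^+ (2 * e) != 0 by rewrite !expf_neq0.
have h0 : s ^+ d != 0 by rewrite expf_neq0.
have -> : (s ^+ 2) ^+ (2 * (d - e)) = (s ^+ d) ^+ 4 / (s ^+ 2) ^+ (2 * e).
  by apply: (canRL (mulfK Q0)); rewrite -!exprD expr4_double; congr (_ ^+ _); lia.
apply/eqP; transitivity (u ^+ 2 * (s ^+ d) ^+ 2 * ((s ^+ d) ^+ 2 / (x * (s ^+ 2) ^+ (2 * e)))).
  by field; rewrite x0 Q0.
by rewrite E; field; rewrite x0 Q0.
Qed.

Section Generate.
Variables (s u1 u2 a b : F).
Hypotheses (sr : nonroot s) (u10 : u1 != 0) (u20 : u2 != 0) (a0 : a != 0) (b0 : b != 0).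
Hypothesis sp1 : off_string s m u1 (a / b).
Hypothesis sp2 : off_string s n u2 (a / b).
Hypothesis up1 : off_string s m u1 (a * b)^-1.
Hypothesis up2 : off_string s n u2 (a * b)^-1.
Hypothesis res : off_res s u1 u2.

Lemma Psi2_generates (M : {vspace V}) :
  (A12 m n s u1 u2 a @: M <= M)%VS -> (A12 m n s^-1 u1^-1 u2^-1 b @: M <= M)%VS ->
  Psi2 m n s u1 u2 a b 0 0 \in M -> M = fullv.
Proof.
move=> AM BM PM; have s0 : s != 0 by case: sr.
have q0 : s ^+ 2 != 0 by rewrite expf_neq0.
have h10 : s ^+ m != 0 by rewrite expf_neq0.
have h20 : s ^+ n != 0 by rewrite expf_neq0.
have Q0 k : (s ^+ 2) ^+ k != 0 by rewrite expf_neq0.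
have ab0 : a * b != 0 by rewrite mulf_neq0.
apply: (Psi2_span s0 u10 u20 a0 b0 sp1 sp2).
apply: (@grid_generated _ _ m n _ _ (A12 m n s u1 u2 a) (A12 m n s^-1 u1^-1 u2^-1 b)
  (theta m n s a) (fun k => theta m n s^-1 b (m + n - k))
  (rho1 m n s u1 a (s ^+ m / u1 * b / (s ^+ n) ^+ 2)) (lambda1_closed s u1 a b)
  (rho2 m n s u2 a (s ^+ n / u2 * b)) (lambda2_closed s u2 a b)) => //.
- by move=> k1 k2 h; apply: Psi_zero.
- by move=> k1 k2 h1 h2; apply: A12_Psi.
- move=> k1 k2 h1 h2; rewrite B21_Psi2 //; congr (_ + _ + _).
    by case: k1 h1 => // k1 h1; rewrite lambda1E.
  by case: k2 h2 => // k2 h2; rewrite lambda2E.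
- by move=> k; rewrite /rho1 /phi expr4_double divff ?expf_neq0 // subrr !(mulr0, addr0).
- by rewrite /rho2 /phi expr4_double divff ?expf_neq0 // subrr !(mulr0, addr0).
- move=> k kn; rewrite /rho2 mulf_neq0 ?invr_eq0 ?expf_neq0 // phi_neq0 //.
  have := off_string_mul sr ab0 up2 (ltn0Sn k) kn.
  by rewrite mulnS exprD !mulrA.
(* The parameters attached to [k] multiply [a * b] by [q^(4k - 2n)], so the exponent to be excluded
   is [i + k + 1 - n]. It lies between 1 and [m] since [n <= i < m] and [k <= n]. *)
- move=> i k ni im kn; rewrite /rho1.
  have ikm : (i - k < m)%N by clear -im; lia.
  have iknm : ((i + k).+1 - n <= m)%N by clear -ni im kn; lia.
  have ikn : (2 * ((i + k).+1 - n) + 2 * n = 2 + 2 * (i - k) + 2 * k + 2 * k)%N by clear -ni kn; lia.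
  set c := a * _ / _; have c0 : c != 0 by rewrite !mulf_neq0 ?invr_eq0 ?expf_neq0.
  have -> : s ^+ m / u1 * b / (s ^+ n) ^+ 2 * (s ^+ 2) ^+ (2 * k) = s ^+ m / u1 * (b * (s ^+ 2) ^+ (2 * k) / (s ^+ n) ^+ 2).
    ring.
  apply: phi_neq0 => //.
  have := off_string_mul (e := (i + k).+1 - n) sr ab0 up1; rewrite subn_gt0 ltnS (leq_trans ni) ?leq_addr //.
  move=> /(_ isT iknm); congr (_ != _).
  have -> : (s ^+ 2) ^+ (2 * ((i + k).+1 - n)) = (s ^+ 2) ^+ 2 *
      (s ^+ 2) ^+ (2 * (i - k)) * (s ^+ 2) ^+ (2 * k) * (s ^+ 2) ^+ (2 * k) / (s ^+ n) ^+ 4.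
    apply: (canRL (mulfK _)); first by rewrite expf_neq0.
    by rewrite expr4_double -!exprD ikn.
  rewrite /c; move: ((s ^+ 2) ^+ (2 * k)) ((s ^+ 2) ^+ (2 * (i - k))) => x y.
  by field.
move=> j jm jn; rewrite mu_value //.
have [H1 _ H3 _] := res jm jn.
have T0 : (s ^+ 2) ^+ (2 * j) != 0 by [].
have nr k : (0 < k)%N -> 1 - (s ^+ 2) ^+ k != 0.
  by case: sr => _ nr k0; rewrite subr_eq0 eq_sym nr.
have E1 : 1 - (s ^+ m) ^+ 4 / (s ^+ 2) ^+ (2 * j) != 0.
  rewrite subr_eq0 expr4_double eq_sym; apply/eqP => /divr1_eq /(nonroot_inj sr) e.
  by clear -jm e; lia.
have E2 : 1 - a * b * (s ^+ 2) ^+ 2 * (s ^+ 2) ^+ (2 * j) / ((s ^+ m) ^+ 2 * u1 ^+ 2) != 0.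
  have := off_string_mul sr ab0 up1 (ltn0Sn j) jm; apply: contraNneq => /eqP.
  rewrite subr_eq0 eq_sym => /eqP/divr1_eq e; apply/eqP.
  by rewrite mulnS exprD [RHS]mulrA e mulrC.
have E3 : u2 ^+ 2 - u1 ^+ 2 * (s ^+ m) ^+ 2 * (s ^+ n) ^+ 2 / (s ^+ 2) ^+ (2 * j) != 0.
  by move: H1; apply: contraNneq => /eqP; rewrite subr_eq0 => /eqP->; rewrite mulfVK // mulrA.
have E4 : u1 ^+ 2 * u2 ^+ 2 * (s ^+ m) ^+ 2 * (s ^+ n) ^+ 2 / (s ^+ 2) ^+ (2 * j) - (s ^+ 2) ^+ 2 != 0.
  by move: H3; apply: contraNneq => /eqP; rewrite subr_eq0 => /eqP<-; rewrite mulfVK // !mulrA.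
by rewrite !mulf_neq0 ?invr_eq0 ?mulf_neq0 ?expf_neq0 ?nr.
Qed.
End Generate.

Definition off_strings s d u a b :=
  [/\ off_string s d u (a / b), off_string s d u (a / b)^-1,
      off_string s d u (a * b) & off_string s d u (a * b)^-1].

Lemma off_strings_dual s d u a b : s != 0 -> u != 0 -> a != 0 -> b != 0 ->
  off_strings s d u a b -> off_strings s d (s ^+ 2 / u) a b.
Proof.
move=> s0 u0 a0 b0 [H1 H2 H3 H4].
have H x : x != 0 -> off_string s d u x -> off_string s d (s ^+ 2 / u) x^-1.
  exact: off_string_dual.
have ab0 : a * b != 0 by rewrite mulf_neq0.
have ab0' : a / b != 0 by rewrite mulf_neq0 ?invr_eq0.
split; [rewrite -[a / b]invrK| |rewrite -[a * b]invrK|]; apply: H => //; by rewrite invr_eq0.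
Qed.

Lemma factors_mem (A : 'End(V)) ts (W : {vspace V}) w : (A @: W <= W)%VS -> w \in W -> factors A ts w \in W.
Proof.
move=> /subvP AW wW; elim: ts => //= t ts IH.
by rewrite memvB ?memvZ // AW // memv_img.
Qed.

Lemma form_factors s (A A' : 'End(V)) ts f g : (forall f g, form s (A f) g = form s f (A' g)) ->
  form s (factors A ts f) g = form s f (factors A' ts g).
Proof.
move=> AA'; elim: ts g => //= t ts IH g.
rewrite -scaleNr addrC form_linl AA' !IH factors_comm.
by rewrite [in RHS]addrC -[in RHS]scaleNr form_linr.
Qed.

Lemma irreducible12 s u1 u2 a b : nonroot s -> u1 != 0 -> u2 != 0 -> a != 0 -> b != 0 ->
  off_strings s m u1 a b -> off_strings s n u2 a b -> off_res s u1 u2 ->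
  uniq (map (theta m n s^-1 b) (iota 0 (m + n).+1)) ->
  irreducible_pair (A12 m n s u1 u2 a) (A12 m n s^-1 u1^-1 u2^-1 b).
Proof.
move=> sr u10 u20 a0 b0 S1 S2 res uth W AW BW; have s0 : s != 0 by case: sr.
have q0 : s ^+ 2 != 0 by rewrite expf_neq0.
set B := A12 m n s^-1 _ _ b in BW.
(* All eigenvalues of [B] but the top one: the product over [ts] maps the space into the line of
   [Psi2 0 0]. *)
pose ts := map (theta m n s^-1 b) (iota 0 (m + n)).
have v10 : s ^+ 2 / u1 != 0 by rewrite mulf_neq0 ?invr_eq0.
have v20 : s ^+ 2 / u2 != 0 by rewrite mulf_neq0 ?invr_eq0.
have ab0 : a / b != 0 by rewrite mulf_neq0 ?invr_eq0.
case: (S1) (S2) => H1 _ _ H1' [H2 _ _ H2'].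
have gen M : (A12 m n s u1 u2 a @: M <= M)%VS -> (B @: M <= M)%VS ->
    Psi2 m n s u1 u2 a b 0 0 \in M -> M = fullv by exact: Psi2_generates.
have top w : exists c, factors B ts w = c *: Psi2 m n s u1 u2 a b 0 0.
  rewrite (Psi2_inv _ _ _ _ s0) // !subn0.
  have isr := nonroot_inv sr.
  apply: (@flag_fac_top _ _ m n (Psi2 m n s^-1 u1^-1 u2^-1 b a)).
  - by move=> k1 k2; apply: Psi_zero.
  - apply: Psi2_span; rewrite ?invr_eq0 // -[b / a]invf_div; exact: off_string_inv.
  move=> k1 k2 k1m k2n; rewrite A12_Psi ?invr_eq0 // [_ - _]addrC !addrA addNr add0r.
  by rewrite memvD // memvZ // mem_flag ?addSn ?addnS // => *; apply: Psi_zero.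
have [z|nz] := eqVneq (linfun (factors B ts) @: W)%VS 0%VS; last first.
  right; apply: gen => //.
  have /memv_imgP[w wW e] := memv_pick (linfun (factors B ts) @: W).
  have [c ec] := top w; rewrite lfunE /= in e.
  have c0 : c != 0.
    by apply: contraNneq nz => c0; rewrite -vpick0 e ec c0 scale0r.
  have := factors_mem ts BW wW; rewrite ec => /(memvZ c^-1).
  by rewrite scalerA mulVf // scale1r.
left.
have z' w : w \in W -> factors B ts w = 0.
  move=> wW; apply/eqP; rewrite -memv0 -z.
  by have := memv_img (linfun (factors B ts)) wW; rewrite lfunE.
have [W' [W'P _]] := orth_exists (form_linl s) (form_linr s) W.
pose A' := A12 m n s (s ^+ 2 / u1) (s ^+ 2 / u2) a.
pose B' := A12 m n s^-1 (s ^+ 2 / u1)^-1 (s ^+ 2 / u2)^-1 b.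
have AA' f g : form s (A12 m n s u1 u2 a f) g = form s f (A' g) by exact: form_A12.
have BB' f g : form s (B f) g = form s f (B' g) by exact: form_B21.
have inv (C C' : 'End(V)) : (forall f g, form s (C f) g = form s f (C' g)) ->
    (C @: W <= W)%VS -> (C' @: W' <= W')%VS.
  move=> CC' /subvP CW; apply/subvP => _ /memv_imgP[v /W'P vW' ->]; apply/W'P => w wW.
  by rewrite formC -CC' formC vW' // CW // memv_img.
have full : W' = fullv.
  apply: (@Psi2_generates s (s ^+ 2 / u1) (s ^+ 2 / u2) a b) => //.
  - by case: (off_strings_dual s0 u10 a0 b0 S1).
  - by case: (off_strings_dual s0 u20 a0 b0 S2).
  - by case: (off_strings_dual s0 u10 a0 b0 S1).
  - by case: (off_strings_dual s0 u20 a0 b0 S2).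
  - exact: off_res_dual.
  - exact: inv AW.
  - exact: inv BW.
  set t0 := Psi2 _ _ _ _ _ _ _ _ _; apply/W'P => w wW.
  (* Moved across the form, the product over [ts] acts on [t0] by the differences of the top
     eigenvalue with the others. These are nonzero, while the product kills [w]; so [w] is
     orthogonal to [t0]. *)
  have e : B' t0 = theta m n s^-1 b (m + n) *: t0.
    by rewrite /B' /t0 B21_Psi2 // !addr0 addn0 subn0.
  have := form_factors ts w t0 BB'; rewrite (z' _ wW) (factors_eigen _ e).
  have -> : form s 0 t0 = 0.
    by have := form_linl s t0 (-1) 0 0; rewrite scaler0 addr0 mulN1r addNr.
  have -> (c : F) : form s w (c *: t0) = c * form s w t0.
    have := form_linr s w c t0 0; rewrite addr0 => ->.
    by have := form_linr s w (-1) 0 0; rewrite scaler0 addr0 mulN1r addNr => ->; rewrite addr0.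
  move=> /esym/eqP; rewrite mulf_eq0 => /orP[|/eqP]; last by rewrite formC.
  rewrite prodf_seq_eq0 => /hasP[_ /mapP[i hi ->] /=]; rewrite subr_eq0 => /eqP ei.
  move: uth; rewrite -addn1 iotaD map_cat cat_uniq => /and3P[_ /hasPn/(_ (theta m n s^-1 b (m + n)))].
  rewrite /= inE eqxx => /(_ isT)/negP[].
  by rewrite ei; apply: map_f.
apply/eqP; rewrite -subv0; apply/subvP => w wW; rewrite memv0; apply/eqP.
apply: (form_nondeg sr) => g; rewrite formC.
by have /W'P : g \in W' by [rewrite full memvf]; apply.
Qed.
End Irreducible.

(** * Necessity *)

(** A subspace inside [P] is enlarged by one vector as long as [P] is not exhausted; the dimension
    bounds the number of steps. *)
Lemma vspace_of_pred (K : fieldType) (V : vectType K) (P : V -> Prop) :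
  P 0 -> (forall c v w, P v -> P w -> P (c *: v + w)) ->
  exists W : {vspace V}, forall v, v \in W <-> P v.
Proof.
move=> P0 PD.
suff H k (W : {vspace V}) : (forall v, v \in W -> P v) -> (\dim {:V} - \dim W <= k)%N ->
    exists W : {vspace V}, forall v, v \in W <-> P v.
  by apply: (H _ 0%VS _ (leqnn _)) => v; rewrite memv0 => /eqP->.
elim: k W => [|k IH] W WP.
  rewrite leqn0 subn_eq0 => d; exists W => v; split=> [/WP //|_].
  have -> : W = fullv; last exact: memvf.
  by apply/eqP; rewrite -(dimv_leqif_eq (subvf W)) eqn_leq d dimvS ?subvf.
move=> d; have [all|] := pselect (forall v, P v -> v \in W).
  by exists W => v; split=> [/WP|/all].
move=> /existsNP[v /not_implyP[Pv /negP vW]].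
apply: (IH (<[v]> + W)%VS) => [w /memv_addP[_ /vlineP[c ->] [w' /WP Pw' ->]]|].
  exact: PD.
have : (\dim W < \dim (<[v]> + W))%N.
  rewrite ltn_neqAle dimvS ?addvSr // andbT dimv_leqif_eq ?addvSr //.
  apply: contra vW => /eqP->; exact: subvP (addvSl _ _) _ (memv_line v).
have := dimvS (subvf (<[v]> + W)); move: d; lia.
Qed.

Section Necessity.
Variables (F : fieldType) (m n : nat).
Local Notation V := (bipoly F m n).
Implicit Types (s u a b : F).

Lemma diag_uniq s u1 u2 a : nonroot s -> u1 != 0 -> u2 != 0 -> a != 0 ->
  diagonalizable_end (A12 m n s u1 u2 a) -> uniq (map (theta m n s a) (iota 0 (m + n).+1)).
Proof.
move=> sr u10 u20 a0; have s0 : s != 0 by case: sr.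
set A := A12 _ _ _ _ _ _; set th := map _ _ => -[X Xb XP].
have an v : factors A th v = 0.
  (* With [d1 = d2 = 0] the vectors [Psi] span without any condition on the parameters. *)
  apply: (@flag_annih _ _ m n (Psi m n s u1 u2 a 0 0)).
  - by move=> k1 k2; apply: Psi_zero.
  - by apply: Psi_spanning => // t _; rewrite !mulf_neq0 ?invr_eq0 ?expf_neq0.
  move=> k1 k2 k1m k2n; rewrite A12_Psi // [_ - _]addrC !addrA addNr add0r.
  by rewrite memvD // memvZ // mem_flag ?addSn ?addnS // => *; apply: Psi_zero.
have sz : size th = (m + n).+1 by rewrite size_map size_iota.
clearbody th; have an' v : factors A (undup th) v = 0.
  have vX : v \in <<X>>%VS by rewrite (span_basis Xb) memvf.
  have : (<<X>> <= lker (linfun (factors A (undup th))))%VS.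
    apply/span_subvP => x xX; rewrite memv_ker lfunE /=.
    have [c Ax] := XP x xX; have := an x; rewrite !(factors_eigen _ Ax) => /eqP.
    rewrite !scaler_eq0 => /orP[|->]; last by rewrite orbT.
    rewrite prodf_seq_eq0 => /hasP[t tth /=]; rewrite subr_eq0 => /eqP ct.
    apply/orP; left; rewrite prodf_seq_eq0; apply/hasP; exists t; first by rewrite mem_undup.
    by rewrite /= ct subrr.
  by move=> /subvP/(_ _ vX); rewrite memv_ker lfunE /= => /eqP.
have [v vP] := A12_cyclic m n sr u10 u20 a0.
apply/negPn/negP => nu.
have lt : (size (undup th) < size th)%N by rewrite ltn_size_undup.
(* Padding with zeros gives exactly the [m + n] factors in the statement about the cyclic vector. *)
have /vP/negP[] : size (undup th ++ nseq (m + n - size (undup th)) 0) = (m + n)%N.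
  rewrite size_cat size_nseq subnKC //; by move: lt; rewrite sz ltnS.
by rewrite factors_cat an'.
Qed.

Lemma one_ev (x y : F) : ev (tens m n 1 1) x y = 1.
Proof. by rewrite ev_tens ?size_poly1 // !hornerC mulr1. Qed.

(** The subspace given by [P] is nonzero because of [f], and proper because the constant polynomial
    1 does not vanish at [(x, y)]. *)
Lemma not_irr (A B : 'End(V)) (P : V -> Prop) f x y :
  P 0 -> (forall c v w, P v -> P w -> P (c *: v + w)) ->
  (forall v, P v -> P (A v)) -> (forall v, P v -> P (B v)) ->
  P f -> f != 0 -> (forall v, P v -> ev v x y = 0) -> irreducible_pair A B -> False.
Proof.
move=> P0 PD PA PB Pf f0 Pxy I; have [W WP] := vspace_of_pred P0 PD.
have inv (C : 'End(V)) : (forall v, P v -> P (C v)) -> (C @: W <= W)%VS.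
  by move=> PC; apply/subvP => _ /memv_imgP[v /WP Pv ->]; apply/WP/PC.
have [e|e] := I W (inv _ PA) (inv _ PB).
  by move/WP: Pf; rewrite e memv0 (negPf f0).
have /WP/Pxy : tens m n 1 1 \in W by rewrite e memvf.
by move/eqP; rewrite one_ev oner_eq0.
Qed.

Lemma horner_lin (c x : F) : (1 - c *: 'X).[x] = 1 - c * x.
Proof. by rewrite !hornerE. Qed.

(* Otherwise the polynomials vanishing on the lines z2 = z_0, ..., z2 = z_t   *)
(* form an invariant subspace: A12 cannot leave z_0 and B21 cannot leave z_t. *)
Lemma irr_off_string s u1 u2 a b : nonroot s -> u1 != 0 -> u2 != 0 -> a != 0 -> b != 0 ->
  irreducible_pair (A12 m n s u1 u2 a) (A12 m n s^-1 u1^-1 u2^-1 b) -> off_string s n u2 (a / b).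
Proof.
move=> sr u10 u20 a0 b0 I t tn; apply/eqP => e; have s0 : s != 0 by case: sr.
have is0 : s^-1 != 0 by rewrite invr_eq0.
have iu10 : u1^-1 != 0 by rewrite invr_eq0.
have iu20 : u2^-1 != 0 by rewrite invr_eq0.
have q0 : s ^+ 2 != 0 by rewrite expf_neq0.
have h20 : s ^+ n != 0 by rewrite expf_neq0.
pose c := u2 / s ^+ n * a; have c0 : c != 0 by rewrite !mulf_neq0 ?invr_eq0.
pose z i := (c * (s ^+ 2) ^+ (2 * i))^-1.
have zS i : (s ^+ 2) ^+ 2 * z i.+1 = z i.
  rewrite /z mulnS exprD; move: (s ^+ 2) q0 => q q0; field; by rewrite c0 q0 expf_neq0.
have z0 i : z i != 0 by rewrite invr_eq0 mulf_neq0 ?expf_neq0.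
have cz : 1 - c * z 0%N = 0 by rewrite /z muln0 expr0 mulr1 divff ?subrr.
(* Here the failing inequality [e] enters: the last line [z t] is a zero of the shift factor of
   [B21]. *)
have dz : 1 - u2^-1 / s^-1 ^+ n * b * z t = 0.
  rewrite exprVn invrK; have -> : b = u2 ^+ 2 * (s ^+ 2) ^+ (2 * t) * a / (s ^+ n) ^+ 2.
    by rewrite -e; field; rewrite b0 u20 a0 !expf_neq0.
  by rewrite /z /c; field; rewrite h20 u20 a0 !expf_neq0.
pose p : {poly F} := \prod_(i < t.+1) (1 - (c * (s ^+ 2) ^+ (2 * i)) *: 'X).
have sp : (size p <= n.+1)%N.
  by apply: leq_trans (size_lin_prod (fun i => c * (s ^+ 2) ^+ (2 * i)) t.+1) _; rewrite ltnS.
apply: (not_irr (P := fun f => forall i x, (i <= t)%N -> x != 0 -> ev f x (z i) = 0)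
  (f := tens m n 1 p) (x := 1) (y := z 0%N) _ _ _ _ _ _ _ I).
- by move=> i x _ _; rewrite ev0.
- by move=> k f g Hf Hg i x it x0; rewrite evD evZ Hf // Hg // mulr0 addr0.
- move=> f Pf i x it x0; rewrite ev_A12 // !Pf ?mulf_neq0 ?expf_neq0 //.
  case: i it => [|i] it; first by rewrite -/c cz !(mulr0, mul0r, subr0, addr0).
  by rewrite zS Pf ?mulf_neq0 ?expf_neq0 ?(ltnW it) // !(mulr0, mul0r, subr0, addr0).
- move=> f Pf i x it x0; rewrite ev_A12 // !Pf ?mulf_neq0 ?expf_neq0 ?invr_eq0 //.
  have [e1|ne] := eqVneq i t; first by rewrite e1 dz !(mulr0, mul0r, subr0, addr0).
  rewrite !exprVn -zS mulKf ?expf_neq0 // Pf ?mulf_neq0 ?invr_eq0 ?expf_neq0 //.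
    by rewrite !(mulr0, mul0r, subr0, addr0).
  by rewrite ltn_neqAle ne.
- move=> i x it x0; rewrite ev_tens ?size_poly1 // horner_prod (bigD1 (Ordinal (it : (i < t.+1)%N))) //=.
  by rewrite horner_lin /z mulfV ?subrr ?mul0r ?mulr0 // mulf_neq0 ?expf_neq0.
- apply: contraTneq isT => f0; have : ev (tens m n 1 p) 0 0 = 0 by rewrite f0 ev0.
  rewrite ev_tens ?size_poly1 // horner_prod big1 => [|i _]; last by rewrite horner_lin mulr0 subr0.
  by move/eqP; rewrite !hornerE oner_eq0.
by move=> f Pf; rewrite Pf // oner_neq0.
Qed.

(** [A12] is unchanged by inverting [a], and [B21] by inverting [b], so [irr_off_string] can be
    applied to four pairs of parameters. *)
Lemma irr_off_strings s u1 u2 a b : nonroot s -> u1 != 0 -> u2 != 0 -> a != 0 -> b != 0 ->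
  irreducible_pair (A12 m n s u1 u2 a) (A12 m n s^-1 u1^-1 u2^-1 b) -> off_strings s n u2 a b.
Proof.
move=> sr u10 u20 a0 b0 I; have isr := nonroot_inv sr.
split.
- exact: irr_off_string I.
- rewrite invf_div -[b / a](_ : a^-1 / b^-1 = _); last by rewrite invrK mulrC.
  apply: (@irr_off_string _ u1); rewrite ?invr_eq0 //.
  by rewrite !A12_inva ?invr_eq0.
- rewrite -[b in a * b]invrK; apply: (@irr_off_string _ u1); rewrite ?invr_eq0 //.
  by rewrite [A12 _ _ s^-1 _ _ _]A12_inva ?invr_eq0.
rewrite invfM; apply: (@irr_off_string _ u1); rewrite ?invr_eq0 //.
by rewrite [A12 _ _ s _ _ _]A12_inva ?invr_eq0.
Qed.

Lemma lines_bounded (g : nat -> F) k :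
  (\prod_(j < k) ('X - (g j *: 'X)%:P) : {poly {poly F}}) \in bounded_bidegree k k.
Proof.
elim: k => [|k IH].
  rewrite big_ord0; apply: bounded_poly2 => [|i]; first by rewrite size_poly1.
  by rewrite coef1; case: (i == 0%N); rewrite ?size_poly1 ?size_poly0.
rewrite big_ord_recr /=; move: (\prod_(j < k) _) IH => p /bounded_bidegreeP H.
apply/bounded_bidegreeP => i l h; rewrite mulrBr coefB coefMX coefMC coefB -scalerAr coefZ coefMX.
case: i h => [|i] /= h.
  rewrite coef0 sub0r; case: l h => [|l] /= h; first by rewrite mulr0 oppr0.
  by rewrite H ?mulr0 ?oppr0.
case: l h => [|l] /= h; first by rewrite mulr0 subr0 H //; lia.
by rewrite (H i) ?(H i.+1) ?mulr0 ?subrr //; lia.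
Qed.

(* Otherwise the polynomials vanishing on the lines z1 = g_j z2, j <= t, form *)
(* an invariant subspace: the terms of A12 and B21 which evaluate outside of  *)
(* these lines cancel at g_0 and g_t respectively.                            *)
Lemma irr_off_line s u1 u2 a b t : nonroot s -> u1 != 0 -> u2 != 0 -> a != 0 -> b != 0 ->
  irreducible_pair (A12 m n s u1 u2 a) (A12 m n s^-1 u1^-1 u2^-1 b) -> (t < m)%N -> (t < n)%N ->
  u1 ^+ 2 * (s ^+ 2) ^+ (2 * t) != u2 ^+ 2 * ((s ^+ m) ^+ 2 * (s ^+ n) ^+ 2).
Proof.
move=> sr u10 u20 a0 b0 I tm tn; apply/eqP => e; have s0 : s != 0 by case: sr.
have is0 : s^-1 != 0 by rewrite invr_eq0.
have iu10 : u1^-1 != 0 by rewrite invr_eq0.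
have iu20 : u2^-1 != 0 by rewrite invr_eq0.
have q0 : s ^+ 2 != 0 by rewrite expf_neq0.
have h10 : s ^+ m != 0 by rewrite expf_neq0.
have h20 : s ^+ n != 0 by rewrite expf_neq0.
(* Only [f(q^2 z1, z2)] leaves a line through the origin. Its coefficient in [A12] is a multiple of
   [w + w^-1 - w' - w'^-1] with [w = u2 q^(j_2) z2] and [w' = u1 q^(-j_1) z1], hence zero on
   [z1 = g 0 * z2]. The analogous line for [B21] is the one with slope [g t], by [e]. *)
pose g j := u2 * s ^+ m * s ^+ n / u1 / (s ^+ 2) ^+ (2 * j).
have gS j y : (s ^+ 2) ^+ 2 * (g j.+1 * y) = g j * y.
  rewrite /g mulnS exprD; move: (s ^+ 2) q0 => q q0; field; by rewrite u10 q0 expf_neq0.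
have g0 j : g j != 0 by rewrite !mulf_neq0 ?invr_eq0 ?expf_neq0.
have gt : g t = u1 / (u2 * s ^+ m * s ^+ n).
  have Q0 : (s ^+ 2) ^+ (2 * t) != 0 by rewrite expf_neq0.
  have -> : g t = u2 ^+ 2 * ((s ^+ m) ^+ 2 * (s ^+ n) ^+ 2) / (u1 * (u2 * s ^+ m * s ^+ n) * (s ^+ 2) ^+ (2 * t)).
    by rewrite /g; field; rewrite u20 u10 Q0 h10 h20.
  by rewrite -e; field; rewrite u20 u10 Q0 h10 h20.
pose p : {poly {poly F}} := \prod_(j < t.+1) ('X - (g j *: 'X)%:P).
have bp : p \in bounded_bidegree m n.
  have /bounded_bidegreeP H := lines_bounded g t.+1.
  apply/bounded_bidegreeP => i k /orP[h|h]; apply: H.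
    by rewrite (leq_ltn_trans tm h).
  by rewrite (leq_ltn_trans tn h) orbT.
apply: (not_irr (P := fun f => forall j y, (j <= t)%N -> y != 0 -> ev f (g j * y) y = 0)
  (f := Bipoly bp) (x := g 0%N) (y := 1) _ _ _ _ _ _ _ I).
- by move=> j y _ _; rewrite ev0.
- by move=> k f f' Hf Hg j y jt y0; rewrite evD evZ Hf // Hg // mulr0 addr0.
- move=> f Pf j y jt y0; have gy : g j * y != 0 by rewrite mulf_neq0.
  rewrite ev_A12 // Pf //.
  have -> : (s ^+ 2) ^+ 2 * (g j * y) = g j * ((s ^+ 2) ^+ 2 * y) by ring.
  rewrite Pf ?mulf_neq0 ?expf_neq0 //.
  case: j jt {gy} => [|j] jt.
    move: (ev _ _ _) => E; rewrite /g muln0 expr0; move: (s ^+ m) (s ^+ n) h10 h20 => h1 h2 h10 h20.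
    by field; rewrite a0 u10 u20 y0 h10 h20 ?oner_neq0.
  have -> : g j.+1 * ((s ^+ 2) ^+ 2 * y) = g j * y by rewrite -[RHS]gS; ring.
  by rewrite Pf ?(ltnW jt) // !(mulr0, mul0r, subr0, addr0).
- move=> f Pf j y jt y0; have gy : g j * y != 0 by rewrite mulf_neq0.
  rewrite ev_A12 // Pf //.
  have -> : (s^-1 ^+ 2) ^+ 2 * (g j * y) = g j * ((s^-1 ^+ 2) ^+ 2 * y) by ring.
  rewrite Pf ?mulf_neq0 ?expf_neq0 ?invr_eq0 //.
  have [->|ne] := eqVneq j t.
    move: (ev _ _ _) => E; rewrite gt !exprVn; move: (s ^+ m) (s ^+ n) h10 h20 => h1 h2 h10 h20.
    by field; rewrite b0 u10 u20 y0 h10 h20 ?oner_neq0.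
  have -> : g j * ((s^-1 ^+ 2) ^+ 2 * y) = g j.+1 * y.
    by apply: (mulfI (expf_neq0 2 q0)); rewrite gS !exprVn mulrCA mulVKf ?expf_neq0.
  by rewrite Pf ?ltn_neqAle ?ne // !(mulr0, mul0r, subr0, addr0).
- move=> j y jt y0; rewrite /ev /= horner_prod horner_prod (bigD1 (Ordinal (jt : (j < t.+1)%N))) //=.
  by rewrite !hornerE subrr mul0r.
- apply/eqP => /(congr1 val) /= e0; have : p \is monic by apply: monic_prod => j _; apply: monicXsubC.
  by rewrite e0 => /monicP; rewrite lead_coef0 => /eqP; rewrite eq_sym oner_eq0.
by move=> f Pf; rewrite -[g 0%N]mulr1 Pf // oner_neq0.
Qed.
End Necessity.

(** * The symmetry exchanging u_2 and q / u_2 *)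

Section Iso.
Variables (F : fieldType) (m n : nat).
Local Notation V := (bipoly F m n).
Implicit Types (s u a b : F).

Lemma dim_bipoly : \dim {:V} = (m.+1 * n.+1)%N.
Proof. by rewrite dimvf. Qed.

(** Each grid has as many vectors as the dimension, so spanning grids are bases. *)
Lemma grid_iso (Psi Psi' : nat -> nat -> V) :
  (forall k1 k2, (m < k1)%N || (n < k2)%N -> Psi k1 k2 = 0 /\ Psi' k1 k2 = 0) ->
  (forall M : {vspace V},
    (forall k1 k2, (k1 <= m)%N -> (k2 <= n)%N -> Psi k1 k2 \in M) -> M = fullv) ->
  (forall M : {vspace V},
    (forall k1 k2, (k1 <= m)%N -> (k2 <= n)%N -> Psi' k1 k2 \in M) -> M = fullv) ->
  exists2 T : 'End(V), lker T = 0%VS & forall k1 k2, T (Psi k1 k2) = Psi' k1 k2.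
Proof.
move=> Z S S'; pose idx := [seq (i, k) | i <- iota 0 m.+1, k <- iota 0 n.+1].
have sz : size idx = (m.+1 * n.+1)%N by rewrite size_allpairs !size_iota.
have mem_idx k1 k2 : (k1 <= m)%N -> (k2 <= n)%N -> (k1, k2) \in idx.
  by move=> h1 h2; apply/allpairsP; exists (k1, k2); rewrite !mem_iota.
pose X (P : nat -> nat -> V) := [seq P p.1 p.2 | p <- idx].
have sX P : size (X P) == \dim {:V} by rewrite size_map sz dim_bipoly.
have bX P : (forall M : {vspace V},
    (forall k1 k2, (k1 <= m)%N -> (k2 <= n)%N -> P k1 k2 \in M) -> M = fullv) ->
    basis_of fullv (Tuple (sX P)).
  move=> SP; rewrite basisEdim (eqP (sX P)) leqnn andbT.
  rewrite (SP <<X P>>%VS) ?subvv // => k1 k2 h1 h2.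
  by apply/memv_span/mapP; exists (k1, k2); rewrite ?mem_idx.
have [T T0 TE] := lfun_of_basis (bX _ S) (bX _ S').
exists T => // k1 k2.
have [/Z[-> ->]|] := boolP ((m < k1)%N || (n < k2)%N); first exact: linear0.
rewrite negb_or -!leqNgt => /andP[h1 h2].
have ip : (index (k1, k2) idx < \dim {:V})%N by rewrite dim_bipoly -sz index_mem mem_idx.
have ip' : (index (k1, k2) idx < size idx)%N by rewrite index_mem mem_idx.
have := TE (Ordinal ip); rewrite /= /X !(nth_map (0%N, 0%N)) //.
by rewrite nth_index ?mem_idx.
Qed.

Lemma rho_lam s u2 a b k : s != 0 -> u2 != 0 -> a != 0 -> b != 0 ->
  rho2 m n s u2 a (s ^+ n / u2 * b) k * lambda2_closed m n s u2 a b k.+1 =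
  rho2 m n s (s ^+ 2 / u2) a (s ^+ n / (s ^+ 2 / u2) * b) k * lambda2_closed m n s (s ^+ 2 / u2) a b k.+1.
Proof.
move=> s0 u20 a0 b0; rewrite /rho2 /lambda2_closed /phi mulnS exprD.
have h10 : s ^+ m != 0 by rewrite expf_neq0.
have h20 : s ^+ n != 0 by rewrite expf_neq0.
have q0 : s ^+ 2 != 0 by rewrite expf_neq0.
have Q0 : (s ^+ 2) ^+ (2 * k) != 0 by rewrite expf_neq0.
move: (s ^+ 2) (s ^+ m) (s ^+ n) ((s ^+ 2) ^+ (2 * k)) h10 h20 q0 Q0 => q h1 h2 Q h10 h20 q0 Q0.
by field; rewrite h10 h20 q0 Q0 u20 a0 b0 ?oner_neq0.
Qed.

(* In the bases Psi2 only rho2 and lambda2 change under u2 -> q / u2, and     *)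
(* their product does not, so a rescaling intertwines the two actions.        *)
Lemma iso_irr s u1 u2 a b : nonroot s -> u1 != 0 -> u2 != 0 -> a != 0 -> b != 0 ->
  off_strings s m u1 a b -> off_strings s n u2 a b ->
  irreducible_pair (A12 m n s u1 (s ^+ 2 / u2) a) (A12 m n s^-1 u1^-1 (s ^+ 2 / u2)^-1 b) ->
  irreducible_pair (A12 m n s u1 u2 a) (A12 m n s^-1 u1^-1 u2^-1 b).
Proof.
move=> sr u10 u20 a0 b0 S1 S2; have s0 : s != 0 by case: sr.
have q0 : s ^+ 2 != 0 by rewrite expf_neq0.
have v20 : s ^+ 2 / u2 != 0 by rewrite mulf_neq0 ?invr_eq0.
have S2' := off_strings_dual s0 u20 a0 b0 S2.
pose r u k := rho2 m n s u a (s ^+ n / u * b) k.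
have ab0 : a * b != 0 by rewrite mulf_neq0.
have r0 u k : u != 0 -> off_strings s n u a b -> (k < n)%N -> r u k != 0.
  move=> u0 [_ _ _ H] kn; rewrite /r /rho2 mulf_neq0 ?invr_eq0 ?expf_neq0 // phi_neq0 //.
  have := off_string_mul sr ab0 H (ltn0Sn k) kn.
  by rewrite mulnS exprD !mulrA.
set v2 := s ^+ 2 / u2 in v20 S2' *.
(* The scaling is determined by the raising coefficients in the second index ([sgS]); that the
   lowering ones then agree is [rho_lam]. *)
pose sg k := \prod_(t < k) (r v2 t / r u2 t).
have sg0 k : (k <= n)%N -> sg k != 0.
  move=> kn; apply/prodf_neq0 => t _; have tn := leq_trans (ltn_ord t) kn.
  by rewrite mulf_neq0 ?invr_eq0 ?r0.
have sgS k : (k < n)%N -> r u2 k * sg k.+1 = sg k * r v2 k.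
  move=> kn; rewrite /sg big_ord_recr /=; move: (\prod_(t < k) _) => P.
  by have := r0 _ _ u20 S2 kn; move: (r u2 k) => x x0; field.
pose Ps := Psi2 m n s u1 u2 a b; pose Ps' := Psi2 m n s u1 v2 a b.
case: (S1) (S2) (S2') => H1 _ _ _ [H2 _ _ _] [H2' _ _ _].
have SP := Psi2_span s0 u10 u20 a0 b0 H1 H2.
have SP' := Psi2_span s0 u10 v20 a0 b0 H1 H2'.
have Z u k1 k2 : (m < k1)%N || (n < k2)%N -> Psi2 m n s u1 u a b k1 k2 = 0 by exact: Psi_zero.
have [||T T0 TE] := @grid_iso Ps (fun k1 k2 => sg k2 *: Ps' k1 k2) _ SP.
- by move=> k1 k2 h; rewrite /Ps /Ps' !Z ?scaler0.
- move=> M HM; apply: SP' => k1 k2 h1 h2; have := memvZ (sg k2)^-1 (HM k1 k2 h1 h2).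
  by rewrite scalerA mulVf ?sg0 // scale1r.
have ext (C C' : 'End(V)) : (forall k1 k2, (k1 <= m)%N -> (k2 <= n)%N ->
    T (C (Ps k1 k2)) = C' (sg k2 *: Ps' k1 k2)) -> forall v, T (C v) = C' (T v).
  move=> CC' v; have : ((T \o C) - (C' \o T))%VF v = 0.
    apply/eqP; rewrite -memv_ker.
    have -> : lker ((T \o C) - (C' \o T))%VF = fullv; last exact: memvf.
    apply: SP => k1 k2 h1 h2.
    by rewrite memv_ker add_lfunE opp_lfunE !comp_lfunE TE CC' // subrr.
  by rewrite add_lfunE opp_lfunE !comp_lfunE => /eqP; rewrite subr_eq0 => /eqP.
apply: (transport_irr T0 (ext _ _ _) (ext _ _ _)) => k1 k2 h1 h2; rewrite linearZ /=.
  rewrite /Ps /Ps' /Psi2 !A12_Psi // -!/(Ps _ _) -!/(Ps' _ _) linearD linearD !linearZ /= !TE.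
  rewrite 2!scalerDr !scalerA ![_ * sg k2]mulrC; congr (_ + _).
  have [kn|nk] := ltnP k2 n; first by rewrite (sgS _ kn).
  rewrite -[Psi m n s u1 v2 a _ _ k1 k2.+1]/(Ps' k1 k2.+1).
  by have -> : Ps' k1 k2.+1 = 0; [apply: Z; rewrite ltnS nk orbT|rewrite !scaler0].
rewrite /Ps /Ps' !B21_Psi2 // -!/(Ps _ _) linearD linearD linearZ /= TE.
rewrite 2![in RHS]scalerDr !scalerA [_ * sg k2]mulrC; congr (_ + _ + _).
  case: k1 h1 => [|k1] h1; first by rewrite linear0 scaler0.
  by rewrite linearZ /= -/(Ps _ _) TE !scalerA mulrC.
case: k2 h2 => [|k2] h2; first by rewrite linear0 scaler0.
rewrite linearZ /= -/(Ps _ _) TE !scalerA; congr (_ *: _).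
rewrite !lambda2E //.
apply: (mulfI (r0 _ _ u20 S2 h2)).
have E1 : r u2 k2 * lambda2_closed m n s u2 a b k2.+1 = r v2 k2 * lambda2_closed m n s v2 a b k2.+1 by apply: rho_lam.
by rewrite mulrA E1 [RHS]mulrA (sgS _ h2); ring.
Qed.

End Iso.

Section Necessary.
Variables (F : fieldType) (m n : nat) (s u1 u2 a b : F).
Hypotheses (sr : nonroot s) (u10 : u1 != 0) (u20 : u2 != 0) (a0 : a != 0) (b0 : b != 0).

Lemma irr_dual :
  irreducible_pair (A12 m n s u1 u2 a) (A12 m n s^-1 u1^-1 u2^-1 b) ->
  irreducible_pair (A12 m n s (s ^+ 2 / u1) (s ^+ 2 / u2) a)
      (A12 m n s^-1 (s ^+ 2 / u1)^-1 (s ^+ 2 / u2)^-1 b).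
Proof.
apply: (orth_irr (form_linl s) (form_linr s)).
- by move=> w H; apply: (form_nondeg sr) => g; rewrite formC.
- by move=> v w; apply: form_A12.
- by move=> v w; apply: form_B21.
Qed.
End Necessary.

(** [irr_off_line] excludes one resonance. Applied to [(u1, u2)], to its adjoint [(q / u1, q / u2)],
    and to the two mixed pairs obtained from these by [iso_irr], it excludes all four. *)
Lemma irr_off_res (F : fieldType) (m n : nat) (s u1 u2 a b : F) :
  nonroot s -> u1 != 0 -> u2 != 0 -> a != 0 -> b != 0 ->
  off_strings s m u1 a b -> off_strings s n u2 a b ->
  irreducible_pair (A12 m n s u1 u2 a) (A12 m n s^-1 u1^-1 u2^-1 b) -> off_res m n s u1 u2.
Proof.
move=> sr u10 u20 a0 b0 S1 S2 I j jm jn; have s0 : s != 0 by case: sr.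
have q0 : s ^+ 2 != 0 by rewrite expf_neq0.
have v10 : s ^+ 2 / u1 != 0 by rewrite mulf_neq0 ?invr_eq0.
have v20 : s ^+ 2 / u2 != 0 by rewrite mulf_neq0 ?invr_eq0.
have S1' := off_strings_dual s0 u10 a0 b0 S1.
have S2' := off_strings_dual s0 u20 a0 b0 S2.
have vv u : u != 0 -> s ^+ 2 / (s ^+ 2 / u) = u.
  by move=> u0; rewrite invf_div mulrCA mulfV ?mulr1.
have Id := irr_dual sr u10 u20 a0 b0 I.
have I1 : irreducible_pair (A12 m n s u1 (s ^+ 2 / u2) a) (A12 m n s^-1 u1^-1 (s ^+ 2 / u2)^-1 b).
  by apply: iso_irr; rewrite ?vv.
have I2 : irreducible_pair (A12 m n s (s ^+ 2 / u1) u2 a) (A12 m n s^-1 (s ^+ 2 / u1)^-1 u2^-1 b).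
  by apply: iso_irr; rewrite ?vv.
have L0 := irr_off_line sr u10 u20 a0 b0 I jm jn.
have Ld := irr_off_line sr v10 v20 a0 b0 Id jm jn.
have L1 := irr_off_line sr u10 v20 a0 b0 I1 jm jn.
have L2 := irr_off_line sr v10 u20 a0 b0 I2 jm jn.
move: {I Id I1 I2 S1 S2 S1' S2' vv v10 v20} L0 Ld L1 L2; rewrite /=.
move: (s ^+ 2) ((s ^+ 2) ^+ (2 * j)) ((s ^+ m) ^+ 2 * (s ^+ n) ^+ 2) q0 => q T P q0 L0 Ld L1 L2.
split=> //.
- move: Ld; apply: contraNneq => e; apply/eqP.
  transitivity (u2 ^+ 2 * T * (q / (u1 * u2)) ^+ 2); first by field; rewrite u10 u20.
  by rewrite e; field; rewrite u10 u20.
- move: L2; apply: contraNneq => e; apply/eqP.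
  transitivity (q ^+ 2 * T / u1 ^+ 2); first by field.
  by rewrite -e; field.
move: L1; apply: contraNneq => e; apply/eqP.
transitivity (u1 ^+ 2 * u2 ^+ 2 * T / u2 ^+ 2); first by field.
by rewrite -e; field.
Qed.

(** * Exchange of the variables and the equivalence with the conditions *)

Section Swap.
Variable F : fieldType.

Definition swap m n (f : bipoly F m n) : bipoly F n m :=
  mx_bipoly (bipoly_mx f)^T.

Lemma coef_swap m n (f : bipoly F m n) i k : (i <= n)%N -> (k <= m)%N ->
  (bival (swap f))`_i`_k = (bival f)`_k`_i.
Proof.
move=> im kn; have := congr1 (fun M : 'M_(_, _) => M (inord i) (inord k)) (mx_bipolyK (bipoly_mx f)^T).
by rewrite !mxE !inordK.
Qed.

Lemma swap_linear m n : linear (@swap m n).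
Proof.
move=> c f g; apply: bipolyP => i k im kn.
rewrite bivalD bivalZ !(coefD, coefZ, coefCM) !coef_swap //.
by rewrite bivalD bivalZ !(coefD, coefZ, coefCM).
Qed.
HB.instance Definition _ m n := GRing.isLinear.Build F (bipoly F m n) (bipoly F n m) _
  (@swap m n) (@swap_linear m n).

Lemma swapK m n (f : bipoly F m n) : swap (swap f) = f.
Proof. by apply: bipolyP => i k im kn; rewrite !coef_swap. Qed.

Lemma ev_swap m n (f : bipoly F m n) x y : ev (swap f) x y = ev f y x.
Proof.
rewrite !ev_coef exchange_big; apply: eq_bigr => i _; apply: eq_bigr => k _.
by rewrite coef_swap ?leq_ord // mulrAC.
Qed.

Definition swapl m n : 'Hom(bipoly F m n, bipoly F n m) := linfun (@swap m n).

Lemma swaplE m n f : swapl m n f = swap f.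
Proof. by rewrite lfunE. Qed.

Lemma swapl_inj m n : lker (swapl m n) = 0%VS.
Proof.
apply/eqP; rewrite -subv0; apply/subvP => f; rewrite memv_ker lfunE memv0 /=.
by move=> /eqP f0; rewrite -(swapK f) f0 linear0.
Qed.

Lemma swapl_surj m n : limg (swapl m n) = fullv.
Proof.
apply/eqP; rewrite eqEsubv subvf /=; apply/subvP => f _.
by apply/memv_imgP; exists (swap f); rewrite ?memvf // lfunE /= swapK.
Qed.

Lemma swap_A m n s u1 u2 a (f : bipoly F m n) : nonroot s -> u1 != 0 -> u2 != 0 -> a != 0 ->
  swapl m n (A21 m n s u1 u2 a f) = A12 n m s u2 u1 a (swapl m n f).
Proof.
move=> sr u10 u20 a0; have s0 : s != 0 by case: sr.
rewrite !swaplE; apply: (ev_inj (nonroot_inj sr)) => i j.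
have q0 k : (s ^+ 2) ^+ k != 0 by rewrite !expf_neq0.
by rewrite ev_swap ev_A21 // ev_A12 // !ev_swap.
Qed.

Lemma swap_A' m n s u1 u2 a (f : bipoly F n m) : nonroot s -> u1 != 0 -> u2 != 0 -> a != 0 ->
  swapl n m (A12 n m s u2 u1 a f) = A21 m n s u1 u2 a (swapl n m f).
Proof.
move=> sr u10 u20 a0.
by rewrite -{1}[f]swapK -!swaplE -swap_A // !swaplE swapK.
Qed.
End Swap.

Definition conditions (F : fieldType) m n (s u1 u2 a b : F) :=
  [/\ off_strings s m u1 a b, off_strings s n u2 a b, off_res m n s u1 u2,
      uniq (map (theta m n s a) (iota 0 (m + n).+1))
    & uniq (map (theta m n s^-1 b) (iota 0 (m + n).+1))].

Lemma thetaC (F : fieldType) m n (s : F) : theta m n s =2 theta n m s.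
Proof. by move=> a p; rewrite /theta [s ^+ m * _]mulrC. Qed.

Lemma conditionsC (F : fieldType) m n (s u1 u2 a b : F) :
  conditions m n s u1 u2 a b -> conditions n m s u2 u1 a b.
Proof.
case=> S1 S2 R Ua Ub; split=> //; last 2 first.
- by rewrite addnC (eq_map (thetaC n m s a)).
- by rewrite addnC (eq_map (thetaC n m s^-1 b)).
move=> j jn jm; have [H1 H2 H3 H4] := R j jm jn.
by rewrite [_ * (s ^+ m) ^+ 2]mulrC [u2 ^+ 2 * u1 ^+ 2]mulrC; split.
Qed.

Section Core.
Variables (F : fieldType).
Implicit Types (s u a b : F).

Lemma conditions_half m n s u1 u2 a b : nonroot s -> u1 != 0 -> u2 != 0 -> a != 0 -> b != 0 ->
  conditions m n s u1 u2 a b ->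
  half_tridiagonal (A12 m n s u1 u2 a) (A12 m n s^-1 u1^-1 u2^-1 b)
       (map (theta m n s a) (iota 0 (m + n).+1)) /\
  half_tridiagonal (A12 m n s^-1 u1^-1 u2^-1 b) (A12 m n s u1 u2 a)
       (map (theta m n s^-1 b) (iota 0 (m + n).+1)).
Proof.
move=> sr u10 u20 a0 b0 [S1 S2 _ Ua Ub]; have s0 : s != 0 by case: sr.
have ab0 : a * b != 0 by rewrite mulf_neq0.
have ab0' : a / b != 0 by rewrite mulf_neq0 ?invr_eq0.
case: S1 S2 => [H1 H2 H3 H4] [G1 G2 G3 G4].
have inv d u x : u != 0 -> x != 0 -> off_string s d u x -> off_string s^-1 d u^-1 x^-1.
  exact: off_string_inv.
split; first by apply: half_A12 => //; rewrite -invfM.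
rewrite -{2}[s]invrK -{2}[u1]invrK -{2}[u2]invrK.
apply: half_A12; rewrite ?invr_eq0 //; first exact: nonroot_inv.
- by rewrite -invf_div; apply: inv.
- by rewrite -invf_div; apply: inv.
- by rewrite mulrC -invfM; apply: inv.
- by rewrite mulrC -invfM; apply: inv.
Qed.

Lemma qRacah_theta m n s a : s != 0 -> a != 0 ->
  qRacah_form (s ^+ 2) (map (theta m n s a) (iota 0 (m + n).+1)).
Proof.
move=> s0 a0; exists (a / (s ^+ m * s ^+ n) ^+ 2), ((s ^+ m * s ^+ n) ^+ 2 / a).
split; rewrite ?mulf_neq0 ?invr_eq0 ?expf_neq0 ?mulf_neq0 ?expf_neq0 //.
move=> p; rewrite size_map size_iota => pN.
rewrite (nth_map 0%N) ?size_iota // nth_iota // add0n /theta.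
by congr (_ + _); [rewrite mulrAC|rewrite invfM mulrA].
Qed.

Lemma qRacah_theta_inv m n s b : s != 0 -> b != 0 ->
  qRacah_form (s ^+ 2) (map (theta m n s^-1 b) (iota 0 (m + n).+1)).
Proof.
move=> s0 b0; exists ((b * (s ^+ m * s ^+ n) ^+ 2)^-1), (b * (s ^+ m * s ^+ n) ^+ 2).
split; rewrite ?invr_eq0 ?mulf_neq0 ?expf_neq0 ?mulf_neq0 ?expf_neq0 //.
move=> p; rewrite size_map size_iota => pN.
rewrite (nth_map 0%N) ?size_iota // nth_iota // add0n /theta addrC.
have h0 : s ^+ m * s ^+ n != 0 by rewrite mulf_neq0 ?expf_neq0.
have Q0 : (s ^+ 2) ^+ (2 * p) != 0 by rewrite !expf_neq0.
rewrite !exprVn -invfM; move: (s ^+ m * s ^+ n) ((s ^+ 2) ^+ (2 * p)) h0 Q0 => h Q h0 Q0.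
by congr (_ + _); field; rewrite ?b0 ?h0 ?Q0 ?oner_neq0.
Qed.

Lemma tridiagonal_pairs_iff m n s u1 u2 a b : nonroot s -> u1 != 0 -> u2 != 0 -> a != 0 -> b != 0 ->
  (qRacah_tridiagonal_pair (s ^+ 2) (A12 m n s u1 u2 a) (B21 m n s u1 u2 b) /\
   qRacah_tridiagonal_pair (s ^+ 2) (A21 m n s u1 u2 a) (B12 m n s u1 u2 b)) <->
  conditions m n s u1 u2 a b.
Proof.
move=> sr u10 u20 a0 b0; have s0 : s != 0 by case: sr.
have isr := nonroot_inv sr.
have i10 : u1^-1 != 0 by rewrite invr_eq0.
have i20 : u2^-1 != 0 by rewrite invr_eq0.
rewrite B21_A12 B12_A21; split=> [[[T1 _ _] [T2 _ _]]|C].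
  have I := td_irreducible T1.
  have I' : irreducible_pair (A12 n m s u2 u1 a) (A12 n m s^-1 u2^-1 u1^-1 b).
    apply: (transport_irr (swapl_inj F n m)) (td_irreducible T2) => v; exact: swap_A'.
  have S1 := irr_off_strings sr u20 u10 a0 b0 I'.
  have S2 := irr_off_strings sr u10 u20 a0 b0 I.
  split=> //; first exact: irr_off_res I.
    exact: diag_uniq (td_diag T1).
  exact: diag_uniq (td_diag_dual T1).
have qa := qRacah_theta m n s0 a0; have qb := qRacah_theta_inv m n s0 b0.
have [hA hB] := conditions_half sr u10 u20 a0 b0 C.
have C' := conditionsC C; have [hA' hB'] := conditions_half sr u20 u10 a0 b0 C'.
split.
  apply: (td_of_halves hA hB) => //.
  by case: C => S1 S2 R _ Ub; apply: irreducible12.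
have TA f := @swap_A F m n s u1 u2 a f sr u10 u20 a0.
have TB f := @swap_A F m n s^-1 u1^-1 u2^-1 b f isr i10 i20 b0.
apply: (td_of_halves (transport_half (swapl_inj F m n) (swapl_surj F m n) TA TB hA')
  (transport_half (swapl_inj F m n) (swapl_surj F m n) TB TA hB')).
- apply: (transport_irr (swapl_inj F m n) TA TB).
  by case: C' => S1 S2 R _ Ub; apply: irreducible12.
- exact: qRacah_theta.
- exact: qRacah_theta_inv.
Qed.
End Core.

(** * General position of q-strings *)

Section Strings.
Variables (F : fieldType) (q : F).
Hypotheses (q0 : q != 0) (qinj : injective (GRing.exp q)).
Implicit Types (v x y z : F) (d : nat).

Lemma mem_qstring d v x :
  x \in qstring q d v <-> exists2 i, (i < d)%N & x = v * q / q ^+ d * q ^+ (2 * i).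
Proof.
have E i : q ^ (2%:Z * i%:Z - d%:Z + 1) = q / q ^+ d * q ^+ (2 * i).
  rewrite !expfzDr // -PoszM expr1z -exprnN !exprnP; ring.
rewrite /qstring; split=> [/mapP[j]|[i id_ ->]].
  by rewrite mem_iota => /andP[_ jd] ->; exists j; rewrite // E; ring.
by apply/mapP; exists i; rewrite ?mem_iota // E; ring.
Qed.

Lemma general_positionC d v d' v' :
  general_position q d v d' v' -> general_position q d' v' d v.
Proof.
case=> [nS|H|H]; [apply: Or31|exact: Or33|exact: Or32].
by case=> D [V [V0 H]]; apply: nS; exists D, V; split=> // x; rewrite -H !mem_cat orbC.
Qed.

(** Counted in steps of [q^2] from the start of the first string, the second one begins at place
    [d - t]: they overlap in [t] elements, or are adjacent if [t = 0]. As [t < d] and [t < d'],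
    neither contains the other, and the union is a string of length [d + d' - t]. *)
Lemma resonance_position d v d' v' t : v != 0 -> v' != 0 -> (t < d)%N -> (t < d')%N ->
  v' * q ^+ (2 * t) = v * q ^+ (d + d') -> ~ general_position q d v d' v'.
Proof.
move=> v0 v'0 td td' e.
have Q0 k : q ^+ k != 0 by rewrite expf_neq0.
pose z := v * q / q ^+ d; have z0 : z != 0 by rewrite !mulf_neq0 ?invr_eq0.
have zz i j : z * q ^+ (2 * i) = z * q ^+ (2 * j) -> i = j.
  by move=> /(mulfI z0) /qinj h; lia.
have E' : v' * q / q ^+ d' = z * q ^+ (2 * (d - t)).
  apply: (mulIf (Q0 d')); rewrite mulfVK //; apply: (mulIf (Q0 (2 * t)%N)).
  rewrite mulrAC e /z; apply: (mulIf (Q0 d)).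
  have -> : v * q ^+ (d + d') * q * q ^+ d = v * q * q ^+ (d + d + d').
    rewrite !exprD; ring.
  have -> : v * q / q ^+ d * q ^+ (2 * (d - t)) * q ^+ d' * q ^+ (2 * t) * q ^+ d =
      v * q / q ^+ d * q ^+ d * (q ^+ (2 * (d - t)) * q ^+ d' * q ^+ (2 * t)) by ring.
  by rewrite mulfVK // -!exprD; congr (_ * _ ^+ _); lia.
have mS x : x \in qstring q d v <-> exists2 i, (i < d)%N & x = z * q ^+ (2 * i).
  exact: mem_qstring.
have mS' x : x \in qstring q d' v' <-> exists2 i, (i < d')%N & x = z * q ^+ (2 * (d - t + i)).
  split=> [/mem_qstring|] [i id_]; last by move=> xE; apply/mem_qstring; exists i => //; rewrite E' xE mulnDr exprD mulrA.
  by move=> ->; exists i => //; rewrite E' mulnDr exprD mulrA.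
case=> [nS|H|H].
- apply: nS; pose D := (d + d' - t)%N; exists D, (z * q ^+ D / q); split.
    by rewrite !mulf_neq0 ?invr_eq0.
  have B : z * q ^+ D / q * q / q ^+ D = z by rewrite mulfVK // mulfK.
  move=> x; rewrite mem_cat; apply/orP/idP => [[/mS[i id_ ->]|/mS'[i id_ ->]]|].
  + by apply/mem_qstring; exists i; rewrite ?B // /D; lia.
  + by apply/mem_qstring; exists (d - t + i)%N; rewrite ?B // /D; lia.
  move=> /mem_qstring[i iD]; rewrite B => ->.
  have [id_|di] := ltnP i d; first by left; apply/mS; exists i.
  right; apply/mS'; exists (i - (d - t))%N; first by move: iD; rewrite /D; lia.
  by congr (_ * _ ^+ _); lia.
- have /H/mS'[i _ /zz h] : z * q ^+ (2 * 0) \in qstring q d v by apply/mS; exists 0%N => //; lia.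
  lia.
have /H/mS[i id_ /zz h] : z * q ^+ (2 * (d - t + d'.-1)) \in qstring q d' v'.
  by apply/mS'; exists d'.-1 => //; lia.
lia.
Qed.

(** If the union is a q-string, both strings are intervals of places in it and leave no gap. Unless
    they are nested, the end of one exceeds the start of the other by some [t] smaller than both
    lengths, which is a resonance. *)
Lemma position_resonance d v d' v' : v != 0 -> v' != 0 ->
  (forall t, (t < d)%N -> (t < d')%N ->
     v' * q ^+ (2 * t) != v * q ^+ (d + d') /\ v * q ^+ (2 * t) != v' * q ^+ (d + d')) ->
  general_position q d v d' v'.
Proof.
move=> v0 v'0 H; have Q0 k : q ^+ k != 0 by rewrite expf_neq0.
have [->|d0] := posnP d; first by apply: Or32.
have [->|d'0] := posnP d'; first by apply: Or33.
have [[D [V [V0 HD]]]|] := pselect (is_qstring q (qstring q d v ++ qstring q d' v')); last exact: Or31.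
pose z := V * q / q ^+ D; have z0 : z != 0 by rewrite !mulf_neq0 ?invr_eq0.
have zz i j : z * q ^+ (2 * i) = z * q ^+ (2 * j) -> i = j.
  by move=> /(mulfI z0) /qinj h; lia.
have base e w : (0 < e)%N -> {subset qstring q e w <= qstring q D V} ->
    exists i, [/\ (i < D)%N, w * q / q ^+ e = z * q ^+ (2 * i) &
      forall x, x \in qstring q e w <-> exists2 k, (k < e)%N & x = z * q ^+ (2 * (i + k))].
  move=> e0 sub; have /sub/mem_qstring[i iD] : w * q / q ^+ e * q ^+ (2 * 0) \in qstring q e w.
    by apply/mem_qstring; exists 0%N.
  rewrite muln0 expr0 mulr1 => E; exists i; split=> // x; split=> [/mem_qstring|] [k ke].
    by move=> ->; exists k; rewrite // E mulnDr exprD mulrA.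
  by move=> ->; apply/mem_qstring; exists k; rewrite // E mulnDr exprD mulrA.
have [i1 [i1D e1 m1]] : exists i, [/\ (i < D)%N, v * q / q ^+ d = z * q ^+ (2 * i) &
      forall x, x \in qstring q d v <-> exists2 k, (k < d)%N & x = z * q ^+ (2 * (i + k))].
  by apply: base => // x; rewrite -HD mem_cat => ->.
have [i2 [i2D e2 m2]] : exists i, [/\ (i < D)%N, v' * q / q ^+ d' = z * q ^+ (2 * i) &
      forall x, x \in qstring q d' v' <-> exists2 k, (k < d')%N & x = z * q ^+ (2 * (i + k))].
  by apply: base => // x; rewrite -HD mem_cat => ->; rewrite orbT.
have all i : (i < D)%N -> (i1 <= i < i1 + d)%N \/ (i2 <= i < i2 + d')%N.
  move=> iD; have : z * q ^+ (2 * i) \in qstring q D V by apply/mem_qstring; exists i.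
  rewrite -HD mem_cat => /orP[/m1|/m2] [k kd /zz ->]; [left|right]; lia.
have inc a1 b1 e f w w' : (forall x, x \in qstring q e w <-> exists2 k, (k < e)%N & x = z * q ^+ (2 * (a1 + k))) ->
    (forall x, x \in qstring q f w' <-> exists2 k, (k < f)%N & x = z * q ^+ (2 * (b1 + k))) ->
    (b1 <= a1)%N -> (a1 + e <= b1 + f)%N -> {subset qstring q e w <= qstring q f w'}.
  move=> ma mb ba ef x /ma[k ke ->]; apply/mb; exists (a1 - b1 + k)%N; first by lia.
  by congr (_ * _ ^+ (2 * _)); lia.
have res e f w w' i j t : w * q / q ^+ e = z * q ^+ (2 * i) -> w' * q / q ^+ f = z * q ^+ (2 * j) ->
    (j + t = i + e)%N -> w' * q ^+ (2 * t) = w * q ^+ (e + f).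
  move=> we wf jt; apply: (mulIf q0).
  have -> : w' * q ^+ (2 * t) * q = w' * q / q ^+ f * (q ^+ f * q ^+ (2 * t)).
    by field; rewrite expf_neq0.
  have -> : w * q ^+ (e + f) * q = w * q / q ^+ e * (q ^+ e * q ^+ (e + f)).
    by field; rewrite expf_neq0.
  by rewrite we wf -[LHS]mulrA -[RHS]mulrA -!exprD; congr (z * _ ^+ _); lia.
have [le|lt] := leqP i1 i2.
  have [h|h] := leqP (i2 + d') (i1 + d); first by apply/Or33/(inc i2 i1).
  have [ei|ni] := eqVneq i1 i2; first by apply/Or32/(inc i1 i2) => //; lia.
  have gap : (i2 <= i1 + d)%N.
    by rewrite leqNgt; apply/negP => g; have := all (i1 + d)%N; lia.
  have [||/eqP[]] := H (i1 + d - i2)%N; [lia|lia|].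
  by apply: (res d d' v v' i1 i2) => //; lia.
have [h|h] := leqP (i1 + d) (i2 + d'); first by apply/Or32/(inc i1 i2) => //; lia.
have gap : (i1 <= i2 + d')%N.
  by rewrite leqNgt; apply/negP => g; have := all (i2 + d')%N; lia.
have [||_ /eqP[]] := H (i2 + d' - i1)%N; [lia|lia|].
by rewrite [(d + d')%N]addnC; apply: (res d' d v' v i2 i1) => //; lia.
Qed.
End Strings.

(** * Translation into the conditions of the theorem *)

Section Translation.
Variables (F : fieldType) (s : F).
Hypothesis sr : nonroot s.
Let s0 : s != 0. Proof. by case: sr. Qed.
Let q0 : s ^+ 2 != 0. Proof. by rewrite expf_neq0. Qed.
Let Q0 k : (s ^+ 2) ^+ k != 0. Proof. by rewrite expf_neq0. Qed.

Let expr2AC d : (s ^+ d) ^+ 2 = (s ^+ 2) ^+ d. Proof. exact: exprAC. Qed.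

Lemma off_stringP d u x : u != 0 ->
  (x \notin qstring (s ^+ 2) d (s ^+ 2 / u ^+ 2)) <-> off_string s d u x.
Proof.
move=> u0.
have E i : (i < d)%N -> s ^+ 2 / u ^+ 2 * s ^+ 2 / (s ^+ 2) ^+ d * (s ^+ 2) ^+ (2 * i) =
    (s ^+ 2) ^+ d / (u ^+ 2 * (s ^+ 2) ^+ (2 * (d - i.+1))).
  move=> id_; have -> : (s ^+ 2) ^+ (2 * i) = (s ^+ 2) ^+ (2 * d) / ((s ^+ 2) ^+ 2 * (s ^+ 2) ^+ (2 * (d - i.+1))).
    apply: (canRL (mulfK _)); first by rewrite mulf_neq0.
    by rewrite -!exprD; congr (_ ^+ _); lia.
  rewrite mul2n -addnn exprD; move: (s ^+ 2) q0 (_ ^+ d) (Q0 d) (_ ^+ _) (Q0 (2 * (d - i.+1))).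
  by move=> q q0' X X0 Y Y0; field; rewrite q0' X0 Y0 u0.
split=> [H t td|H].
  apply: contraNneq H => e; apply/(mem_qstring q0); exists (d - t.+1)%N; first by lia.
  rewrite E; last by lia.
  have -> : (d - (d - t.+1).+1 = t)%N by lia.
  by rewrite -expr2AC -e; field; rewrite u0 Q0.
apply/negP => /(mem_qstring q0)[i id_]; rewrite E // => xE.
have /H/eqP[] : (d - i.+1 < d)%N by lia.
by rewrite expr2AC xE; field; rewrite u0 Q0.
Qed.

Lemma off_string_invP d u x : u != 0 -> x != 0 ->
  (x \notin qstring (s ^+ 2) d (s ^+ 2 / u ^+ 2)^-1) <-> off_string s d u x^-1.
Proof.
move=> u0 x0.
have E i : (s ^+ 2 / u ^+ 2)^-1 * s ^+ 2 / (s ^+ 2) ^+ d * (s ^+ 2) ^+ (2 * i) =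
    u ^+ 2 * (s ^+ 2) ^+ (2 * i) / (s ^+ 2) ^+ d.
  move: ((s ^+ 2) ^+ (2 * i)) ((s ^+ 2) ^+ d) (Q0 d) => Y X X0.
  move: (s ^+ 2) q0 => q q0'; field; by rewrite q0' X0 u0.
split=> [H t td|H].
  apply: contraNneq H => e; apply/(mem_qstring q0); exists t => //.
  by rewrite E -(expr2AC d) -e; field; rewrite u0 x0 Q0.
apply/negP => /(mem_qstring q0)[i id_]; rewrite E => xE.
have /eqP[] := H _ id_.
apply: (mulfI x0); rewrite expr2AC {2}xE mulrA; field.
by rewrite ?x0 ?Q0.
Qed.

(** With [x = q^(2i)], [y = q^(2j)] and [h^2 = q^(m + n)], the difference is
    [(x - y) (a^2 x y - h^4) / (a h^2 x y)]. *)
Lemma theta_neq m n a i j : a != 0 -> i != j ->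
  (theta m n s a i == theta m n s a j) =
  ((a * (s ^+ 2) ^+ (i + j)) ^+ 2 == ((s ^+ 2) ^+ (m + n)) ^+ 2).
Proof.
move=> a0 ij; rewrite -subr_eq0 -[RHS]subr_eq0 /theta.
have -> : (s ^+ 2) ^+ (m + n) = (s ^+ m * s ^+ n) ^+ 2 by rewrite exprD -(expr2AC m) -(expr2AC n) -exprMn.
have h0 : s ^+ m * s ^+ n != 0 by rewrite mulf_neq0 ?expf_neq0.
have -> : (a * (s ^+ 2) ^+ (i + j)) ^+ 2 = a ^+ 2 * (s ^+ 2) ^+ (2 * i) * (s ^+ 2) ^+ (2 * j).
  have E2 : ((s ^+ 2) ^+ (i + j)) ^+ 2 = (s ^+ 2) ^+ (2 * i) * (s ^+ 2) ^+ (2 * j).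
    by rewrite -exprD -[LHS]exprM; congr (_ ^+ _); lia.
  by rewrite exprMn E2 mulrA.
have d0 : (s ^+ 2) ^+ (2 * i) - (s ^+ 2) ^+ (2 * j) != 0.
  rewrite subr_eq0 (inj_eq (nonroot_inj sr)); lia.
move: (s ^+ m * s ^+ n) h0 ((s ^+ 2) ^+ (2 * i)) ((s ^+ 2) ^+ (2 * j)) (Q0 (2 * i)) (Q0 (2 * j)) d0.
move=> h h0 x y x0 y0 d0.
have -> : a * x / h ^+ 2 + h ^+ 2 / (a * x) - (a * y / h ^+ 2 + h ^+ 2 / (a * y)) =
  (x - y) * (a ^+ 2 * x * y - (h ^+ 2) ^+ 2) / (a * h ^+ 2 * x * y).
  by field; rewrite a0 h0 x0 y0.
have D0 : (a * h ^+ 2 * x * y)^-1 != 0 by rewrite invr_eq0 !mulf_neq0 ?expf_neq0.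
by rewrite mulf_eq0 (negPf D0) orbF mulf_eq0 (negPf d0).
Qed.

(** By [theta_neq], two eigenvalues coincide when [a] or [-a] is [q^(m + n - (i + j))]. *)
Lemma uniq_thetaP m n a : a != 0 ->
  uniq (map (theta m n s a) (iota 0 (m + n).+1)) <->
  forall k : int, `|k| <= (m + n)%:Z - 1 -> a != (s ^+ 2) ^ k /\ - a != (s ^+ 2) ^ k.
Proof.
move=> a0; set N := (m + n)%N; split=> [U k kN|H].
  suff sq : a ^+ 2 != ((s ^+ 2) ^ k) ^+ 2.
    by split; apply: contraNneq sq => <-; rewrite ?sqrrN.
  have [p pE] : exists p : nat, p%:Z = N%:Z - k by exists `|N%:Z - k|%N; lia.
  (* The bound on [k] says [1 <= p <= 2N - 1], the range of the sums of two distinct indices up to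
     [N]. *)
  have [i [j [ij jN ijp]]] : exists i j, [/\ (i < j)%N, (j <= N)%N & (i + j = p)%N].
    have [pN|Np] := leqP p N; first by exists 0%N, p; split; lia.
    by exists (p - N)%N, N; split; lia.
  have ne : theta m n s a i != theta m n s a j.
    have := U; set th := map _ _ => Uth.
    have thE l : (l <= N)%N -> theta m n s a l = th`_l.
      by move=> lN; rewrite (nth_map 0%N) ?size_iota // nth_iota.
    rewrite !thE ?nth_uniq ?size_map ?size_iota //; lia.
  apply: contraNneq ne => e; rewrite theta_neq //; last by lia.
  rewrite exprMn e -exprMn ijp; apply/eqP; congr (_ ^+ 2).
  move: (s ^+ 2) q0 => q q0'.
  by rewrite [q ^+ p]exprnP [q ^+ N]exprnP -expfzDr // pE addrC subrK.
rewrite map_inj_in_uniq ?iota_uniq // => i j; rewrite !mem_iota /= !add0n !ltnS => iN jN e.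
apply/eqP; apply/negPn/negP => ij; move/eqP: e; rewrite theta_neq // eqf_sqr.
have kE : (s ^+ 2) ^+ N = (s ^+ 2) ^ (N%:Z - (i + j)%:Z) * (s ^+ 2) ^+ (i + j).
  move: (s ^+ 2) q0 => q q0'.
  by rewrite [q ^+ N]exprnP [q ^+ (i + j)]exprnP -expfzDr // subrK.
have [] : a != (s ^+ 2) ^ (N%:Z - (i + j)%:Z) /\ - a != (s ^+ 2) ^ (N%:Z - (i + j)%:Z).
  by apply: H; move: iN jN ij; rewrite -/N; lia.
rewrite -/N kE => H1 H2 /orP[/eqP/(mulIf (Q0 _)) e|/eqP]; first by rewrite e eqxx in H1.
by rewrite -mulNr => /(mulIf (Q0 _)) e; rewrite e opprK eqxx in H2.
Qed.
End Translation.

Section Positions.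
Variables (F : fieldType) (s u1 u2 : F) (m n : nat).
Hypotheses (sr : nonroot s) (u10 : u1 != 0) (u20 : u2 != 0).
Let q := s ^+ 2.

Lemma general_positionP v v' : v != 0 -> v' != 0 ->
  general_position q m v n v' <->
  forall t, (t < m)%N -> (t < n)%N ->
    v' * q ^+ (2 * t) != v * q ^+ (m + n) /\ v * q ^+ (2 * t) != v' * q ^+ (m + n).
Proof.
move=> v0 v'0; have q0 : q != 0 by case: sr => s0 _; rewrite expf_neq0.
have qi := nonroot_inj sr.
split=> [G t tm tn|]; last exact: position_resonance.
split; apply/negP => /eqP e.
  exact: (resonance_position q0 qi v0 v'0 tm tn e).
apply: (resonance_position q0 qi v'0 v0 tn tm _ (general_positionC G)).
by rewrite [(n + m)%N]addnC.
Qed.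

Lemma general_position_scaled c w w' v v' : c != 0 -> w != 0 -> w' != 0 ->
  v = c * w -> v' = c * w' ->
  general_position q m v n v' <->
  forall t, (t < m)%N -> (t < n)%N ->
    w' * q ^+ (2 * t) != w * q ^+ (m + n) /\ w * q ^+ (2 * t) != w' * q ^+ (m + n).
Proof.
move=> c0 w0 w'0 -> ->; rewrite general_positionP ?mulf_neq0 //.
by split=> H t tm tn; have := H t tm tn; rewrite -!(mulrA c) !(inj_eq (mulfI c0)).
Qed.

(** Once a common scalar is removed from the two strings, equal signs give the first two
    inequalities of [off_res] and opposite signs the last two. *)
Lemma off_resP : off_res m n s u1 u2 <->
  forall e1 e2 : int, e1 \in [:: 1; -1] -> e2 \in [:: 1; -1] ->
    general_position q m ((q / u1 ^+ 2) ^ e1) n ((q / u2 ^+ 2) ^ e2).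
Proof.
have q0 : q != 0 by case: sr => s0 _; rewrite expf_neq0.
have U1 : u1 ^+ 2 != 0 by rewrite expf_neq0.
have U2 : u2 ^+ 2 != 0 by rewrite expf_neq0.
have P : (s ^+ m) ^+ 2 * (s ^+ n) ^+ 2 = q ^+ (m + n).
  by rewrite exprD (exprAC s m 2) (exprAC s n 2).
have Q2 : q ^+ 2 != 0 by rewrite expf_neq0.
have U12 : u1 ^+ 2 * u2 ^+ 2 != 0 by rewrite mulf_neq0.
have G11 := @general_position_scaled (q / (u1 ^+ 2 * u2 ^+ 2)) _ _
  (q / u1 ^+ 2) (q / u2 ^+ 2) _ U2 U1.
have G00 := @general_position_scaled q^-1 _ _ (q / u1 ^+ 2)^-1 (q / u2 ^+ 2)^-1 _ U1 U2.
have G10 := @general_position_scaled (q * u1 ^+ 2)^-1 _ _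
  (q / u1 ^+ 2) (q / u2 ^+ 2)^-1 _ Q2 U12.
have G01 := @general_position_scaled (q * u2 ^+ 2)^-1 _ _
  (q / u1 ^+ 2)^-1 (q / u2 ^+ 2) _ U12 Q2.
have {}G11 := G11 ltac:(by rewrite mulf_neq0 ?invr_eq0)
  ltac:(by field; rewrite u10 u20) ltac:(by field; rewrite u10 u20).
have {}G00 := G00 ltac:(by rewrite invr_eq0)
  ltac:(by field; rewrite q0 u10) ltac:(by field; rewrite q0 u20).
have {}G10 := G10 ltac:(by rewrite invr_eq0 mulf_neq0)
  ltac:(by field; rewrite q0 u10) ltac:(by field; rewrite q0 u10 u20).
have {}G01 := G01 ltac:(by rewrite invr_eq0 mulf_neq0)
  ltac:(by field; rewrite q0 u10 u20) ltac:(by field; rewrite q0 u20).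
split=> [H e1 e2|H].
  have sp t (tm : (t < m)%N) (tn : (t < n)%N) := H t tm tn.
  rewrite !inE => /orP[]/eqP-> /orP[]/eqP->; rewrite ?expr1z ?exprN1.
  - by apply/G11 => t tm tn; have [] := sp t tm tn; rewrite P.
  - by apply/G10 => t tm tn; have [h1 h2 h3 h4] := sp t tm tn; rewrite -P; split=> //; rewrite eq_sym.
  - by apply/G01 => t tm tn; have [h1 h2 h3 h4] := sp t tm tn; rewrite -P; split=> //; rewrite eq_sym.
  - by apply/G00 => t tm tn; have [] := sp t tm tn; rewrite P.
move=> j jm jn; have M1 : 1 \in [:: 1; -1 : int] by [].
have M2 : -1 \in [:: 1; -1 : int] by [].
have := H _ _ M1 M1; rewrite ?expr1z => /G11/(_ j jm jn)[h1 h2].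
have := H _ _ M1 M2; rewrite expr1z exprN1 => /G10/(_ j jm jn)[h3 h4].
by rewrite P /=; split=> //; rewrite eq_sym.
Qed.
End Positions.

Lemma off_stringsP (F : fieldType) (s u a b : F) d :
  nonroot s -> u != 0 -> a != 0 -> b != 0 ->
  off_strings s d u a b <->
  forall x, x \in [:: a * b; a / b] ->
    x \notin qstring (s ^+ 2) d (s ^+ 2 / u ^+ 2)
    /\ x \notin qstring (s ^+ 2) d (s ^+ 2 / u ^+ 2)^-1.
Proof.
move=> sr u0 a0 b0.
have ab0 : a * b != 0 by rewrite mulf_neq0.
have a_b0 : a / b != 0 by rewrite mulf_neq0 ?invr_eq0.
split=> [[h1 h2 h3 h4] x|H].
  rewrite !inE => /orP[]/eqP->; split.
  - exact/(off_stringP sr).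
  - exact/(off_string_invP sr).
  - exact/(off_stringP sr).
  - exact/(off_string_invP sr).
have [|h3 h4] := H (a * b); first by rewrite inE eqxx.
have [|h1 h2] := H (a / b); first by rewrite !inE eqxx orbT.
by split; do [exact/(off_stringP sr)|exact/(off_string_invP sr)].
Qed.

Theorem proposition4p3 (R : realType) (q s a b u1 u2 : R[i]) (n1 n2 : nat)
    (q_neq0 : q != 0)
    (q_not_root : forall k : nat, (0 < k)%N -> q ^+ k != 1)
    (s_sqrt_q : s ^+ 2 = q)
    (a_neq0 : a != 0) (b_neq0 : b != 0) (u1_neq0 : u1 != 0) (u2_neq0 : u2 != 0) :
  (qRacah_tridiagonal_pair q (A12 n1 n2 s u1 u2 a) (B21 n1 n2 s u1 u2 b)
   /\ qRacah_tridiagonal_pair q (A21 n1 n2 s u1 u2 a) (B12 n1 n2 s u1 u2 b))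
  <->
  [/\ forall e1 e2 : int, e1 \in [:: 1; -1] -> e2 \in [:: 1; -1] ->
        general_position q n1 ((q / u1 ^+ 2) ^ e1) n2 ((q / u2 ^+ 2) ^ e2),
      forall n u, (n, u) \in [:: (n1, u1); (n2, u2)] ->
        forall x, x \in [:: a * b; a / b] ->
          x \notin qstring q n (q / u ^+ 2)
          /\ x \notin qstring q n (q / u ^+ 2)^-1
    & forall k : int, `|k| <= (n1 + n2)%:Z - 1 ->
        [/\ a != q ^ k, - a != q ^ k, b != q ^ k & - b != q ^ k]].
Proof.
subst q; have sr : nonroot s.
  by split=> //; apply: contraNneq q_neq0 => ->; rewrite expr0n.
(* The condition on [b] comes with [s^-1], hence with [k] negated; the range of [k] is symmetric. *)
have sVk k : (s^-1 ^+ 2) ^ k = (s ^+ 2) ^ (- k) by rewrite exprVn exprz_inv.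
rewrite tridiagonal_pairs_iff //; split=> [[S1 S2 Q U V]|[G S U]].
  split; first exact/off_resP.
    move=> n u; rewrite !inE => /orP[]/eqP[-> ->]; exact/off_stringsP.
  move=> k k_small; have [h1 h2] := (uniq_thetaP sr n1 n2 a_neq0).1 U k k_small.
  have := (uniq_thetaP (nonroot_inv sr) n1 n2 b_neq0).1 V (- k).
  by rewrite normrN => /(_ k_small); rewrite sVk opprK => -[h3 h4].
split; last 2 first.
- by apply/(uniq_thetaP sr) => // k /U[].
- apply/(uniq_thetaP (nonroot_inv sr)) => // k k_small.
  by rewrite sVk; have [] := U (- k); rewrite ?normrN.
- by apply/off_stringsP => //; apply: S; rewrite inE eqxx.
- by apply/off_stringsP => //; apply: S; rewrite !inE eqxx orbT.
- exact/off_resP.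
Qed.
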